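(* Let $\mathrm{II}^w$ be the second fundamental form of $\partial\Omega$ defined with respect to the metric $w$, and fix a point $x_0\in\partial\Omega$. If $\mathrm{II}^{\partial[\Omega]_{T(x_0)}}$ and $\mathrm{II}^{\partial[\bar\Omega]_{x_0}}$ are the (Euclidean) second fundamental forms of $\partial[\Omega]_{T(x_0)}$ and $\partial[\bar\Omega]_{x_0}$ respectively, then for any $\tau_1,\tau_2\in T_{x_0}\partial\Omega$, $$2|\beta(x_0)|_w\,\mathrm{II}^w_{x_0}(\tau_1,\tau_2)=|DT(x_0)\beta(x_0)|\,\mathrm{II}^{\partial[\Omega]_{T(x_0)}}_{-\overline Dc(x_0,T(x_0))}(\hat\tau_1,\hat\tau_2)+|\beta(x_0)|\,\mathrm{II}^{\partial[\bar\Omega]_{x_0}}_{-Dc(x_0,T(x_0))}(\hat{\overline\tau}_1,\hat{\overline\tau}_2),$$ where $$\hat\tau_i:=-D\overline Dc(x_0,T(x_0))\,\tau_i\in T^*_{T(x_0)}\bar\Omega,\qquad \hat{\overline\tau}_i:=-\overline DDc(x_0,T(x_0))\,DT(x_0)\tau_i\in T^*_{x_0}\Omega .$$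
   Context: In this statement $\Omega$ and $\bar\Omega$ denote the source and target domains ($\bar\Omega$ is NOT the closure of $\Omega$), which are open, smooth, bounded domains in fixed $n$-dimensional Riemannian manifolds; points of $\bar\Omega$ are written with a bar. The inner products and norms of the underlying Riemannian metrics are $\langle\cdot,\cdot\rangle$ and $|\cdot|$, and the cotangent spaces are identified metrically with $\mathbb{R}^n$ through these metrics. Cost and sign convention (minimization convention): $c$ is a $C^{4,\alpha}$ cost on the product of the closures of $\Omega$ and $\bar\Omega$, and $dc=Dc\oplus\overline Dc$ is the splitting of the one-form $dc$ on $\Omega\times\bar\Omega$ according to the product structure ($D$ differentiates in $x$, $\overline D$ in $\bar x$). Bi-twist condition: for each $x$ in the closure of $\Omega$ the map $\bar x\mapsto-Dc(x,\bar x)$ is a diffeomorphism onto its image, and for each $\bar x$ in the closure of $\bar\Omega$ the map $x\mapsto-\overline Dc(x,\bar x)$ is a diffeomorphism onto its image. $Y(x,p)$ is the unique point with $-Dc(x,Y(x,p))=p$. For $(x,\bar x)$, set $$[\Omega]_{\bar x}:=-\overline Dc(\Omega,\bar x)\subset T^*_{\bar x}\bar\Omega,\qquad[\bar\Omega]_x:=-Dc(x,\bar\Omega)\subset T^*_x\Omega .$$ Potential and map: fix a time $t$ and let $u=u(\cdot,t)$ be the time slice of a solution in $C^4_xC^2_t$ (that is, $C^4$ in space and $C^2$ in time) of the parabolic optimal transport problem; in the present sign convention, in local coordinates, $\partial_tu=\log\det[u_{ij}+c_{ij}(x,T(x))]-\log B(x,\nabla u)$ in $\Omega$ where $T(x)=Y(x,\nabla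 u(x))$, $B(x,p)=|\det(D\overline Dc)(x,Y(x,p))|\,\rho(x)/\rho^*(Y(x,p))$ and $\rho,\rho^*$ are the densities of the source and target measures (bounded between positive constants, with equal total mass), with boundary condition $h^*(T(x))=0$ on $\partial\Omega$, and with initial condition $u_0\in C^{4,\alpha}$ such that the matrix $(u_0)_{ij}(x)+c_{ij}(x,T_0(x))$ is positive definite on the closure of $\Omega$, $h^*(T_0)=0$ on $\partial\Omega$ and $T_0(\Omega)=\bar\Omega$, where $T_0(x)=Y(x,\nabla u_0(x))$. Here $h^*$ is a defining function for $\bar\Omega$: $h^*=0$ on $\partial\bar\Omega$, $h^*<0$ in $\bar\Omega$, and $\nabla h^*$ equals the outward unit normal on $\partial\bar\Omega$. Set $\beta(x):=\nabla_p\big(h^*(Y(x,p))\big)\big|_{p=\nabla u(x)}$. Metrics: the Kim-McCann pseudo-Riemannian metric on $\Omega\times\bar\Omega$ is $$h:=\frac12\begin{pmatrix}0&-\overline DDc\\-D\overline Dc&0\end{pmatrix},$$ and $w:=(\mathrm{Id}\times T)^*h$ is its pullback to $\Omega$; $w$ is a Riemannian metric whose coefficients at $x$ in Euclidean coordinates are $w_{ij}(x)=u_{ij}(x)+c_{ij}(x,T(x))$. $|\cdot|_w$ is the length with respect to $w$. Second fundamental forms use the convention $\mathrm{II}(\tau_1,\tau_2)=\langle\nabla_{\tau_1}N,\tau_2\rangle$ with $N$ the outward unit normal and with the relevant metric and Levi-Civita connection; the subscript on $\mathrm{II}$ is the boundary point at which it is evaluated. *)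

(* Defs.v *)
From HB Require Import structures.
From mathcomp Require Import all_boot all_order all_algebra.
From mathcomp Require Import all_classical all_reals all_analysis.

Set Implicit Arguments.
Unset Strict Implicit.
Unset Printing Implicit Defensive.

Import Order.TTheory GRing.Theory Num.Theory.
Import numFieldNormedType.Exports.

Local Open Scope classical_set_scope.
Local Open Scope ring_scope.

(* Tangent vectors and covectors are both written as row vectors of components
   in a chart, with pairing [p *m v^T]; a bilinear form B is evaluated as
   [v *m B *m w^T], and a linear map with matrix J acts by [v *m J]. *)

Section DerivativesUpToTheBoundary.
Context {R : realType} {V W : normedModType R}.
Implicit Types (A : set V) (f : V -> W) (x v : V).

(* Derivatives relative to a set A. On an open set these are the usual ones;
   on the closure of a smooth domain they are the derivatives up to the
   boundary, and along a hypersurface they are meaningful in the tangential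
   directions. *)
Definition has_deriv_on A f x (L : V -> W) : Prop :=
  [/\ linear L, continuous L &
      forall e : R, 0 < e ->
        \forall y \near within A (nbhs x),
          `|f y - f x - L (y - x)| <= e * `|y - x|].

Definition differentiable_on A f x : Prop := exists L, has_deriv_on A f x L.

Definition deriv_on A f x : V -> W :=
  xget (fun=> 0) [set L | has_deriv_on A f x L].

Fixpoint class_on (top : (V -> W) -> Prop) (k : nat) A f : Prop :=
  match k with
  | 0 => top f
  | k'.+1 => (forall x, A x -> differentiable_on A f x) /\
             (forall v, class_on top k' A (fun x => deriv_on A f x v))
  end.

Definition Ck_on (k : nat) A f : Prop :=
  class_on (fun g => {within A, continuous g}) k A f.

Definition locally_holder (a : R) A f : Prop :=
  forall x, A x -> exists K : R,
    \forall y \near within A (nbhs x) & z \near within A (nbhs x),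
      `|f y - f z| <= K * `|y - z| `^ a.

Definition Ckalpha_on (k : nat) (a : R) A f : Prop :=
  class_on (locally_holder a A) k A f.

(* For functions of (t, x) in I * A: all x-derivatives of order at most k,
   resp. all t-derivatives of order at most k, are jointly continuous. *)
Fixpoint Ck_space (k : nat) (I : set R) A (f : R -> V -> W) : Prop :=
  {within I `*` A, continuous (fun z : R * V => f z.1 z.2)} /\
  match k with
  | 0 => True
  | k'.+1 =>
      (forall t x, I t -> A x -> differentiable_on A (f t) x) /\
      (forall v, Ck_space k' I A (fun t x => deriv_on A (f t) x v))
  end.

End DerivativesUpToTheBoundary.

Fixpoint Ck_time {R : realType} {V W : normedModType R} (k : nat) (I : set R)
    (A : set V) (f : R -> V -> W) : Prop :=
  {within I `*` A, continuous (fun z : R * V => f z.1 z.2)} /\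
  match k with
  | 0 => True
  | k'.+1 =>
      (forall t x, I t -> A x -> differentiable_on I (fun s => f s x) t) /\
      Ck_time k' I A (fun t x => deriv_on I (fun s => f s x) t 1)
  end.

Section Coordinates.
Context {R : realType} {n : nat}.

Definition grad_on (A : set 'rV[R]_n) (f : 'rV[R]_n -> R) (y : 'rV[R]_n)
    : 'rV[R]_n :=
  \row_k deriv_on A f y (delta_mx 0 k).

Definition jac_on (A : set 'rV[R]_n) (f : 'rV[R]_n -> 'rV[R]_n)
    (y : 'rV[R]_n) : 'M[R]_n :=
  lin1_mx (deriv_on A f y).

Definition hess_on (A : set 'rV[R]_n) (f : 'rV[R]_n -> R) (y : 'rV[R]_n)
    : 'M[R]_n :=
  jac_on A (grad_on A f) y.

Definition bform (B : 'M[R]_n) (v w : 'rV[R]_n) : R := (v *m B *m w^T) 0 0.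

Definition bform_norm (B : 'M[R]_n) (v : 'rV[R]_n) : R := Num.sqrt (bform B v v).

Definition posdef (B : 'M[R]_n) : Prop :=
  B^T = B /\ forall v : 'rV[R]_n, v != 0 -> 0 < bform B v v.

End Coordinates.

Definition boundary {X : topologicalType} (A : set X) : set X :=
  closure A `\` interior A.

Section SecondFundamentalForm.
Context {R : realType} {n : nat}.
Implicit Types (A : set 'rV[R]_n) (G : 'rV[R]_n -> 'M[R]_n).
Implicit Types (p v w N : 'rV[R]_n).

Definition tangent_to (S : set 'rV[R]_n) p v : Prop :=
  exists gamma : R -> 'rV[R]_n,
    [/\ gamma 0 = p, is_derive (0 : R) (1 : R) gamma v &
        \forall s \near (0 : R), S (gamma s)].

Definition outward_unit_normal A G p N : Prop :=
  [/\ bform (G p) N N = 1,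
      forall v, tangent_to (boundary A) p v -> bform (G p) N v = 0 &
      \forall s \near (0 : R)^'+, A (p - s *: N) /\ ~ A (p + s *: N)].

Definition unit_normal A G p : 'rV[R]_n :=
  xget 0 [set N | outward_unit_normal A G p N].

(* Christoffel symbols of the metric G on the closure of A, contracted with
   v and w *)
Definition christoffel A G p v w : 'rV[R]_n :=
  let dG z := deriv_on (closure A) G p z in
  2^-1 *: ((\row_k (bform (dG v) w (delta_mx 0 k) + bform (dG w) v (delta_mx 0 k)
                    - bform (dG (delta_mx 0 k)) v w)) *m invmx (G p)).

Definition second_form A G p v w : R :=
  let N := unit_normal A G in
  bform (G p) (deriv_on (boundary A) N p v + christoffel A G p v (N p)) w.

End SecondFundamentalForm.

Record riemannian_manifold (R : realType) (n : nat) := RiemannianManifold {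
  carrier :> ptopologicalType;
  chart_index : Type;
  chart_dom : chart_index -> set carrier;
  chart : chart_index -> carrier -> 'rV[R]_n;
  chart_inv : chart_index -> 'rV[R]_n -> carrier;
  metric : chart_index -> 'rV[R]_n -> 'M[R]_n;
  carrier_hausdorff : hausdorff_space carrier;
  carrier_countable : @second_countable carrier;
  chart_cover : forall x, exists i, chart_dom i x;
  chart_dom_open : forall i, open (chart_dom i);
  chart_img_open : forall i, open (chart i @` chart_dom i);
  chartK : forall i x, chart_dom i x -> chart_inv i (chart i x) = x;
  chart_continuous : forall i, {within chart_dom i, continuous (chart i)};
  chart_inv_continuous :
    forall i, {within chart i @` chart_dom i, continuous (chart_inv i)};
  chart_smooth : forall i j k,
    Ck_on k (chart i @` (chart_dom i `&` chart_dom j))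
          (fun y => chart j (chart_inv i y));
  metric_smooth : forall i k, Ck_on k (chart i @` chart_dom i) (metric i);
  metric_posdef : forall i x, chart_dom i x -> posdef (metric i (chart i x));
  metric_compat : forall i j x, chart_dom i x -> chart_dom j x ->
    let J := jacobian (fun y => chart j (chart_inv i y)) (chart i x) in
    metric i (chart i x) = J *m metric j (chart j x) *m J^T
}.

Section Manifold.
Context {R : realType} {n : nat} (M : riemannian_manifold R n).

Definition chart_set (i : chart_index M) (A : set M) : set 'rV[R]_n :=
  chart i @` (A `&` chart_dom i).

(* The differential of f at x as a covector, in the chart i; here and below,
   A is the domain of f. *)
Definition dform (A : set M) (f : M -> R) (i : chart_index M) (x : M)
    : 'rV[R]_n :=
  grad_on (chart_set i A) (fun y => f (chart_inv i y)) (chart i x).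

Definition hess (A : set M) (f : M -> R) (i : chart_index M) (x : M)
    : 'M[R]_n :=
  hess_on (chart_set i A) (fun y => f (chart_inv i y)) (chart i x).

Definition metric_at (i : chart_index M) (x : M) : 'M[R]_n :=
  metric i (chart i x).

(* the metric induced on covectors *)
Definition cometric_at (i : chart_index M) (x : M) : 'M[R]_n :=
  invmx (metric_at i x).

Definition smooth_boundary (Om : set M) : Prop :=
  forall x, boundary Om x ->
    exists i (U : set 'rV[R]_n) (r : 'rV[R]_n -> R),
      [/\ chart_dom i x, open U & U (chart i x)] /\
      [/\ forall k, Ck_on k U r,
          grad_on U r (chart i x) != 0 &
          chart_set i Om `&` U = [set y | U y /\ r y < 0]].

Definition smooth_bounded_domain (Om : set M) : Prop :=
  [/\ Om !=set0, open Om & connected Om] /\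
  [/\ compact (closure Om) & smooth_boundary Om].

(* C^1 in both directions; when F is C^k the inverse is then C^k as well. *)
Definition diffeo_onto_image (A : set M) (F : M -> 'rV[R]_n) : Prop :=
  (forall i, Ck_on 1 (chart_set i A) (fun y => F (chart_inv i y))) /\
  exists G : 'rV[R]_n -> M,
    [/\ forall x, A x -> G (F x) = x,
        {within F @` A, continuous G} &
        forall i, Ck_on 1 (F @` (A `&` chart_dom i)) (fun p => chart i (G p))].

Definition defining_function (Om : set M) (h : M -> R) : Prop :=
  (forall i, Ck_on 2 (chart_set i (closure Om)) (fun y => h (chart_inv i y))) /\
  [/\ forall x, Om x -> h x < 0,
      forall x, boundary Om x -> h x = 0 &
      forall i x, chart_dom i x -> boundary Om x ->
        outward_unit_normal (chart_set i Om) (metric i) (chart i x)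
          (dform (closure Om) h i x *m cometric_at i x)].

Definition borel (X : ptopologicalType) := g_sigma_algebraType (@open X).

Definition is_lebesgue (lam : {measure set (borel 'rV[R]_n) -> \bar R})
    : Prop :=
  forall a b : 'rV[R]_n, (forall k, a 0 k <= b 0 k) ->
    lam [set y : 'rV[R]_n | forall k, a 0 k <= y 0 k <= b 0 k] =
    (\prod_k (b 0 k - a 0 k))%:E.

Definition is_riemannian_volume (vol : {measure set (borel M) -> \bar R})
    : Prop :=
  exists lam : {measure set (borel 'rV[R]_n) -> \bar R},
    is_lebesgue lam /\
    forall i (E : set (borel M)), measurable E -> E `<=` chart_dom i ->
      vol E = (\int[lam]_(y in (chart i @` E : set (borel 'rV[R]_n)))
                 (Num.sqrt (\det (metric i y)))%:E)%E.

Definition density_on (Om : set M) (rho : M -> R) : Prop :=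
  measurable_fun (Om : set (borel M)) (rho : borel M -> R) /\
  exists m1 m2 : R, 0 < m1 /\ forall x, Om x -> m1 <= rho x <= m2.

End Manifold.

Arguments metric_at {R n M} i x.
Arguments cometric_at {R n M} i x.

Section OptimalTransport.
Context {R : realType} {n : nat} {M Mb : riemannian_manifold R n}.
Variables (Om : set M) (Omb : set Mb) (c : M -> Mb -> R).

Definition equal_mass (rho : M -> R) (rhos : Mb -> R) : Prop :=
  exists (vol : {measure set (borel M) -> \bar R})
         (volb : {measure set (borel Mb) -> \bar R}),
    [/\ is_riemannian_volume vol, is_riemannian_volume volb &
        (\int[vol]_(x in (Om : set (borel M))) (rho x)%:E =
         \int[volb]_(y in (Omb : set (borel Mb))) (rhos y)%:E)%E].

Definition cost_Ckalpha (k : nat) (a : R) : Prop :=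
  forall i j,
    Ckalpha_on k a (chart_set i (closure Om) `*` chart_set j (closure Omb))
      (fun z : 'rV[R]_n * 'rV[R]_n => c (chart_inv i z.1) (chart_inv j z.2)).

Definition Dc (i : chart_index M) (x : M) (xb : Mb) : 'rV[R]_n :=
  dform (closure Om) (fun y => c y xb) i x.

Definition Dbc (j : chart_index Mb) (x : M) (xb : Mb) : 'rV[R]_n :=
  dform (closure Omb) (c x) j xb.

(* DDbc acts on tangent vectors at x, DbDc on tangent vectors at xb. *)
Definition DDbc (i : chart_index M) (j : chart_index Mb) (x : M) (xb : Mb)
    : 'M[R]_n :=
  jac_on (chart_set i (closure Om))
    (fun y => Dbc j (chart_inv i y) xb) (chart i x).

Definition DbDc (i : chart_index M) (j : chart_index Mb) (x : M) (xb : Mb)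
    : 'M[R]_n :=
  jac_on (chart_set j (closure Omb))
    (fun yb => Dc i x (chart_inv j yb)) (chart j xb).

Definition bi_twist : Prop :=
  (forall i x, chart_dom i x -> closure Om x ->
     diffeo_onto_image (closure Omb) (fun xb => - Dc i x xb)) /\
  (forall j xb, chart_dom j xb -> closure Omb xb ->
     diffeo_onto_image (closure Om) (fun x => - Dbc j x xb)).

(* [Omega]_xb and [Omegabar]_x *)
Definition image_src (A : set M) (j : chart_index Mb) (xb : Mb)
    : set 'rV[R]_n := [set - Dbc j x xb | x in A].

Definition image_tgt (B : set Mb) (i : chart_index M) (x : M)
    : set 'rV[R]_n := [set - Dc i x xb | xb in B].

Definition Ymap (i : chart_index M) (x : M) (p : 'rV[R]_n) : Mb :=
  xget point [set xb | closure Omb xb /\ - Dc i x xb = p].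

(* T = Y(x, grad v(x)) on the closure of Omega *)
Definition transport_map (v : M -> R) (T : M -> Mb) : Prop :=
  forall i x, chart_dom i x -> closure Om x ->
    let p := dform (closure Om) v i x in
    image_tgt (closure Omb) i x p /\ T x = Ymap i x p.

Definition w_matrix (v : M -> R) (T : M -> Mb) (i : chart_index M) (x : M)
    : 'M[R]_n :=
  hess (closure Om) v i x + hess (closure Om) (fun y => c y (T x)) i x.

(* rho and rhos are densities with respect to the Riemannian volumes; the
   factors sqrt(det g) turn them into densities in the charts. *)
Definition rhs_density (rho : M -> R) (rhos : Mb -> R)
    (i : chart_index M) (j : chart_index Mb) (x : M) (xb : Mb) : R :=
  `|\det (DDbc i j x xb)| *
  ((rho x * Num.sqrt (\det (metric_at i x))) /
   (rhos xb * Num.sqrt (\det (metric_at j xb)))).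

Definition initial_condition (a : R) (hs : Mb -> R) (u0 : M -> R)
    (T0 : M -> Mb) : Prop :=
  [/\ forall i, Ckalpha_on 4 a (chart_set i (closure Om))
                  (fun y => u0 (chart_inv i y)),
      transport_map u0 T0,
      forall i x, chart_dom i x -> closure Om x -> posdef (w_matrix u0 T0 i x),
      forall x, boundary Om x -> hs (T0 x) = 0 &
      T0 @` Om = Omb].

Definition parabolic_solution (rho : M -> R) (rhos : Mb -> R) (hs : Mb -> R)
    (tmax : R) (u : R -> M -> R) (T : R -> M -> Mb) : Prop :=
  [/\ forall i,
        Ck_space 4 `[0, tmax[ (chart_set i (closure Om))
          (fun t y => u t (chart_inv i y)) /\
        Ck_time 2 `[0, tmax[ (chart_set i (closure Om))
          (fun t y => u t (chart_inv i y)),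
      forall t, 0 <= t < tmax -> transport_map (u t) (T t),
      forall t x i j, 0 < t < tmax -> Om x ->
        chart_dom i x -> chart_dom j (T t x) ->
        let W := w_matrix (u t) (T t) i x in
        0 < \det W /\
        deriv_on `[0, tmax[ (fun s => u s x) t 1 =
          ln (\det W) - ln (rhs_density rho rhos i j x (T t x)) &
      forall t x, 0 <= t < tmax -> boundary Om x -> hs (T t x) = 0].

Definition DT (T : M -> Mb) (i : chart_index M) (j : chart_index Mb) (x : M)
    : 'M[R]_n :=
  jac_on (chart_set i (closure Om `&` T @^-1` chart_dom j))
    (fun y => chart j (T (chart_inv i y))) (chart i x).

(* In the block formula for h the blocks act on column vectors, hence the
   transpositions. *)
Definition kim_mccann (i : chart_index M) (j : chart_index Mb) (x : M) (xb : Mb)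
    : 'M[R]_(n + n) :=
  2^-1 *: block_mx 0 (- (DbDc i j x xb)^T) (- (DDbc i j x xb)^T) 0.

(* (Id x T)^* h, in the chart i; it does not depend on the chart j of the
   target used to compute it. *)
Definition pullback_metric (T : M -> Mb) (i : chart_index M)
    (j : chart_index Mb) (x : M) : 'M[R]_n :=
  let P := row_mx 1%:M (DT T i j x) in
  P *m kim_mccann i j x (T x) *m P^T.

(* beta is the differential of p |-> hs (Y(x, p)), p in the cotangent space at
   x, so its components are those of a tangent vector at x. *)
Definition beta (hs : Mb -> R) (v : M -> R) (i : chart_index M) (x : M)
    : 'rV[R]_n :=
  grad_on (image_tgt (closure Omb) i x) (fun p => hs (Ymap i x p))
          (dform (closure Om) v i x).

End OptimalTransport.

(* Main.v *)
Require Import Defs.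
From HB Require Import structures.
From mathcomp Require Import all_boot all_order all_algebra.
From mathcomp Require Import all_classical all_reals all_analysis.
From mathcomp Require Import ring lra.

Set Implicit Arguments.
Unset Strict Implicit.
Unset Printing Implicit Defensive.

Import Order.TTheory GRing.Theory Num.Theory.
Import numFieldNormedType.Exports.

Local Open Scope classical_set_scope.
Local Open Scope ring_scope.

(** The identity compares three normal fields along the boundary, which all come
    from the defining function [hs] of the target. Write [J = DT], [K = DbDc] at
    [(x, T x)], [w] for the metric and [b] for [beta].

    - Differentiating [- Dc x (T x) = Du x] gives [w = - J K] ([w_matrix_DT]).
    - Differentiating [hs (Y x p)] gives [b K^T = - dhs] ([beta_eq]). Together,
      [b w] is the differential of [hs o T], which is negative inside and vanishes
      on the boundary: [b] is an outward normal field for [w] ([beta_dual]).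
    - The image of the source under [- Dbc _ y0] has conormal field [nu] with
      [- nu K (x, y0) = b w], whose value at [x0] is [b J].
    - The image of the target under [- Dc x0] has conormal field [nub] with
      [- nub K (x0, y)^T = dhs], whose value at [y0] is [b].

    The length of the normal field times the second fundamental form is computed
    by differentiating the field in a tangent direction. For [w] this produces,
    in addition, the Christoffel symbols: with [v], [e] tangent and [Lb], [dw],
    [DxK] the derivatives of [b], of [w] and of [K] in its first point,

      [2 |b| II^w (v, e) = 2 w (Lb v, e) + dw v (b, e) + dw b (v, e) - dw e (v, b)]

    ([metric_form_eval]). The two images lie in a flat space, where differentiating
    the equations of [nu] and [nub] gives

      [w (Lb v, e) + dw v (b, e) + DxK v (b J, e)] and
      [w (Lb v, e) - DxK v (e J, b)]

    ([source_image_form_eval], [target_image_form_eval]). The sum is the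
    first expression because
    [dw b (v, e) - dw e (v, b) = DxK v (b J, e) - DxK v (e J, b)]
    ([hd_w_matrix_swap]): as [w = D^2 u + Dxx c (x, T x)], the terms with three
    derivatives in [x] are symmetric and cancel, and the others arise from the
    motion of [T].

    To make sense of this on the boundary, derivatives are taken relative to the
    closed domain. They are unique, and mixed derivatives commute ([schwarz]),
    because near each boundary point the domain contains a cone. The
    boundary of an image, its tangent vectors and its inward directions are
    recovered from those of the domain ([image_boundary], [image_conormal]) by
    minimising a distance, as no extension across the boundary is at hand.
    Finally [w] is positive definite up to the boundary ([w_posdef]): it is so at
    time 0, and its determinant, controlled by the parabolic equation, never
    vanishes. This also shows that [T] maps the interior to the interior, and that
    [DT] is invertible. *)

(** * Derivatives relative to a set *)

Section RawLinear.
Context {R : realType} {V W : normedModType R}.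
Implicit Types (L : V -> W).

Lemma linD L : linear L -> forall x y, L (x + y) = L x + L y.
Proof. by move=> h x y; have := h 1 x y; rewrite !scale1r. Qed.

Lemma lin0 L : linear L -> L 0 = 0.
Proof. by move=> h; apply: (addrI (L 0)); rewrite -linD// !addr0. Qed.

Lemma linZ L : linear L -> forall a x, L (a *: x) = a *: L x.
Proof. by move=> h a x; have := h a x 0; rewrite lin0// !addr0. Qed.

Lemma linN L : linear L -> forall x, L (- x) = - L x.
Proof. by move=> h x; rewrite -scaleN1r linZ// scaleN1r. Qed.

Lemma linB L : linear L -> forall x y, L (x - y) = L x - L y.
Proof. by move=> h x y; rewrite linD// linN. Qed.

Lemma lin_sum L : linear L -> forall (I : Type) (s : seq I) (F : I -> V),
  L (\sum_(i <- s) F i) = \sum_(i <- s) L (F i).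
Proof.
move=> h I s F; elim: s => [|a s IH]; first by rewrite !big_nil lin0.
by rewrite !big_cons linD// IH.
Qed.

Lemma near_withinP (A : set V) (x : V) (P : V -> Prop) :
  (\forall y \near within A (nbhs x), P y) <->
  exists2 d : R, 0 < d & forall y, A y -> `|y - x| < d -> P y.
Proof.
split.
  rewrite near_withinE => /nbhs_normP[d d0 h]; exists d => // y Ay yx.
  by apply: h => //; rewrite /ball_ /= distrC.
move=> [d d0 h]; rewrite near_withinE; apply/nbhs_normP; exists d => // y.
by rewrite /ball_ /= distrC => yx Ay; apply: h.
Qed.

Lemma lin_bound L : linear L -> continuous L ->
  exists2 C : R, 0 < C & forall v, `|L v| <= C * `|v|.
Proof.
move=> hL cL; have /cvgrPdist_lt/(_ 1 ltr01) := cL 0.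
move/nbhs_normP => [d /= d0 h].
have h' v : `|v| < d -> `|L v| < 1.
  by move=> vd; have := h v; rewrite /ball_ /= sub0r normrN lin0// sub0r normrN; exact.
exists (2 / d); first by rewrite divr_gt0.
move=> v; have [->|v0] := eqVneq v 0; first by rewrite lin0// !normr0 mulr0.
have nv : 0 < `|v| by rewrite normr_gt0.
have [k k0 kE] : exists2 k, 0 < k & k = d / 2 / `|v|.
  by exists (d / 2 / `|v|) => //; rewrite !divr_gt0.
have := h' (k *: v); rewrite linZ// !normrZ (gtr0_norm k0).
rewrite {1}kE divfK ?gt_eqF// ltr_pdivrMr// ltr_pMr// ltr1n => /(_ erefl) kl.
rewrite -(ler_pM2l k0) (le_trans (ltW kl))// kE.
suff -> : d / 2 / `|v| * (2 / d * `|v|) = 1 by [].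
by field; rewrite !gt_eqF.
Qed.

End RawLinear.

Lemma near_and (T : topologicalType) (A : set T) (x : T) (P Q : T -> Prop) :
  (\forall y \near within A (nbhs x), P y) ->
  (\forall y \near within A (nbhs x), Q y) ->
  \forall y \near within A (nbhs x), P y /\ Q y.
Proof. exact: filterS2. Qed.

Section Calculus.
Context {R : realType}.
Implicit Types V W : normedModType R.

Lemma hd_lin {V W} (A : set V) (f : V -> W) x L : has_deriv_on A f x L -> linear L.
Proof. by case. Qed.

Lemma hd_eq {V W} (A A' : set V) (f g : V -> W) x L :
  (\forall y \near x, A' y -> A y) ->
  (\forall y \near x, A' y -> g y = f y) -> g x = f x ->
  has_deriv_on A f x L -> has_deriv_on A' g x L.
Proof.
move=> hA hf fx [lL cL h]; split=> // e e0.
have := h e e0; rewrite !near_withinE fx.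
move: hA hf; apply: filterS3 => y h1 h2 h3 A'y.
by rewrite h2//; exact/h3/h1.
Qed.

Lemma hd_sub {V W} (A A' : set V) (f : V -> W) x L :
  A' `<=` A -> has_deriv_on A f x L -> has_deriv_on A' f x L.
Proof. by move=> s; apply: hd_eq => //; apply: nearW => // y; exact: s. Qed.

Lemma hd_lip {V W} (A : set V) (f : V -> W) x L : has_deriv_on A f x L ->
  exists2 C : R, 0 < C &
    \forall y \near within A (nbhs x), `|f y - f x| <= C * `|y - x|.
Proof.
move=> [lL cL h]; have [C C0 hC] := lin_bound lL cL.
exists (C + 1); first by rewrite addr_gt0.
have := h 1 ltr01; apply: filterS => y hy.
rewrite -(subrK (L (y - x)) (f y - f x)) (le_trans (ler_normD _ _))//.
by rewrite mulrDl addrC lerD.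
Qed.

Lemma hd_cts {V W} (A : set V) (f : V -> W) x L : has_deriv_on A f x L ->
  f @ within A (nbhs x) --> f x.
Proof.
move=> /hd_lip[C C0 /near_withinP[d d0 h]].
apply/cvgrPdist_lt => e e0; apply/near_withinP; exists (Num.min d (e / (C + 1))).
  by rewrite lt_min d0 divr_gt0// addr_gt0.
move=> y Ay; rewrite lt_min => /andP[yd ye].
rewrite distrC (le_lt_trans (h _ Ay yd))//.
rewrite ltr_pdivlMr ?addr_gt0// in ye.
apply: le_lt_trans ye; rewrite mulrC ler_wpM2l//.
by rewrite lerDl.
Qed.

Lemma hd_cst {V W} (A : set V) (k : W) x : has_deriv_on A (fun _ : V => k) x (fun=> 0).
Proof.
split; [by move=> a u v; rewrite scaler0 addr0|by move=> y; exact: cvg_cst|].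
by move=> e e0; apply: nearW => y; rewrite !subrr normr0 mulr_ge0// ltW.
Qed.

Lemma hd_clin {V W} (A : set V) (L : V -> W) x :
  linear L -> continuous L -> has_deriv_on A L x L.
Proof.
move=> lL cL; split=> // e e0; apply: nearW => y.
by rewrite -linB// subrr normr0 mulr_ge0// ltW.
Qed.

Lemma hd_id {V} (A : set V) (x : V) : has_deriv_on A id x id.
Proof. by apply: hd_clin => // y. Qed.

Lemma hd_comp {V W} {Z : normedModType R} (A : set V) (B : set W) (f : V -> W)
    (g : W -> Z) x L L' :
  (\forall y \near x, A y -> B (f y)) ->
  has_deriv_on A f x L -> has_deriv_on B g (f x) L' ->
  has_deriv_on A (g \o f) x (L' \o L).
Proof.
move=> AB hf [lL' cL' hg]; have [lL cL hf'] := hf.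
split.
- by move=> a u v /=; rewrite lL lL'.
- by move=> v; apply: continuous_comp; [exact: cL|exact: cL'].
move=> e e0; have [C C0 hC] := hd_lip hf; have [D D0 hD] := lin_bound lL' cL'.
have e1 : 0 < e / (2 * C) by rewrite divr_gt0// mulr_gt0.
have e2 : 0 < e / (2 * D) by rewrite divr_gt0// mulr_gt0.
have := hg _ e1; rewrite near_withinE => hg1.
have := hd_cts hf; move=> cf.
have {}hg1 : \forall y \near within A (nbhs x), B (f y) ->
    `|g (f y) - g (f x) - L' (f y - f x)| <= e / (2 * C) * `|f y - f x|.
  exact: (cf _ hg1).
have AB' : \forall y \near within A (nbhs x), B (f y) by [].
have n1 := near_and hC hg1; have n2 := near_and AB' (hf' _ e2); move: n1 n2.
apply: filterS2 => y [E1 E3'] [Bf E2] /=.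
have E3 := E3' Bf.
have E4 := hD (f y - f x - L (y - x)).
rewrite linB// in E4.
have -> : g (f y) - g (f x) - L' (L (y - x)) =
  (g (f y) - g (f x) - L' (f y - f x)) + (L' (f y - f x) - L' (L (y - x))).
  by rewrite addrA subrK.
rewrite (le_trans (ler_normD _ _))//.
have F1 : e / (2 * C) * `|f y - f x| <= e / 2 * `|y - x|.
  rewrite (le_trans (ler_wpM2l (ltW e1) E1))// mulrA ler_wpM2r//.
  by rewrite invfM mulrA divfK ?gt_eqF.
have F2 : D * `|f y - f x - L (y - x)| <= e / 2 * `|y - x|.
  rewrite (le_trans (ler_wpM2l (ltW D0) E2))// mulrA ler_wpM2r//.
  by rewrite mulrC invfM mulrA divfK ?gt_eqF.
have := le_trans E3 F1; have := le_trans E4 F2.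
move: (`|y - x|) => a h1 h2; lra.
Qed.

Lemma hd_add {V W} (A : set V) (f g : V -> W) x L L' :
  has_deriv_on A f x L -> has_deriv_on A g x L' ->
  has_deriv_on A (fun y => f y + g y) x (fun v => L v + L' v).
Proof.
move=> [lL cL hf] [lL' cL' hg]; split.
- by move=> a u v; rewrite lL lL' scalerDr addrACA.
- by move=> v; apply: cvgD; [exact: cL|exact: cL'].
move=> e e0; have e2 : 0 < e / 2 by rewrite divr_gt0.
move: (hf _ e2) (hg _ e2); apply: filterS2 => y h1 h2.
have -> : f y + g y - (f x + g x) - (L (y - x) + L' (y - x)) =
  (f y - f x - L (y - x)) + (g y - g x - L' (y - x)).
  by rewrite (opprD (f x)) (addrACA (f y)) (opprD (L _)) [RHS]addrACA.
rewrite (le_trans (ler_normD _ _))// (le_trans (lerD h1 h2))//.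
by rewrite -mulrDl -splitr.
Qed.

Lemma hd_post {V W} {Z : normedModType R} (A : set V) (f : V -> W)
    (g : W -> Z) x L :
  linear g -> continuous g -> has_deriv_on A f x L ->
  has_deriv_on A (fun y => g (f y)) x (fun v => g (L v)).
Proof.
move=> lg cg hf; apply: (@hd_comp _ _ _ A setT f g x L g) => //.
  exact: nearW.
exact: hd_clin.
Qed.

Lemma hd_opp {V W} (A : set V) (f : V -> W) x L :
  has_deriv_on A f x L -> has_deriv_on A (fun y => - f y) x (fun v => - L v).
Proof.
apply: (@hd_post V W W A f (fun z => - z)); first by move=> a u v; rewrite opprD scalerN.
by move=> z; exact: opp_continuous.
Qed.

Lemma hd_sum {V W} (I : Type) (s : seq I) (A : set V) (f : I -> V -> W) x L :
  (forall i, has_deriv_on A (f i) x (L i)) ->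
  has_deriv_on A (fun y => \sum_(i <- s) f i y) x (fun v => \sum_(i <- s) L i v).
Proof.
move=> h; elim: s => [|a s IH].
  under eq_fun do rewrite big_nil.
  under [X in has_deriv_on _ _ _ X]eq_fun do rewrite big_nil.
  exact: hd_cst.
under eq_fun do rewrite big_cons.
under [X in has_deriv_on _ _ _ X]eq_fun do rewrite big_cons.
exact: hd_add.
Qed.

Lemma hd_mul {V} (A : set V) (f g : V -> R) x (L L' : V -> R) :
  has_deriv_on A f x L -> has_deriv_on A g x L' ->
  has_deriv_on A (fun y => f y * g y) x (fun v => L v * g x + f x * L' v).
Proof.
move=> hf hg; have [lL cL hf'] := hf; have [lL' cL' hg'] := hg; split.
- move=> a u v; rewrite lL lL'.
  have sE (b d : R) : b *: d = b * d by [].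
  rewrite !sE; ring.
- move=> v; apply: cvgD.
    by apply: cvgM; [exact: cL|exact: cvg_cst].
  by apply: cvgM; [exact: cvg_cst|exact: cL'].
move=> e e0; have [C C0 hC] := hd_lip hf.
have [D D0 hD] := lin_bound lL cL; have [E E0 hE] := hd_lip hg.
have CE : 0 <= C * E by rewrite mulr_ge0// ltW.
have [K K0 K1] : exists2 K : R, 0 < K & `|f x| + `|g x| + C * E <= K.
  exists (`|f x| + `|g x| + C * E + 1); last by rewrite lerDl.
  by rewrite ltr_wpDl// !addr_ge0.
have ek : 0 < e / (4 * K) by rewrite divr_gt0// mulr_gt0.
have hd : 0 < e / (4 * C * E) by rewrite divr_gt0// !mulr_gt0.
have hs : \forall y \near within A (nbhs x), `|y - x| <= e / (4 * C * E).
  apply/near_withinP; exists (e / (4 * C * E)) => // y _; exact: ltW.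
have n1 := near_and (hf' _ ek) (hg' _ ek); have n2 := near_and hC hE; move: n1 n2 hs.
apply: filterS3 => y [h1 h2] [h3 h4] h5.
have -> : f y * g y - f x * g x - (L (y - x) * g x + f x * L' (y - x)) =
  (f y - f x - L (y - x)) * g x + f x * (g y - g x - L' (y - x)) +
  (f y - f x) * (g y - g x) by ring.
rewrite (le_trans (ler_normD _ _))// (le_trans (lerD (ler_normD _ _) (lexx _)))//.
rewrite !normrM.
have hK (b : R) : b <= K -> e / (4 * K) * b <= e / 4.
  move=> bK; rewrite mulrAC ler_pdivrMr ?mulr_gt0//.
  have -> : e / 4 * (4 * K) = e * K by field.
  by rewrite ler_wpM2l// ltW.
have fx0 := normr_ge0 (f x); have gx0 := normr_ge0 (g x).
have a1 : `|f y - f x - L (y - x)| * `|g x| <= e / 4 * `|y - x|.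
  rewrite (le_trans (ler_wpM2r _ h1))// mulrAC ler_wpM2r// hK//; lra.
have a2 : `|f x| * `|g y - g x - L' (y - x)| <= e / 4 * `|y - x|.
  rewrite (le_trans (ler_wpM2l _ h2))// mulrA ler_wpM2r// mulrC hK//; lra.
have a3 : `|f y - f x| * `|g y - g x| <= e / 4 * `|y - x|.
  rewrite (le_trans (ler_pM _ _ h3 h4))// mulrACA mulrA ler_wpM2r//.
  rewrite (le_trans (ler_wpM2l (mulr_ge0 (ltW C0) (ltW E0)) h5))//.
  rewrite mulrA ler_pdivrMr ?mulr_gt0//.
  suff -> : e / 4 * (4 * C * E) = C * E * e by [].
  by field.
have := mulr_ge0 (ltW e0) (normr_ge0 (y - x)).
move: (`|y - x|) a1 a2 a3 => a a1 a2 a3; lra.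
Qed.

End Calculus.

(** * Derivatives of matrix-valued functions *)

Section MatrixCalculus.
Context {R : realType}.
Implicit Types V W : normedModType R.

Lemma mx_norm_leP m n (M : 'M[R]_(m, n)) (e : R) : 0 <= e ->
  (forall i j, `|M i j| <= e) <-> `|M| <= e.
Proof.
move=> e0; rewrite {2}/Num.Def.normr /= mx_normrE; split=> [h|h i j].
  by apply: bigmax_le => // -[i j] _ /=.
apply: le_trans h; exact: (le_bigmax 0 (fun ij : 'I_m * 'I_n => `|M ij.1 ij.2|) (i, j)).
Qed.

Lemma mx_norm_entry m n (M : 'M[R]_(m, n)) i j : `|M i j| <= `|M|.
Proof. by have /(_ (normr_ge0 _))[_ /(_ (lexx _))] := @mx_norm_leP m n M `|M|. Qed.

Lemma lin_cts {V W} (L : V -> W) (C : R) : linear L ->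
  (forall v, `|L v| <= C * `|v|) -> continuous L.
Proof.
move=> lL h x; apply/cvgrPdist_lt => e e0; apply/nbhs_normP.
have C0 : 0 < `|C| + 1 by rewrite ltr_wpDl.
exists (e / (`|C| + 1)); first by rewrite /= divr_gt0.
move=> y; rewrite /ball_ /= ltr_pdivlMr// => hy.
rewrite -linB// (le_lt_trans (h _))// (le_lt_trans _ hy)// mulrC ler_wpM2l//.
by rewrite (le_trans (ler_norm C))// lerDl.
Qed.

Lemma lin_mx_sum {W} m n (L : 'M[R]_(m, n) -> W) M : linear L ->
  L M = \sum_i \sum_j M i j *: L (delta_mx i j).
Proof.
move=> lL; rewrite {1}[M]matrix_sum_delta lin_sum//; apply: eq_bigr => i _.
by rewrite lin_sum//; apply: eq_bigr => j _; rewrite linZ.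
Qed.

Lemma mx_lin_cts {W} m n (L : 'M[R]_(m, n) -> W) : linear L -> continuous L.
Proof.
move=> lL; apply: (@lin_cts _ _ _ (\sum_i \sum_j `|L (delta_mx i j)|)) => // M.
rewrite lin_mx_sum// (le_trans (ler_norm_sum _ _ _))// mulr_suml ler_sum// => i _.
rewrite (le_trans (ler_norm_sum _ _ _))// mulr_suml ler_sum// => j _.
by rewrite normrZ mulrC ler_wpM2l// mx_norm_entry.
Qed.

Lemma hd_entry {V} m n (A : set V) (f : V -> 'M[R]_(m, n)) x L i j :
  has_deriv_on A f x L ->
  has_deriv_on A (fun y => f y i j) x (fun v => L v i j).
Proof.
have lE : linear (fun M : 'M[R]_(m, n) => M i j : R) by move=> a u v; rewrite !mxE.
by apply: (hd_post (g := fun M : 'M[R]_(m, n) => M i j)) => //; exact: mx_lin_cts.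
Qed.

Lemma hd_mxE {V} m n (A : set V) (f : V -> 'M[R]_(m, n)) x
    (L : V -> 'M[R]_(m, n)) :
  (forall i j, has_deriv_on A (fun y => f y i j) x (fun v => L v i j)) ->
  has_deriv_on A f x L.
Proof.
move=> h; have lL : linear L.
  move=> a u v; apply/matrixP => i j; rewrite !mxE.
  by have [l _ _] := h i j; rewrite l.
split=> //.
- have hb (ij : 'I_m * 'I_n) :
      exists C : R, 0 < C /\ forall v, `|L v ij.1 ij.2| <= C * `|v|.
    by have [l c _] := h ij.1 ij.2; have [C C0 hC] := lin_bound l c; exists C.
  have [C hC] := choice hb; apply: (@lin_cts _ _ _ (\sum_ij C ij)) => // v.
  apply/mx_norm_leP.
    by rewrite mulr_ge0// sumr_ge0// => ij _; rewrite ltW//; case: (hC ij).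
  move=> i j; have [C0 h1] := hC (i, j); rewrite (le_trans (h1 v))// ler_wpM2r//.
  rewrite (bigD1 (i, j))//= lerDl sumr_ge0// => ij _.
  by rewrite ltW//; case: (hC ij).
move=> e e0.
have : \forall y \near within A (nbhs x), forall ij : 'I_m * 'I_n,
    `|f y ij.1 ij.2 - f x ij.1 ij.2 - L (y - x) ij.1 ij.2| <= e * `|y - x|.
  by apply: filter_forall => ij; have [_ _] := h ij.1 ij.2; apply.
apply: filterS => y hy; apply/mx_norm_leP; first by rewrite mulr_ge0// ltW.
by move=> i j; rewrite !mxE; exact: (hy (i, j)).
Qed.

Lemma hd_mulmx {V} m n p (A : set V) (f : V -> 'M[R]_(m, n))
    (g : V -> 'M[R]_(n, p)) x L L' :
  has_deriv_on A f x L -> has_deriv_on A g x L' ->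
  has_deriv_on A (fun y => f y *m g y) x (fun v => L v *m g x + f x *m L' v).
Proof.
move=> hf hg; apply: hd_mxE => i j.
under eq_fun do rewrite mxE.
under [X in has_deriv_on _ _ _ X]eq_fun do rewrite !mxE -big_split.
apply: hd_sum => k; apply: hd_mul; exact: hd_entry.
Qed.

Lemma hd_tr {V} m n (A : set V) (f : V -> 'M[R]_(m, n)) x L :
  has_deriv_on A f x L -> has_deriv_on A (fun y => (f y)^T) x (fun v => (L v)^T).
Proof.
apply: (hd_post (g := @trmx _ _ _)); first by move=> a u v; rewrite linearP.
by apply: mx_lin_cts => a u v; rewrite linearP.
Qed.

(** The bridge to the derivative of curves on an open set of times, in which
    tangent vectors are defined; [hd_of_is_derive] is the way back. *)
Lemma hd_is_derive {W} (A : set R) (g : R -> W) x L :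
  (\forall s \near x, A s) -> has_deriv_on A g x L -> is_derive x 1 g (L 1).
Proof.
move=> nA [lL cL h]; suff H : (fun h => h^-1 *: ((g \o shift x) (h *: (1:R)) - g x)) @ 0^' --> L 1.
  by split; [apply/cvg_ex; exists (L 1)|exact/cvg_lim].
apply/cvgrPdist_le => e e0.
have := h e e0; rewrite near_withinE => he.
have {he} : \forall y \near x, `|g y - g x - L (y - x)| <= e * `|y - x|.
  by move: nA he; apply: filterS2 => y Ay; exact.
move=> /nbhs_normP[d /= d0 hd]; rewrite near_withinE; apply/nbhs_normP.
exists d => // s; rewrite /ball_ /= sub0r normrN => sd s0.
have := hd (s + x); rewrite /ball_ /= opprD addrCA subrr addr0 normrN => /(_ sd).
rewrite addrK /shift /= => H.
have -> : L 1 = s^-1 *: L s by rewrite -linZ// /GRing.scale /= mulVf.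
have sE : s *: (1 : R) = s by rewrite /GRing.scale /= mulr1.
rewrite sE -scalerBr normrZ normfV distrC ler_pdivrMl ?normr_gt0// mulrC.
exact: H.
Qed.

Lemma hd_of_is_derive {W} (A : set R) (g : R -> W) (x : R) (d : W) :
  is_derive x 1 g d -> has_deriv_on A g x (fun h => h *: d).
Proof.
move=> [dg gd]; apply: (@hd_sub _ R W setT A) => //.
have lL : linear (fun h : R => h *: d).
  by move=> a u v; rewrite scalerDl scalerA.
split=> //.
  by apply: (@lin_cts _ _ _ `|d|) => // v; rewrite normrZ mulrC.
move=> e e0; have /cvgrPdist_le/(_ e e0) : (fun h => h^-1 *: ((g \o shift x) (h *: (1:R)) - g x)) @ 0^' --> d.
  by rewrite -gd.
move=> H; have /nbhs_normP[r /= r0 hr] : \forall t \near (0 : R), t != 0 ->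
  `|d - t^-1 *: ((g \o shift x) (t *: (1:R)) - g x)| <= e by exact: H.
rewrite near_withinE.
apply/nbhs_normP; exists r => // y; rewrite /ball_ /= => yr _.
have [->|yx] := eqVneq y x; first by rewrite !subrr scale0r subr0 !normr0 mulr0.
have s0 : y - x != 0 by rewrite subr_eq0.
have := hr (y - x); rewrite /ball_ /= sub0r normrN distrC => /(_ yr s0).
have sE (s : R) : s *: (1 : R) = s by rewrite /GRing.scale /= mulr1.
rewrite /shift /= sE subrK => {}H.
have -> : g y - g x - (y - x) *: d = - ((y - x) *: (d - (y - x)^-1 *: (g y - g x))).
  by rewrite scalerBr scalerA mulfV// scale1r opprB.
by rewrite normrN normrZ mulrC [`|x - y|]distrC ler_wpM2r.
Qed.

Lemma hd_line {W} (A : set R) (c v : W) (s : R) :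
  has_deriv_on A (fun s => c + s *: v) s (fun h => h *: v).
Proof.
have lv : linear (fun h : R => h *: v) by move=> a u w; rewrite scalerDl scalerA.
have cv : continuous (fun h : R => h *: v).
  by apply: (@lin_cts _ _ _ `|v|) => // h; rewrite normrZ mulrC.
have := hd_add (hd_cst A c s) (hd_clin A s lv cv).
by under [X in has_deriv_on _ _ _ X -> _]eq_fun do rewrite add0r.
Qed.

Lemma hd_inv {V} (A : set V) (f : V -> R) x L : f x != 0 ->
  has_deriv_on A f x L ->
  has_deriv_on A (fun y => (f y)^-1) x (fun v => L v *: (- (f x) ^- 2)).
Proof.
move=> f0 hf.
have h : is_derive (f x) 1 (fun y : R => y^-1) (- (f x) ^- 2).
  have := @is_deriveV R id (f x) 1 1 f0 (is_derive_id _ _).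
  by rewrite /GRing.scale /= mulr1.
apply: (@hd_comp _ V R R A setT f (fun y : R => y^-1) x L
  (fun h : R => h *: (- (f x) ^- 2))) => //; first exact: nearW.
exact: hd_of_is_derive.
Qed.

Lemma hd_sqrt {V} (A : set V) (f : V -> R) x L : 0 < f x ->
  has_deriv_on A f x L ->
  has_deriv_on A (fun y => Num.sqrt (f y)) x
    (fun v => L v *: (2 * Num.sqrt (f x))^-1).
Proof.
move=> f0 hf.
apply: (@hd_comp _ V R R A setT f (fun y : R => Num.sqrt y) x L
  (fun h : R => h *: (2 * Num.sqrt (f x))^-1)) => //; first exact: nearW.
apply: hd_of_is_derive; exact: is_derive1_sqrt.
Qed.

Lemma diff_eq {V W} (A : set V) (f g : V -> W) x :
  (forall y, g y = f y) -> differentiable_on A f x -> differentiable_on A g x.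
Proof. by move=> /funext ->. Qed.

Lemma diff_prod {V} (I : Type) (s : seq I) (A : set V) (f : I -> V -> R) x :
  (forall i, differentiable_on A (f i) x) ->
  differentiable_on A (fun y => \prod_(i <- s) f i y) x.
Proof.
move=> h; elim: s => [|a s [L IH]].
  under eq_fun do rewrite big_nil.
  by exists (fun=> 0); exact: hd_cst.
have [L' h'] := h a; under eq_fun do rewrite big_cons.
by eexists; exact: hd_mul h' IH.
Qed.

Lemma diff_sum {V} (I : Type) (s : seq I) (A : set V) (f : I -> V -> R) x :
  (forall i, differentiable_on A (f i) x) ->
  differentiable_on A (fun y => \sum_(i <- s) f i y) x.
Proof. by move=> /choice[L h]; eexists; exact: hd_sum h. Qed.

Lemma diff_mx {V} m n (A : set V) (f : V -> 'M[R]_(m, n)) x :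
  (forall i j, differentiable_on A (fun y => f y i j) x) ->
  differentiable_on A f x.
Proof.
move=> h; have /choice[L hL] : forall ij : 'I_m * 'I_n, exists L,
    has_deriv_on A (fun y => f y ij.1 ij.2) x L by move=> ij; exact: h.
exists (fun v => \matrix_(i, j) L (i, j) v); apply: hd_mxE => i j.
under [X in has_deriv_on _ _ _ X]eq_fun do rewrite mxE.
exact: (hL (i, j)).
Qed.

Lemma diff_det {V} n (A : set V) (f : V -> 'M[R]_n) x :
  (forall i j, differentiable_on A (fun y => f y i j) x) ->
  differentiable_on A (fun y => \det (f y)) x.
Proof.
move=> h; rewrite /determinant; apply: diff_sum => s.
suff [L hL] : differentiable_on A (fun y => \prod_i f y i (perm.fun_of_perm s i)) x.
  by eexists; exact: hd_mul (hd_cst A ((-1) ^+ perm.odd_perm s : R) x) hL.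
by apply: diff_prod => i; exact: h.
Qed.

(** Cramer's rule: near a point where the determinant is not 0, the inverse is
    the adjugate divided by the determinant, and both are polynomials in the
    entries. *)
Lemma diff_invmx {V} n (A : set V) (f : V -> 'M[R]_n) x L : f x \in unitmx ->
  has_deriv_on A f x L ->
  differentiable_on A (fun y => invmx (f y)) x.
Proof.
move=> fu hf; have hfe i j : differentiable_on A (fun y => f y i j) x.
  by eexists; exact: hd_entry hf.
have [D hD] := diff_det hfe.
have d0 : \det (f x) != 0 by move: fu; rewrite unitmxE unitfE.
have [Lg hg] : differentiable_on A (fun y => (\det (f y))^-1 *: \adj (f y)) x.
  apply: diff_mx => i j.
  have [Lc hc] : differentiable_on A (fun y => \adj (f y) i j) x.
    apply: (@diff_eq _ _ A (fun y => (-1) ^+ (j + i) * \det (row' j (col' i (f y))))).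
      by move=> y; rewrite mxE.
    have [Ld hd] : differentiable_on A (fun y => \det (row' j (col' i (f y)))) x.
      apply: diff_det => k l; apply: diff_eq (hfe (lift j k) (lift i l)) => y.
      by rewrite !mxE.
    by eexists; exact: hd_mul (hd_cst A ((-1) ^+ (j + i) : R) x) hd.
  apply: (@diff_eq _ _ A (fun y => (\det (f y))^-1 * \adj (f y) i j)).
    by move=> y; rewrite mxE.
  have hi := @hd_inv V A (fun y => \det (f y)) x D d0 hD.
  by eexists; exact: hd_mul hi hc.
exists Lg; move: hg; apply: hd_eq => //; last by rewrite /invmx fu.
  exact: nearW.
have : \forall y \near within A (nbhs x), 0 < `|\det (f y)|.
  by apply: (cvgr_gt `|\det (f x)|); rewrite ?normr_gt0//; apply: cvg_norm; exact: hd_cts hD.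
rewrite near_withinE; apply: filterS => y hy Ay.
by rewrite /invmx unitmxE unitfE -normr_gt0 hy.
Qed.

End MatrixCalculus.

(** * Tangent directions and uniqueness of derivatives *)

Section Fatness.
Context {R : realType}.
Implicit Types V W : normedModType R.

(** [has_deriv_on A f x] constrains a derivative only in the directions in which
    [x] can be approached within [A]. Unlike [tangent_to], a one-sided curve is
    asked for, and it may be discontinuous, so that the notion applies
    to closed domains and is carried by any differentiable map. *)
Definition tdir {V} (A : set V) (x v : V) : Prop :=
  exists gamma : R -> V, (\forall s \near 0^'+, A (gamma s)) /\
    forall e : R, 0 < e ->
      \forall s \near 0^'+, `|gamma s - x - s *: v| <= e * s.

(** Enough tangent directions to determine a linear map, which makes [deriv_on]
    the unique derivative. *)
Definition fat {V} (A : set V) (x : V) : Prop :=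
  exists v0 e, 0 < e /\ forall z, `|z - v0| < e -> tdir A x z.

(** Interior directions: a truncated cone around [v] with apex [x] lies in [A].
    This survives a change of chart and provides the parallelograms on which
    mixed differences are computed. *)
Definition cone_dir {V} (A : set V) (x v : V) : Prop :=
  exists e d : R, [/\ 0 < e, 0 < d &
    forall w s, `|w - v| < e -> 0 < s < d -> A (x + s *: w)].

Definition cone_at {V} (A : set V) (x : V) : Prop := exists v, cone_dir A x v.

Lemma near_right (P : R -> Prop) (d : R) : 0 < d ->
  (forall s, 0 < s < d -> P s) -> \forall s \near 0^'+, P s.
Proof.
move=> d0 h; rewrite near_withinE; apply/nbhs_normP; exists d => // s.
by rewrite /ball_ /= sub0r normrN => sd s0; apply: h; rewrite s0 -[s]gtr0_norm.
Qed.

Lemma tdir_cvg {V} (x v : V) (gamma : R -> V) :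
  (forall e : R, 0 < e -> \forall s \near 0^'+, `|gamma s - x - s *: v| <= e * s) ->
  gamma @ 0^'+ --> x.
Proof.
move=> h; apply/cvgrPdist_lt => e e0.
have H1 := h 1 ltr01.
have C0 : 0 < 1 + `|v| by rewrite ltr_pwDl.
have H2 : \forall s \near (0:R)^'+, 0 < s < e / (1 + `|v|).
  by apply: (@near_right _ (e / (1 + `|v|))); rewrite ?divr_gt0.
move: H1 H2; apply: filterS2 => s H1 /andP[s0]; rewrite ltr_pdivlMr// => H2.
rewrite distrC -(subrK (s *: v) (gamma s - x)).
rewrite (le_lt_trans (ler_normD _ _))// (le_lt_trans _ H2)//.
by rewrite mulrDr mulr1 lerD//; [rewrite (le_trans H1)// mul1r|rewrite normrZ gtr0_norm].
Qed.

Lemma tdir_push {V W} (A : set V) (B : set W) (f : V -> W) x v L :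
  (\forall y \near x, A y -> B (f y)) ->
  has_deriv_on A f x L -> tdir A x v -> tdir B (f x) (L v).
Proof.
move=> AB hf [g [gA hg]]; exists (f \o g); have gx := tdir_cvg hg; split.
  by move: gA (gx _ AB); apply: filterS2 => s As; exact.
move=> e e0; have [C C0 hC] := lin_bound (hd_lin hf) (let: And3 _ c _ := hf in c).
have Cv : 0 < 1 + `|v| by rewrite ltr_pwDl.
have e1 : 0 < e / 2 / (1 + `|v|) by rewrite !divr_gt0.
have e2 : 0 < e / 2 / C by rewrite !divr_gt0.
have [lL cL /(_ _ e1)] := hf; rewrite near_withinE => hf'.
have H0 : \forall s \near (0:R)^'+, 0 < s by apply: (@near_right _ 1) => // s /andP[].
have H1 := gx _ hf'; have H2 := hg _ e2; have H3 := hg _ ltr01.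
near=> s; rewrite /=.
have s0 : 0 < s by near: s.
have As : A (g s) by near: s.
have h1 : `|f (g s) - f x - L (g s - x)| <= e / 2 / (1 + `|v|) * `|g s - x|.
  by move: As; near: s.
have h2 : `|g s - x - s *: v| <= e / 2 / C * s by near: s.
have h3 : `|g s - x - s *: v| <= 1 * s by near: s.
have h4 : `|g s - x| <= s * (1 + `|v|).
  rewrite -(subrK (s *: v) (g s - x)) (le_trans (ler_normD _ _))// mulrDr mulr1.
  by rewrite lerD//; [rewrite (le_trans h3)// mul1r|rewrite normrZ gtr0_norm].
have -> : f (g s) - f x - s *: L v =
    (f (g s) - f x - L (g s - x)) + L (g s - x - s *: v).
  by rewrite (linB lL (g s - x)) (linZ lL) addrA subrK.
rewrite (le_trans (ler_normD _ _))// [e]splitr mulrDl lerD//.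
  rewrite (le_trans h1)// (le_trans (ler_wpM2l (ltW e1) h4))//.
  by rewrite mulrCA divfK ?gt_eqF// mulrC.
rewrite (le_trans (hC _))// (le_trans (ler_wpM2l (ltW C0) h2))//.
have -> : C * (e / 2 / C * s) = e / 2 * s by field; rewrite gt_eqF.
by [].
Unshelve. all: by end_near. Qed.

Lemma tdir_near {V} (A B : set V) x v :
  (\forall y \near x, A y -> B y) -> tdir A x v -> tdir B x v.
Proof. by move=> AB; apply: (@tdir_push _ _ A B id x v id) => //; exact: hd_id. Qed.

Lemma tdir_uniq0 {W} (w w' z : W) (f : R -> W) :
  (forall e : R, 0 < e -> \forall s \near 0^'+, `|f s - z - s *: w| <= e * s) ->
  (forall e : R, 0 < e -> \forall s \near 0^'+, `|f s - z - s *: w'| <= e * s) ->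
  w = w'.
Proof.
move=> h h'; apply/eqP; rewrite -subr_eq0 -normr_le0; apply/ler_addgt0Pr => e e0.
have e2 : 0 < e / 2 by rewrite divr_gt0.
rewrite add0r.
have H0 : \forall s \near (0:R)^'+, 0 < s by apply: (@near_right _ 1) => // s /andP[].
have [s [s0 h1 h2]] : exists s, [/\ 0 < s, `|f s - z - s *: w| <= e / 2 * s
    & `|f s - z - s *: w'| <= e / 2 * s].
  apply: (@filter_ex _ (0:R)^'+); move: H0 (h _ e2) (h' _ e2); exact: filterS3.
have : `|s *: (w - w')| <= e * s.
  have -> : s *: (w - w') = (f s - z - s *: w') - (f s - z - s *: w).
    by rewrite opprB [RHS]addrC addrA subrK scalerBr.
  by rewrite (le_trans (ler_normB _ _))// [e]splitr mulrDl lerD.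
by rewrite normrZ gtr0_norm// mulrC ler_pM2r.
Qed.

Lemma hd_uniq_tdir {V W} (A : set V) (f : V -> W) x v L L' :
  has_deriv_on A f x L -> has_deriv_on A f x L' -> tdir A x v -> L v = L' v.
Proof.
move=> h h' tv.
have h0 : has_deriv_on A (fun=> 0 : W) x (fun v => L v - L' v).
  have := hd_add h (hd_opp h'); apply: hd_eq; [exact: nearW| |by rewrite subrr].
  by apply: nearW => y _; rewrite subrr.
have := @tdir_push _ _ A [set 0] _ x v _ _ h0 tv.
move=> /(_ (nearW _ _))[//|g [g0 hg]]; apply/eqP; rewrite -subr_eq0; apply/eqP.
apply: (@tdir_uniq0 _ _ 0 0 (fun=> 0)); last first.
  move=> e e0; have : \forall s \near (0:R)^'+, 0 < s.
    by apply: (@near_right _ 1) => // s /andP[].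
  by apply: filterS => s s0; rewrite scaler0 !subr0 normr0 mulr_ge0// ltW.
by move=> e e0; move: g0 (hg e e0); apply: filterS2 => s ->.
Qed.

(** Every vector is a multiple of a small displacement of [v0]. *)
Lemma lin_ball0 {V W} (L : V -> W) v0 (e : R) : linear L -> 0 < e ->
  (forall z, `|z - v0| < e -> L z = 0) -> forall v, L v = 0.
Proof.
move=> lL e0 h v; have L0 : L v0 = 0 by apply: h; rewrite subrr normr0.
have [->|v0'] := eqVneq v 0; first exact: lin0.
have nv : 0 < `|v| by rewrite normr_gt0.
have [k k0 kE] : exists2 k, 0 < k & k * `|v| = e / 2.
  by exists (e / 2 / `|v|); [rewrite !divr_gt0|rewrite divfK ?gt_eqF].
have := h (v0 + k *: v).
rewrite addrC addKr normrZ gtr0_norm// kE ltr_pdivrMr// ltr_pMr// ltr1n => /(_ erefl).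
rewrite linD// L0 add0r linZ// => /eqP; rewrite scaler_eq0 gt_eqF//= => /eqP.
exact.
Qed.

Lemma hd_uniq {V W} (A : set V) (f : V -> W) x L L' : fat A x ->
  has_deriv_on A f x L -> has_deriv_on A f x L' -> L = L'.
Proof.
move=> [v0 [e [e0 h]]] hL hL'; apply/funext => v; apply/eqP.
rewrite -subr_eq0; apply/eqP.
apply: (@lin_ball0 _ _ (fun v => L v - L' v) v0 e) => //.
  have [lL _ _] := hL; have [lL' _ _] := hL'.
  by move=> a u w; rewrite lL lL' scalerBr opprD addrACA.
by move=> z /h tz; rewrite (hd_uniq_tdir hL hL' tz) subrr.
Qed.

Lemma cone_fat {V} (A : set V) (x : V) : cone_at A x -> fat A x.
Proof.
move=> [v0 [e [d [e0 d0 h]]]]; exists v0, e; split=> // z ze.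
exists (fun s => x + s *: z); split.
  by apply: (near_right d0) => s; exact: h.
move=> r r0; apply: (@near_right _ 1) => // s /andP[s0 _].
by rewrite [x + _]addrC addrK subrr normr0 mulr_ge0// ltW.
Qed.

Lemma fat_near {V} (A B : set V) x : (\forall y \near x, A y -> B y) ->
  fat A x -> fat B x.
Proof.
by move=> AB [v0 [e [e0 h]]]; exists v0, e; split=> // z /h; exact: tdir_near.
Qed.

Lemma fat_push {V W} (A : set V) (B : set W) (f : V -> W) x L K :
  (\forall y \near x, A y -> B (f y)) ->
  has_deriv_on A f x L -> linear K -> continuous K -> cancel L K -> cancel K L ->
  fat A x -> fat B (f x).
Proof.
move=> AB hf lK cK LK KL [v0 [e [e0 h]]].
have [C C0 hC] := lin_bound lK cK.
exists (L v0), (e / C); split; first by rewrite divr_gt0.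
move=> z; rewrite ltr_pdivlMr// => hz; rewrite -[z]KL.
apply: tdir_push AB hf _; apply: h; rewrite -[v0]LK -linB//.
by rewrite (le_lt_trans (hC _))// mulrC.
Qed.

Lemma deriv_onP {V W} (A : set V) (f : V -> W) x :
  differentiable_on A f x -> has_deriv_on A f x (deriv_on A f x).
Proof. by move=> [L h]; rewrite /deriv_on; exact: (xgetPex (fun=> 0) (ex_intro _ L h)). Qed.

Lemma deriv_onE {V W} (A : set V) (f : V -> W) x L : fat A x ->
  has_deriv_on A f x L -> deriv_on A f x = L.
Proof. by move=> fA h; apply: (hd_uniq fA _ h); apply: deriv_onP; exists L. Qed.

Lemma deriv_on_eq {V W} (A B : set V) (f g : V -> W) x :
  (\forall y \near x, A y <-> B y) -> (\forall y \near x, A y -> f y = g y) ->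
  f x = g x -> deriv_on A f x = deriv_on B g x.
Proof.
move=> AB fg fgx; rewrite /deriv_on; congr (xget _ _); apply/seteqP; split=> L /=.
  apply: hd_eq => //; first by move: AB; apply: filterS => y [].
  by move: AB fg; apply: filterS2 => y [_ h] k /h /k ->.
by apply: hd_eq => //; move: AB; apply: filterS => y [].
Qed.

End Fatness.

(** * Symmetry of second derivatives at boundary points *)

Section Schwarz.
Context {R : realType} {V : normedModType R}.
Implicit Types (A : set V) (f : V -> R) (s t : R).

Lemma hd_segment A f (y w : V) (t : R) : (forall s, 0 <= s <= 1 -> A (y + s *: w)) ->
  0 <= t <= 1 -> differentiable_on A f (y + t *: w) ->
  has_deriv_on `[(0:R), 1] (fun s => f (y + s *: w)) t
    (fun h : R => deriv_on A f (y + t *: w) (h *: w)).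
Proof.
move=> hA t01 /deriv_onP hf.
have hp := hd_line `[(0:R), 1] y w t.
apply: (@hd_comp _ R V R `[(0:R), 1] A _ f t _ _ _ hp hf).
by apply: (@filterE _ (nbhs t)) => s; rewrite /= in_itv /=; exact: hA.
Qed.

Lemma mvt_segment A f (y w : V) : (forall s, 0 <= s <= 1 -> A (y + s *: w)) ->
  (forall z, A z -> differentiable_on A f z) ->
  (forall t, t \in `](0:R), 1[ ->
     is_derive t 1 (fun s => f (y + s *: w)) (deriv_on A f (y + t *: w) w)) /\
  {within `[0, 1], continuous (fun s => f (y + s *: w))}.
Proof.
move=> hA df; split.
  move=> t t01; have t01' : 0 <= t <= 1.
    by move: t01; rewrite in_itv /= => /andP[t0 t1]; rewrite !ltW.
  have := hd_segment hA t01' (df _ (hA _ t01')) => /hd_is_derive.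
  rewrite scale1r; apply.
  have : t \in `](0:R), 1[ by [].
  move=> /near_in_itvoo; apply: filterS => s.
  by rewrite /= !in_itv /= => /andP[s0 s1]; rewrite !ltW.
apply/subspace_continuousP => t; rewrite /= in_itv /= => t01.
exact: (hd_cts (hd_segment hA t01 (df _ (hA _ t01)))).
Qed.

(** The mean value theorem along [b] reduces the second difference to the
    increment over [s *: a] of the partial derivative in the direction [b]. *)
Lemma second_difference A f (x a b : V) (d : R) L : 0 < d ->
  (forall s t, 0 < s < d -> 0 <= t <= 1 ->
     A (x + s *: a + t *: (s *: b)) /\ A (x + t *: (s *: b))) ->
  (forall y, A y -> differentiable_on A f y) ->
  has_deriv_on A (fun y => deriv_on A f y b) x L ->
  forall e : R, 0 < e -> \forall s \near 0^'+,
   `|f (x + s *: a + s *: b) - f (x + s *: a) - f (x + s *: b) + f x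
     - s ^+ 2 * L a| <= e * s ^+ 2.
Proof.
move=> d0 hA df hL e e0; have [lL cL hL'] := hL.
have C0 : 0 < `|a| + 2 * `|b| + 1 by rewrite ltr_wpDl// addr_ge0// mulr_ge0.
have e1 : 0 < e / (`|a| + 2 * `|b| + 1) by rewrite divr_gt0.
have /near_withinP[r r0 hr] := hL' _ e1.
apply: (@near_right _ _ (Num.min d (r / (`|a| + 2 * `|b| + 1)))).
  by rewrite lt_min d0 divr_gt0.
move=> s /andP[s0]; rewrite lt_min ltr_pdivlMr// => /andP[sd sr].
have s0d : 0 < s < d by rewrite s0.
pose phi t := f (x + s *: a + t *: (s *: b)) - f (x + t *: (s *: b)).
have hA1 t : 0 <= t <= 1 -> A (x + s *: a + t *: (s *: b)).
  by move=> t01; have [] := hA s t s0d t01.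
have hA2 t : 0 <= t <= 1 -> A (x + t *: (s *: b)).
  by move=> t01; have [] := hA s t s0d t01.
have [D1 c1] := mvt_segment hA1 df; have [D2 c2] := mvt_segment hA2 df.
have [t t01] : exists2 t, t \in `](0:R), 1[ & phi 1 - phi 0 =
   (deriv_on A f (x + s *: a + t *: (s *: b)) (s *: b) -
    deriv_on A f (x + t *: (s *: b)) (s *: b)) * (1 - 0).
  apply: (@MVT R phi (fun t => deriv_on A f (x + s *: a + t *: (s *: b)) (s *: b) -
    deriv_on A f (x + t *: (s *: b)) (s *: b))) => //.
    by move=> t t01; apply: is_deriveB; [exact: D1|exact: D2].
  move=> z; apply: cvgB; [exact: c1|exact: c2].
rewrite /phi !scale1r !scale0r !addr0 subr0 mulr1.
have t01' : 0 <= t <= 1.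
  by move: t01; rewrite in_itv /= => /andP[t0 t1]; rewrite !ltW.
have Az1 := hA1 t t01'; have Az2 := hA2 t t01'.
have dl z : A z -> deriv_on A f z (s *: b) = s * deriv_on A f z b.
  by move=> /df/deriv_onP[l _ _]; rewrite linZ.
rewrite !dl// -mulrBr => E.
have na : `|s *: a| = s * `|a| by rewrite normrZ gtr0_norm.
have nb : `|t *: (s *: b)| <= s * `|b|.
  rewrite !normrZ (gtr0_norm s0); case/andP: t01' => t0 t1.
  by rewrite ger0_norm// ler_piMl// mulr_ge0// ltW.
have b0 := normr_ge0 b; have a0 := normr_ge0 a.
have sb0 : 0 <= s * `|b| by rewrite mulr_ge0// ltW.
have sa0 : 0 <= s * `|a| by rewrite mulr_ge0// ltW.
have n1 : `|s *: a + t *: (s *: b)| <= s * (`|a| + `|b|).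
  by rewrite (le_trans (ler_normD _ _))// na mulrDr lerD2l.
have sr' : s * `|a| + 2 * (s * `|b|) + s < r.
  by apply: le_lt_trans sr; rewrite !mulrDr mulr1 mulrCA.
have H1 := hr _ Az1; have H2 := hr _ Az2.
have E1 : x + s *: a + t *: (s *: b) - x = s *: a + t *: (s *: b).
  by rewrite -(addrA x (s *: a) (t *: _)) [LHS]addrC addKr.
have E2 : x + t *: (s *: b) - x = t *: (s *: b) by rewrite addrC addKr.
rewrite E1 -(addrA x (s *: a) (t *: _)) in H1; rewrite E2 in H2.
have n1r : `|s *: a + t *: (s *: b)| < r.
  by apply: le_lt_trans n1 _; move: sr'; rewrite mulrDr; lra.
have n2r : `|t *: (s *: b)| < r by lra.
have {}H1 := H1 n1r; have {}H2 := H2 n2r.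
have -> : f (x + s *: a + s *: b) - f (x + s *: a) - f (x + s *: b) + f x - s ^+ 2 * L a =
   s * (deriv_on A f (x + (s *: a + t *: (s *: b))) b - deriv_on A f x b - L (s *: a + t *: (s *: b))) -
   s * (deriv_on A f (x + t *: (s *: b)) b - deriv_on A f x b - L (t *: (s *: b))).
  rewrite (linD lL) (linZ lL s a) /GRing.scale /= expr2.
  move: E; rewrite -(addrA x (s *: a) (t *: _)).
  move: (deriv_on A f (x + (s *: a + t *: (s *: b))) b) (deriv_on A f (x + t *: (s *: b)) b).
  move: (f _) (f _) (f _) (f _) (L _) (L a) => p1 p2 p3 p4 l1 l2 q1 q2 E.
  have -> : p4 - p2 - p3 + p1 = s * (q1 - q2) by rewrite -E; ring.
  ring.
rewrite (le_trans (ler_normB _ _))// !normrM (gtr0_norm s0).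
rewrite -mulrDr expr2 mulrCA ler_pM2l//.
apply: le_trans (lerD H1 H2) _; rewrite -mulrDr mulrAC ler_pdivrMr// -mulrA ler_pM2l//.
apply: le_trans (lerD n1 nb) _.
by rewrite -mulrDr ler_wpM2l ?ltW//; lra.
Qed.

(** The cone over a ball is convex, since up to a positive factor its points are
    points of the ball: it contains small parallelograms with a vertex at the
    apex. *)
Lemma cone_parallelogram A (x v0 a b : V) (e d s t : R) :
  (forall z r, `|z - v0| < e -> 0 < r < d -> A (x + r *: z)) -> A x ->
  `|a - v0| < e -> `|b - v0| < e -> 0 < s < d / 2 -> 0 <= t <= 1 ->
  A (x + s *: a + t *: (s *: b)) /\ A (x + t *: (s *: b)).
Proof.
move=> h Ax ha hb /andP[s0 sd] /andP[t0 t1]; split.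
  have t1' : 0 < 1 + t by rewrite ltr_wpDr.
  have -> : x + s *: a + t *: (s *: b) =
      x + (s * (1 + t)) *: ((1 + t)^-1 *: (a + t *: b)).
    have -> : (s * (1 + t)) *: ((1 + t)^-1 *: (a + t *: b)) = s *: (a + t *: b).
      by rewrite scalerA mulfK ?gt_eqF.
    by rewrite scalerDr addrA !scalerA [t * s]mulrC.
  apply: h; last by rewrite mulr_gt0//=; move: sd; rewrite ltr_pdivlMr//; nra.
  have -> : (1 + t)^-1 *: (a + t *: b) - v0 = (1 + t)^-1 *: ((a - v0) + t *: (b - v0)).
    rewrite scalerBr addrACA -opprD -{2}[v0]scale1r -scalerDl scalerBr scalerA.
    by rewrite mulVf ?scale1r// gt_eqF.
  rewrite normrZ gtr0_norm ?invr_gt0// mulrC ltr_pdivrMr//.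
  rewrite (le_lt_trans (ler_normD _ _))// normrZ ger0_norm//.
  by rewrite mulrDr mulr1 ltr_leD// mulrC ler_wpM2r// ltW.
have [->|t0'] := eqVneq t 0; first by rewrite scale0r addr0.
have {}t0' : 0 < t by rewrite lt_neqAle eq_sym t0'.
rewrite scalerA; apply: h => //; rewrite mulr_gt0//=.
by move: sd; rewrite ltr_pdivlMr//; nra.
Qed.

Lemma deriv_on_linearD A f (v w x : V) : A x ->
  (forall y, A y -> differentiable_on A f y) ->
  forall a, deriv_on A f x (a *: v + w) = a * deriv_on A f x v + deriv_on A f x w.
Proof. by move=> Ax df a; have [l _ _] := deriv_onP (df x Ax); rewrite l. Qed.

(** For directions [a] and [b] in the cone the second difference is symmetric in
    [a] and [b], and by [second_difference] it gives either second derivative in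
    the limit. The antisymmetric part [S] is bilinear and vanishes on a ball of
    directions, hence everywhere. *)
Lemma schwarz A f (x : V) : A x -> cone_at A x ->
  (forall y, A y -> differentiable_on A f y) ->
  (forall v, differentiable_on A (fun y => deriv_on A f y v) x) ->
  forall a b, deriv_on A (fun y => deriv_on A f y a) x b =
              deriv_on A (fun y => deriv_on A f y b) x a.
Proof.
move=> Ax cA df ddf; have fA := cone_fat cA.
have [v0 [e [d [e0 d0 h]]]] := cA.
pose L b := deriv_on A (fun y => deriv_on A f y b) x.
have hL b : has_deriv_on A (fun y => deriv_on A f y b) x (L b).
  exact: deriv_onP (ddf b).
pose S a b := L a b - L b a.
have Slin2 a : linear (S a).
  move=> k u v; rewrite /S (hd_lin (hL a)).
  have -> : L (k *: u + v) = fun w => k * L u w + L v w.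
    apply: (hd_uniq fA (hL _)).
    have := hd_add (hd_mul (hd_cst A k x) (hL u)) (hL v).
    under [X in has_deriv_on _ _ _ X]eq_fun do rewrite mul0r add0r.
    apply: hd_eq; [exact: nearW| |exact: deriv_on_linearD].
    by apply: nearW => y Ay; exact: deriv_on_linearD.
  by rewrite /GRing.scale /=; ring.
have Santi a b : S a b = - S b a by rewrite /S opprB.
have Sball a b : `|a - v0| < e -> `|b - v0| < e -> S a b = 0.
  move=> ha hb; have d2 : 0 < d / 2 by rewrite divr_gt0.
  have p1 s t : 0 < s < d / 2 -> 0 <= t <= 1 ->
     A (x + s *: a + t *: (s *: b)) /\ A (x + t *: (s *: b)).
    by move=> s0 t0; exact: cone_parallelogram h Ax ha hb s0 t0.
  have p2 s t : 0 < s < d / 2 -> 0 <= t <= 1 ->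
     A (x + s *: b + t *: (s *: a)) /\ A (x + t *: (s *: a)).
    by move=> s0 t0; exact: cone_parallelogram h Ax hb ha s0 t0.
  apply/eqP; rewrite -normr_le0; apply/ler_addgt0Pr => r r0; rewrite add0r.
  have r2 : 0 < r / 2 by rewrite divr_gt0.
  have H1 := second_difference d2 p1 df (hL b) r2.
  have H2 := second_difference d2 p2 df (hL a) r2.
  have H0 : \forall s \near (0:R)^'+, 0 < s.
    by apply: (@near_right _ _ 1) => // s /andP[].
  have [s [s0 h1 h2]] : exists s, [/\ 0 < s,
      `|f (x + s *: a + s *: b) - f (x + s *: a) - f (x + s *: b) + f x - s ^+ 2 * L b a| <= r / 2 * s ^+ 2 &
      `|f (x + s *: b + s *: a) - f (x + s *: b) - f (x + s *: a) + f x - s ^+ 2 * L a b| <= r / 2 * s ^+ 2].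
    by apply: (@filter_ex _ (0:R)^'+); move: H0 H1 H2; exact: filterS3.
  have s2 : 0 < s ^+ 2 by rewrite exprn_gt0.
  rewrite -(ler_pM2r s2) /S -(gtr0_norm s2) -normrM (gtr0_norm s2).
  move: h1 h2; rewrite (addrAC x (s *: b)).
  move: (f _) (f _) (f _) (f _) (L _ _) (L _ _) => q1 q2 q3 q4 l1 l2 h1 h2.
  rewrite !ler_norml in h1 h2 *.
  by move: h1 h2; set k := s ^+ 2; move: k => k /andP[? ?] /andP[? ?]; apply/andP; split; lra.
move=> a b; apply/eqP; rewrite -subr_eq0; apply/eqP.
have -> : deriv_on A (fun y => deriv_on A f y a) x b -
  deriv_on A (fun y => deriv_on A f y b) x a = S a b by [].
have Sb z : `|z - v0| < e -> forall b, S z b = 0.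
  by move=> hz; apply: (lin_ball0 (v0 := v0) (Slin2 z) e0) => z' hz'; exact: Sball hz hz'.
rewrite Santi; apply/eqP; rewrite oppr_eq0; apply/eqP.
by apply: (lin_ball0 (v0 := v0) (Slin2 b) e0) => z hz; rewrite Santi (Sb z hz) oppr0.
Qed.

End Schwarz.

Lemma near_all {T : topologicalType} (x : T) (P : T -> Prop) :
  (forall y, P y) -> \forall y \near x, P y.
Proof. by move=> h; apply: filterE. Qed.

(** * Implicit differentiation *)

Section Implicit.
Context {R : realType} {V W Z : normedModType R}.

Lemma prod_normE (v : V) (w : W) : `|(v, w)| = Num.max `|v| `|w|.
Proof. by []. Qed.

(** Subtracting the linearised equation bounds [theta y - theta x - J (y - x)],
    through the injectivity bound [m], by a small multiple of
    [`|y - x| + `|theta y - theta x|]; the last term is absorbed on the left.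
    The solution [theta] is given, which allows [A] to have a boundary. *)
Lemma hd_implicit (A : set V) (B : set W) (F : V * W -> Z) (g : V -> Z)
    (theta : V -> W) x LF Lg (J : V -> W) (m : R) :
  (\forall y \near x, A y -> B (theta y)) ->
  (\forall y \near x, A y -> F (y, theta y) = g y) -> F (x, theta x) = g x ->
  theta @ within A (nbhs x) --> theta x ->
  has_deriv_on (A `*` B) F (x, theta x) LF ->
  has_deriv_on A g x Lg ->
  linear J -> continuous J -> (forall v, LF (v, J v) = Lg v) ->
  0 < m -> (forall w, m * `|w| <= `|LF (0, w)|) ->
  has_deriv_on A theta x J.
Proof.
move=> AB FG Fx ct [lF cF hF] [lG cG hG] lJ cJ FJ m0 hm; split=> // e e0.
have [C C0 hC] := lin_bound lJ cJ.
have [k k0 [km ke]] : exists2 k : R, 0 < k & k <= m / 2 /\ k * (2 + C) <= e * (m / 2).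
  have c2 : 0 < 2 + C by rewrite addr_gt0.
  exists (Num.min (m / 2) (e * (m / 2) / (2 + C))).
    by rewrite lt_min !divr_gt0// ?mulr_gt0// divr_gt0.
  by split; [rewrite ge_min lexx|rewrite -ler_pdivlMr// ge_min lexx orbT].
have hF1 := hF _ k0; have hG1 := hG _ k0.
have cp : (fun y => (y, theta y)) @ within A (nbhs x) --> (x, theta x).
  by apply: cvg_pair => //; apply: cvg_within.
rewrite near_withinE in hF1.
have hF2 : \forall y \near within A (nbhs x), (A `*` B) (y, theta y) ->
   `|F (y, theta y) - F (x, theta x) - LF ((y, theta y) - (x, theta x))| <=
     k * `|(y, theta y) - (x, theta x)| by exact: (cp _ hF1).
have AB' : \forall y \near within A (nbhs x), A y /\ B (theta y).
  by rewrite near_withinE; apply: filterS AB => y h Ay; split=> //; exact: h.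
have FG' : \forall y \near within A (nbhs x), F (y, theta y) = g y.
  by rewrite near_withinE; apply: filterS FG => y h Ay; exact: h.
have n1 := near_and AB' FG'; have n2 := near_and hF2 hG1; move: n1 n2.
apply: filterS2 => y [ABy Fy] [H1 H2]; have {}H1 := H1 ABy.
rewrite Fy Fx in H1.
set d := y - x in H2 *; set eta := theta y - theta x.
have dE : (y, theta y) - (x, theta x) = (d, eta) by [].
rewrite dE prod_normE in H1.
have E1 : LF (d, eta) - Lg d = LF (0, eta - J d).
  rewrite -FJ -linB//; congr LF; apply/pair_equal_spec; split=> //=.
  exact: subrr.
have H3 : `|LF (0, eta - J d)| <= k * (2 * `|d| + `|eta|).
  rewrite -E1; have -> : LF (d, eta) - Lg d =
     (g y - g x - Lg d) - (g y - g x - LF (d, eta)).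
    by rewrite opprB [RHS]addrC addrA subrK.
  rewrite (le_trans (ler_normB _ _))// (le_trans (lerD H2 H1))// -mulrDr.
  have mx : Num.max `|d| `|eta| <= `|d| + `|eta|.
    by rewrite ge_max lerDl lerDr !normr_ge0.
  apply: ler_wpM2l; [exact: ltW|lra].
have H4 : `|eta| <= `|eta - J d| + C * `|d|.
  by rewrite -[X in `|X| <= _](subrK (J d)) (le_trans (ler_normD _ _))// lerD2l.
have H5 := le_trans (hm _) H3.
have H6 : m / 2 * `|eta - J d| <= e * (m / 2) * `|d|.
  have H7 : k * `|eta| <= k * (`|eta - J d| + C * `|d|) by rewrite ler_pM2l.
  have H8 : k * `|eta - J d| <= m / 2 * `|eta - J d| by rewrite ler_wpM2r.
  have H9 : k * (2 + C) * `|d| <= e * (m / 2) * `|d| by rewrite ler_wpM2r.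
  lra.
have m2 : 0 < m / 2 by rewrite divr_gt0.
by rewrite -(ler_pM2l m2) mulrA [m / 2 * e]mulrC.
Qed.

End Implicit.

Lemma hd_ctsT {R : realType} {V W : normedModType R} (f : V -> W) x L :
  has_deriv_on setT f x L -> f @ nbhs x --> f x.
Proof.
move=> /hd_cts h P /h; rewrite /= !near_simpl near_withinE.
by apply: filterS => y; exact.
Qed.

Lemma tdir_closure {R : realType} {V : normedModType R} (A : set V) x v :
  tdir A x v -> closure A x.
Proof.
move=> [g [gA hg]] B /(tdir_cvg hg) gB.
have [s [As Bs]] : exists s, A (g s) /\ B (g s).
  by apply: (@filter_ex _ (0:R)^'+); move: gA gB; exact: filterS2.
by exists (g s).
Qed.

(** * Domains with a local defining function *)

Section LocalDefining.
Context {R : realType} {n : nat}.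
Local Notation E := 'rV[R]_n.
Implicit Types (A U : set E) (r : E -> R) (z v w : E).

Definition local_defining A r U : Prop :=
  [/\ open U,
      forall z, U z -> exists L, has_deriv_on setT r z L /\ exists v, L v != 0 &
      forall z, U z -> (A z <-> r z < 0)].

(** The term [s * L w] dominates the error [k * s * `|w|], uniformly for [w] in
    a small ball around [v]. *)
Lemma lin_sign (B : set E) (f : E -> R) z v (L : E -> R) :
  has_deriv_on B f z L -> f z = 0 -> L v < 0 ->
  exists e d : R, [/\ 0 < e, 0 < d & forall w s, `|w - v| < e -> 0 < s < d ->
    B (z + s *: w) -> f (z + s *: w) < 0].
Proof.
move=> [lL cL h] fz Lv; have [D D0 hD] := lin_bound lL cL.
have c0 : 0 < - L v by rewrite oppr_gt0.
have v1 : 0 < `|v| + 1 by rewrite ltr_wpDl.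
pose k := - L v / 4 / (`|v| + 1).
have k0 : 0 < k by rewrite !divr_gt0.
have /near_withinP[d d0 hd] := h _ k0.
exists (Num.min 1 (- L v / 4 / D)), (d / (`|v| + 1)); split.
- by rewrite lt_min ltr01 !divr_gt0.
- by rewrite divr_gt0.
move=> w s; rewrite lt_min => /andP[w1 wD] /andP[s0]; rewrite ltr_pdivlMr// => sd Bz.
have wv : `|w| <= `|v| + 1.
  by rewrite -[w](subrK v) (le_trans (ler_normD _ _))// addrC lerD2l ltW.
have zE : z + s *: w - z = s *: w by rewrite addrC addKr.
have := hd _ Bz; rewrite zE normrZ (gtr0_norm s0) fz subr0 (linZ lL) => H.
have sw : s * `|w| < d by apply: le_lt_trans sd; rewrite ler_pM2l.
have {}H := H sw.
have Lw : L w <= - (- L v * 3 / 4).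
  have := hD (w - v); rewrite linB// => h1.
  have h2 : D * `|w - v| <= - L v / 4.
    by rewrite mulrC -ler_pdivlMr// ltW.
  have := le_trans (ler_norm _) (le_trans h1 h2); lra.
have h3 : k * (s * `|w|) <= s * (- L v / 4).
  have -> : s * (- L v / 4) = k * (s * (`|v| + 1)) by rewrite /k; field; rewrite gt_eqF.
  by rewrite ler_pM2l// ler_pM2l.
have h4 := le_trans (ler_norm _) (le_trans H h3).
have h5 : s * L w <= s * (- (- L v * 3 / 4)) by rewrite ler_pM2l.
have h6 : 0 < s * - L v by rewrite mulr_gt0.
rewrite /GRing.scale /= in h4; lra.
Qed.

Lemma near_segment U z v : open U -> U z ->
  exists e d : R, [/\ 0 < e, 0 < d & forall w s, `|w - v| < e -> 0 <= s < d ->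
    U (z + s *: w)].
Proof.
move=> oU Uz; have /nbhs_normP[d /= d0 h] : nbhs z U by exact: open_nbhs_nbhs.
have v1 : 0 < `|v| + 1 by rewrite ltr_wpDl.
exists 1, (d / (`|v| + 1)); split=> //; first by rewrite divr_gt0.
move=> w s wv /andP[s0]; rewrite ltr_pdivlMr// => sd; apply: h.
rewrite /ball_ /= opprD addrA subrr sub0r normrN normrZ ger0_norm//.
apply: le_lt_trans sd; rewrite ler_wpM2l//.
by rewrite -[w](subrK v) (le_trans (ler_normD _ _))// addrC lerD2l ltW.
Qed.

Lemma ld_in A r U z v L : local_defining A r U -> U z -> r z = 0 ->
  has_deriv_on setT r z L -> L v < 0 -> cone_dir A z v.
Proof.
move=> [oU _ hA] Uz rz hL Lv.
have [e1 [d1 [e10 d10 h1]]] := lin_sign hL rz Lv.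
have [e2 [d2 [e20 d20 h2]]] := near_segment v oU Uz.
exists (Num.min e1 e2), (Num.min d1 d2); split; rewrite ?lt_min ?e10 ?d10//.
move=> w s; rewrite !lt_min => /andP[a b] /and3P[c d f].
have Uw : U (z + s *: w) by apply: h2 => //; rewrite (ltW c).
by apply/hA => //; apply: h1 => //; rewrite c.
Qed.

Lemma ld_out A r U z v L : local_defining A r U -> U z -> r z = 0 ->
  has_deriv_on setT r z L -> 0 < L v ->
  exists e d : R, [/\ 0 < e, 0 < d & forall w s, `|w - v| < e -> 0 < s < d ->
    0 < r (z + s *: w) /\ ~ A (z + s *: w)].
Proof.
move=> [oU _ hA] Uz rz hL Lv.
have rz' : - r z = 0 by rewrite rz oppr0.
have Lv' : - L v < 0 by rewrite oppr_lt0.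
have [e1 [d1 [e10 d10 h1]]] := lin_sign (hd_opp hL) rz' Lv'.
have [e2 [d2 [e20 d20 h2]]] := near_segment v oU Uz.
exists (Num.min e1 e2), (Num.min d1 d2); split; rewrite ?lt_min ?e10 ?d10//.
move=> w s; rewrite !lt_min => /andP[a b] /and3P[c d f].
have Uw : U (z + s *: w) by apply: h2 => //; rewrite (ltW c).
have r0 : 0 < r (z + s *: w) by rewrite -oppr_lt0; apply: h1 => //; rewrite c.
by split=> // /hA-/(_ Uw); rewrite ltNge ltW.
Qed.

Lemma ld_neg A r U z : local_defining A r U -> U z ->
  exists L, has_deriv_on setT r z L /\ exists v, L v < 0.
Proof.
move=> [_ h _] /h[L [hL [v Lv]]]; exists L; split=> //.
move: Lv; rewrite neq_lt => /orP[?|?]; first by exists v.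
by exists (- v); rewrite (linN (hd_lin hL)) oppr_lt0.
Qed.

Lemma ld_interior A r U z : local_defining A r U -> U z -> A z -> interior A z.
Proof.
move=> H Uz Az; have [oU h hA] := H; have [L [hL _]] := h z Uz.
have rz : r z < 0 by apply/hA.
have cr : r @ nbhs z --> r z.
  exact: hd_ctsT hL.
have n1 : \forall y \near z, r y < 0 by exact: (cvgr_lt _ cr _ rz).
have n2 : \forall y \near z, U y by exact: open_nbhs_nbhs.
by move: n1 n2; apply: filterS2 => y ry Uy; apply/hA.
Qed.

Lemma ld_closure A r U z : local_defining A r U -> U z ->
  (closure A z <-> r z <= 0).
Proof.
move=> H Uz; have [oU h hA] := H; have [L [hL [v Lv]]] := ld_neg H Uz; split.
  move=> cA; rewrite leNgt; apply/negP => rz.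
  have cr : r @ nbhs z --> r z.
    exact: hd_ctsT hL.
  have n1 : \forall y \near z, 0 < r y by exact: (cvgr_gt _ cr _ rz).
  have n2 : \forall y \near z, U y by exact: open_nbhs_nbhs.
  have [y [Ay [ry Uy]]] := cA _ (filterI n1 n2).
  by move/hA : Ay => /(_ Uy); rewrite ltNge ltW.
rewrite le_eqVlt => /orP[/eqP rz|rz]; last by apply: subset_closure; exact/hA.
have [e [d [e0 d0 hc]]] := ld_in H Uz rz hL Lv.
apply: (@tdir_closure _ _ _ _ v); exists (fun s => z + s *: v); split.
  by apply: (near_right d0) => s s0; apply: hc => //; rewrite subrr normr0.
move=> k k0; apply: (@near_right _ _ 1) => // s /andP[s0 _].
by rewrite [z + _]addrC addrK subrr normr0 mulr_ge0// ltW.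
Qed.

Lemma ld_boundary A r U z : local_defining A r U -> U z ->
  (boundary A z <-> r z = 0).
Proof.
move=> H Uz; have [oU h hA] := H; split.
  move=> [/(ld_closure H Uz) rz nA]; apply/eqP; rewrite eq_le rz /= leNgt.
  apply/negP => rz0; apply: nA; apply: (ld_interior H Uz); exact/(hA _ Uz).
move=> rz; split; first by apply/(ld_closure H Uz); rewrite rz.
by move=> /interior_subset/hA-/(_ Uz); rewrite rz ltxx.
Qed.

Lemma ld_cone A r U z : local_defining A r U -> U z -> boundary A z ->
  cone_at A z.
Proof.
move=> H Uz /(ld_boundary H Uz) rz; have [L [hL [v Lv]]] := ld_neg H Uz.
have [e [d [e0 d0 hc]]] := ld_in H Uz rz hL Lv.
by exists v, e, d.
Qed.

Lemma cone_dir0 (A : set E) z : interior A z -> cone_dir A z 0.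
Proof.
move=> /nbhs_normP[d /= d0 h]; exists 1, d; split=> // w s.
rewrite subr0 => w1 /andP[s0 sd]; apply: h.
rewrite /ball_ /= opprD addrA subrr sub0r normrN normrZ gtr0_norm//.
by rewrite (lt_trans _ sd)// gtr_pMr.
Qed.

Lemma cone_interior (A : set E) z : interior A z -> cone_at A z.
Proof. by move=> /cone_dir0 h; exists 0. Qed.

Lemma tangent_hd (S : set E) z v : tangent_to S z v ->
  exists gamma, [/\ gamma 0 = z, has_deriv_on setT gamma (0 : R) (fun s => s *: v) &
        \forall s \near (0 : R), S (gamma s)].
Proof. by move=> [g [g0 hg gS]]; exists g; split=> //; exact: hd_of_is_derive. Qed.

Lemma tangent_tdir (S : set E) z v : tangent_to S z v -> tdir S z v.
Proof.
move=> /tangent_hd[g [g0 [lg cg hg] gS]]; exists g; split.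
  by rewrite near_withinE; apply: filterS gS.
move=> e e0; have := hg e e0; rewrite near_withinE => h; rewrite near_withinE.
move: h; apply: filterS => s /(_ I); rewrite g0 subr0 => h s0.
by move: h; rewrite (gtr0_norm s0).
Qed.

Lemma tangent_push (S S' A : set E) (f : E -> E) z v L :
  (\forall y \near z, S y -> S' (f y)) -> (\forall y \near z, S y -> A y) ->
  has_deriv_on A f z L -> tangent_to S z v -> tangent_to S' (f z) (L v).
Proof.
move=> SS SA hf /tangent_hd[g [g0 hg gS]]; exists (f \o g); split=> /=.
- by rewrite g0.
- have N0 : \forall s \near (0:R), [set s | S (g s)] s by exact: gS.
  have h1 : has_deriv_on [set s | S (g s)] (f \o g) 0 (fun s => L (s *: v)).
    apply: (@hd_comp _ _ _ _ _ S g f 0 (fun s : R => s *: v) L).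
    + exact: filterE.
    + exact: hd_sub hg.
    + rewrite g0; move: hf; apply: hd_eq => //; exact: near_all.
  by have := hd_is_derive N0 h1; rewrite scale1r.
have cg : g @ nbhs (0:R) --> z.
  by have := hd_ctsT hg; rewrite g0.
by move: gS (cg _ SS); apply: filterS2 => s ? ; exact.
Qed.

(** If [L v = 0], choose [m] with [L m = 1]. The intermediate value theorem on
    the segment between [z + s v - |s| m] and [z + s v + |s| m], where [r]
    changes sign, gives a point [z + s v + k(s) m] of the boundary. Since
    [r = 0] there, differentiability of [r] forces [k(s) = o(s)], so that this
    curve, possibly discontinuous away from 0, has velocity [v]. *)
Lemma ld_tangent A r U z v L : local_defining A r U -> U z -> r z = 0 ->
  has_deriv_on setT r z L -> (tangent_to (boundary A) z v <-> L v = 0).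
Proof.
move=> H Uz rz hL; have [oU _ hA] := H; split.
  move=> /tangent_tdir tv.
  have h0 : has_deriv_on (boundary A) r z (fun=> 0).
    have := hd_cst (boundary A) (0 : R) z; apply: hd_eq; [exact: near_all| |exact: rz].
    have := open_nbhs_nbhs (conj oU Uz); apply: filterS => y Uy.
    by move/(ld_boundary H Uy).
  exact: (hd_uniq_tdir (hd_sub (@subsetT _ _) hL) h0 tv).
move=> Lv.
have lL := hd_lin hL.
have [m Lm] : exists m, L m = 1.
  have [L' [hL' [w Lw]]] := ld_neg H Uz.
  have -> : L = L'.
    apply: hd_uniq hL hL'; apply: cone_fat; apply: cone_interior.
    by rewrite interiorT.
  exists ((L' w)^-1 *: w).
  by rewrite (linZ (hd_lin hL')) /GRing.scale /= mulVf// lt_eqF.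
have [e1 [d1 [e10 d10 h1]]] : exists e d : R, [/\ 0 < e, 0 < d &
    forall s, 0 < s < d -> [/\ r (z + s *: (v + m)) > 0, r (z + s *: (- v + m)) > 0,
      r (z + s *: (v - m)) < 0 & r (z + s *: (- v - m)) < 0]].
  have g a k : L a = 0 -> L k = 1 -> exists d : R, 0 < d /\
      forall s, 0 < s < d -> r (z + s *: (a + k)) > 0.
    move=> La Lk; have Lak : 0 < L (a + k) by rewrite (linD lL) La Lk add0r.
    have [e [d [e0 d0 hc]]] := ld_out H Uz rz hL Lak.
    by exists d; split=> // s s0; have [] := hc (a + k) s; rewrite ?subrr ?normr0.
  have l a k : L a = 0 -> L k = 1 -> exists d : R, 0 < d /\
      forall s, 0 < s < d -> r (z + s *: (a - k)) < 0.
    move=> La Lk; have Lak : L (a - k) < 0.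
      by rewrite (linB lL) La Lk sub0r oppr_lt0.
    have [e [d [e0 d0 hc]]] := lin_sign (B := setT) hL rz Lak.
    by exists d; split=> // s s0; apply: hc => //; rewrite subrr normr0.
  have Lnv : L (- v) = 0 by rewrite (linN lL) Lv oppr0.
  have [a1 [a10 ha1]] := g _ _ Lv Lm; have [a2 [a20 ha2]] := g _ _ Lnv Lm.
  have [a3 [a30 ha3]] := l _ _ Lv Lm; have [a4 [a40 ha4]] := l _ _ Lnv Lm.
  exists 1, (Num.min (Num.min a1 a2) (Num.min a3 a4)); split=> //.
    by rewrite !lt_min a10 a20 a30.
  move=> s /andP[s0]; rewrite !lt_min => /andP[/andP[x1 x2] /andP[x3 x4]].
  by split; [apply: ha1|apply: ha2|apply: ha3|apply: ha4]; rewrite s0.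
have [d2 d20 hU] : exists2 d : R, 0 < d & forall y, `|y - z| < d -> U y.
  have /nbhs_normP[d /= d0 hd] : nbhs z U by exact: open_nbhs_nbhs.
  by exists d => // y yz; apply: hd; rewrite /ball_ /= distrC.
have nvm : 0 < `|v| + `|m| + 1 by rewrite ltr_wpDl// addr_ge0.
pose d := Num.min d1 (d2 / (`|v| + `|m| + 1)).
have d0 : 0 < d by rewrite lt_min d10 divr_gt0.
have inU (s k : R) : `|s| < d -> `|k| <= `|s| -> U (z + s *: v + k *: m).
  rewrite lt_min ltr_pdivlMr// => /andP[_ sd] ks; apply: hU.
  have -> : z + s *: v + k *: m - z = s *: v + k *: m.
    by rewrite -(addrA z (s *: v)) [LHS]addrC addKr.
  apply: le_lt_trans sd.
  rewrite (le_trans (ler_normD _ _))// !normrZ !mulrDr mulr1.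
  have := ler_wpM2r (normr_ge0 m) ks; have := normr_ge0 s; lra.
(* the intermediate value theorem between the two signs provided by [h1] *)
have key (s : R) : `|s| < d -> exists k, `|k| <= `|s| /\ r (z + s *: v + k *: m) = 0.
  move=> sd; have [->|s0] := eqVneq s 0.
    by exists 0; rewrite !scale0r !addr0 normr0.
  have ns : 0 < `|s| by rewrite normr_gt0.
  have sd1 : `|s| < d1 by move: sd; rewrite lt_min => /andP[].
  have [p1 p2 p3 p4] := h1 `|s| (introT andP (conj ns sd1)).
  have [q1 q2] : r (z + s *: v + `|s| *: m) > 0 /\ r (z + s *: v + (- `|s|) *: m) < 0.
    have [s0'|s0'] := ltP 0 s.
      rewrite (gtr0_norm s0') scaleNr -!addrA -scalerDr -scalerBr.
      by rewrite -(gtr0_norm s0').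
    have E1 : z + s *: v + `|s| *: m = z + `|s| *: (- v + m).
      by rewrite scalerDr scalerN -scaleNr (ler0_norm s0') opprK addrA.
    have E2 : z + s *: v + (- `|s|) *: m = z + `|s| *: (- v - m).
      by rewrite scalerDr !scalerN -!scaleNr (ler0_norm s0') opprK addrA.
    by rewrite E1 E2.
  have [k] : exists2 k, k \in `[- `|s|, `|s|] & r (z + s *: v + k *: m) = 0.
    apply: (@IVT R (fun k => r (z + s *: v + k *: m))).
    - by rewrite (le_trans _ (ltW ns))// oppr_le0.
    - apply/subspace_continuousP => k; rewrite /= in_itv /= -ler_norml => ks.
      have [L' [hL' _]] : exists L', has_deriv_on setT r (z + s *: v + k *: m) L' /\
          exists v, L' v != 0 by have [_ hh _] := H; exact/hh/inU.
      have hm := hd_line setT (z + s *: v) m k.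
      have hc := hd_comp (near_all k (fun _ _ => I)) hm hL'.
      exact: (hd_cts (hd_sub (@subsetT _ _) hc)).
    by rewrite ge_min le_max (ltW q1) (ltW q2) orbT.
  by rewrite in_itv /= -ler_norml => ks rk; exists k.
pose k (s : R) : R := xget (0 : R) [set k : R | `|k| <= `|s| /\ r (z + s *: v + k *: m) = 0].
have kP (s : R) : `|s| < d -> `|k s| <= `|s| /\ r (z + s *: v + k s *: m) = 0.
  by move=> /key[k0 hk0]; rewrite /k; case: xgetP => [y _ //|/(_ k0)]; case.
have nd : \forall s \near (0:R), `|s| < d.
  by apply/nbhs_normP; exists d => // s; rewrite /ball_ /= sub0r normrN.
have k0 : k 0 = 0.
  have [] := kP 0; first by rewrite normr0.
  by rewrite normr0 normr_le0 => /eqP.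
have g0 : z + 0 *: v + k 0 *: m = z by rewrite k0 !scale0r !addr0.
exists (fun s => z + s *: v + k s *: m); split=> //; last first.
  by apply: filterS nd => s sd; have [ks rk] := kP s sd; apply/(ld_boundary H (inU _ _ sd ks)).
suff hg : has_deriv_on setT (fun s : R => z + s *: v + k s *: m : E) (0:R) (fun s : R => s *: v).
  by have := hd_is_derive (near_all (0:R) (fun=> I)) hg; rewrite scale1r.
have lv : linear (fun h : R => h *: v) by move=> a u w; rewrite scalerDl scalerA.
split=> //; first by apply: (@lin_cts _ _ _ _ `|v|) => // s; rewrite normrZ mulrC.
move=> e e0.
have c0 : 0 < (`|v| + `|m| + 1) * (`|m| + 1) by rewrite mulr_gt0// ltr_wpDl.
have [_ _ /(_ _ (divr_gt0 e0 c0))/near_withinP[d3 d30 hd3]] := hL.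
apply/near_withinP; exists (Num.min d (d3 / (`|v| + `|m| + 1))).
  by rewrite lt_min d0 divr_gt0.
move=> s _; rewrite subr0 lt_min ltr_pdivlMr// => /andP[sd sd3].
have [ks rk] := kP s sd; rewrite g0.
have E1 : z + s *: v + k s *: m - z = s *: v + k s *: m.
  by rewrite -(addrA z (s *: v)) [LHS]addrC addKr.
rewrite E1 [s *: v + _]addrC addrK normrZ.
have n1 : `|s *: v + k s *: m| <= `|s| * (`|v| + `|m| + 1).
  rewrite (le_trans (ler_normD _ _))// !normrZ !mulrDr mulr1.
  have := ler_wpM2r (normr_ge0 m) ks; have := normr_ge0 s; lra.
have := hd3 (z + s *: v + k s *: m) I; rewrite E1 rk rz subrr sub0r normrN.
rewrite (linD lL) !(linZ lL) Lv Lm scaler0 add0r => /(_ (le_lt_trans n1 sd3)).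
have -> : `|k s *: (1 : R)| = `|k s| by rewrite /GRing.scale /= mulr1.
move=> kk; have {}kk := le_trans kk (ler_wpM2l (ltW (divr_gt0 e0 c0)) n1).
have m1 : 0 < `|m| + 1 by rewrite ltr_wpDl.
have kk2 : `|k s| <= e / (`|m| + 1) * `|s|.
  apply: le_trans kk _; rewrite le_eqVlt; apply/orP; left; apply/eqP.
  by field; rewrite !gt_eqF.
apply: le_trans (ler_wpM2r (normr_ge0 m) kk2) _.
rewrite mulrAC ler_wpM2r// mulrAC ler_pdivrMr// ler_pM2l// lerDl.
exact: ler01.
Qed.

End LocalDefining.

(** * Bilinear forms *)

Section BilinearForms.
Context {R : realType} {n : nat}.
Local Notation E := 'rV[R]_n.
Implicit Types (B : 'M[R]_n) (u v w : E).

Lemma bform_linl B w : linear (fun v => bform B v w).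
Proof. by move=> a u v; rewrite /bform !mulmxDl -!scalemxAl !mxE. Qed.

Lemma bform_linr B v : linear (bform B v).
Proof. by move=> a u w; rewrite /bform linearP /= mulmxDr -scalemxAr !mxE. Qed.

Lemma bform_linB v w : linear (fun B => bform B v w).
Proof.
by move=> a B C; rewrite /bform mulmxDr mulmxDl -scalemxAr -scalemxAl !mxE.
Qed.

Lemma bformZl B a v w : bform B (a *: v) w = a * bform B v w.
Proof. exact: (linZ (bform_linl B w)). Qed.

Lemma bformZr B a v w : bform B v (a *: w) = a * bform B v w.
Proof. exact: (linZ (bform_linr B v)). Qed.

Lemma bformDl B u v w : bform B (u + v) w = bform B u w + bform B v w.
Proof. exact: (linD (bform_linl B w)). Qed.

Lemma bformBr B u v w : bform B u (v - w) = bform B u v - bform B u w.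
Proof. exact: (linB (bform_linr B u)). Qed.

Lemma bformBl B u v w : bform B (u - v) w = bform B u w - bform B v w.
Proof. exact: (linB (bform_linl B w)). Qed.

Lemma bform_sym B v w : B^T = B -> bform B v w = bform B w v.
Proof.
move=> Bs; rewrite /bform.
have -> : ((v *m B *m w^T) 0 0) = ((v *m B *m w^T)^T 0 0) by rewrite [RHS]mxE.
by rewrite !trmx_mul trmxK Bs mulmxA.
Qed.

Lemma posdef_unit B : posdef B -> B \in unitmx.
Proof.
move=> [_ h]; rewrite -row_free_unit; apply: inj_row_free => v vB.
apply/eqP; apply/negP => /negP/h; rewrite /bform vB mul0mx mxE ltxx//.
Qed.

Lemma bform_norm_gt0 B v : 0 < bform B v v -> 0 < bform_norm B v.
Proof. by move=> h; rewrite /bform_norm sqrtr_gt0. Qed.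

Lemma bform_norm_sqr B v : 0 < bform B v v -> bform_norm B v ^+ 2 = bform B v v.
Proof. by move=> h; rewrite /bform_norm sqr_sqrtr// ltW. Qed.

Lemma hd_bform {V : normedModType R} (A : set V) (G : V -> 'M[R]_n) (b d : V -> E)
    (x : V) LG Lb Ld :
  has_deriv_on A G x LG -> has_deriv_on A b x Lb -> has_deriv_on A d x Ld ->
  has_deriv_on A (fun z => bform (G z) (b z) (d z)) x
    (fun h => bform (G x) (Lb h) (d x) + bform (LG h) (b x) (d x) +
              bform (G x) (b x) (Ld h)).
Proof.
move=> hG hb hd; have := hd_entry 0 0 (hd_mulmx (hd_mulmx hb hG) (hd_tr hd)).
rewrite /bform; set L1 := (X in has_deriv_on _ _ _ X -> _).
set L2 := (X in _ -> has_deriv_on _ _ _ X); suff -> : L1 = L2 by [].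
by apply/funext => v; rewrite /L1 /L2 mulmxDl !mxE.
Qed.

Lemma hd_scale {V : normedModType R} (A : set V) (f : V -> R) (b : V -> E)
    (x : V) Lf Lb :
  has_deriv_on A f x Lf -> has_deriv_on A b x Lb ->
  has_deriv_on A (fun z => f z *: b z) x (fun h => Lf h *: b x + f x *: Lb h).
Proof.
move=> hf hb; apply: hd_mxE => i j.
under eq_fun do rewrite mxE.
under [X in has_deriv_on _ _ _ X]eq_fun do rewrite !mxE.
by apply: hd_mul => //; exact: hd_entry.
Qed.

End BilinearForms.

(** * Conormals, unit normals and the second fundamental form *)

Section Normals.
Context {R : realType} {n : nat}.
Local Notation E := 'rV[R]_n.
Implicit Types (A U : set E) (r : E -> R) (z v w : E).

(** The differential of any defining function is of this form. Stating the
    properties of its sign instead of referring to a defining function makes the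
    notion invariant under diffeomorphisms that are only known up to the
    boundary. *)
Definition conormal A z (L : E -> R) : Prop :=
  [/\ linear L, exists v, L v != 0 &
  [/\ forall v, tangent_to (boundary A) z v <-> L v = 0,
      forall v, L v < 0 -> cone_dir A z v &
      forall v, 0 < L v -> cone_dir (~` A) z v]].

Lemma conormal_in A z L v : conormal A z L -> L v < 0 ->
  exists2 d : R, 0 < d & forall s, 0 < s < d -> A (z + s *: v).
Proof.
move=> [_ _ [_ h _]] /h[e [d [e0 d0 hd]]].
by exists d => // s s0; apply: hd => //; rewrite subrr normr0.
Qed.

Lemma conormal_out A z L v : conormal A z L -> 0 < L v ->
  exists2 d : R, 0 < d & forall s, 0 < s < d -> ~ A (z + s *: v).
Proof.
move=> [_ _ [_ _ h]] /h[e [d [e0 d0 hd]]].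
by exists d => // s s0; apply: hd => //; rewrite subrr normr0.
Qed.

Lemma ld_conormal A r U z L : local_defining A r U -> U z -> r z = 0 ->
  has_deriv_on setT r z L -> conormal A z L.
Proof.
move=> H Uz rz hL; split; first exact: hd_lin hL.
  have [L' [hL' [v Lv]]] := ld_neg H Uz; exists v.
  have -> : L = L'; last by rewrite lt_eqF.
  apply: hd_uniq hL hL'; apply: cone_fat; apply: cone_interior.
  by rewrite interiorT.
split.
- by move=> v; exact: (ld_tangent v H Uz rz hL).
- by move=> v Lv; exact: (ld_in H Uz rz hL Lv).
- move=> v Lv; have [e [d [e0 d0 h]]] := ld_out H Uz rz hL Lv.
  by exists e, d; split=> // w s w0 s0; have [] := h w s w0 s0.
Qed.

(** The normalised metric dual of a conormal is an outward unit normal. Another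
    one is orthogonal to the kernel of [L], so that it is a multiple of the
    first, by a factor [1] or [-1]; pointing outward excludes [-1]. *)
Lemma unit_normalE A (G : E -> 'M[R]_n) z L (b : E) (k : R) :
  conormal A z L -> posdef (G z) -> 0 < k ->
  (forall v, bform (G z) b v = k * L v) ->
  0 < bform (G z) b b /\ unit_normal A G z = (bform_norm (G z) b)^-1 *: b.
Proof.
move=> cL [Gs Gp] k0 hb; have [lL [m Lm] [tL _ _]] := cL.
have b0 : b != 0.
  apply/negP => /eqP b0; move: (hb m); rewrite b0 (lin0 (bform_linl _ _)) => /eqP.
  by rewrite eq_sym mulf_eq0 (negPf Lm) gt_eqF.
have bb := Gp b b0; split=> //.
have nb := bform_norm_gt0 bb.
pose N := (bform_norm (G z) b)^-1 *: b.
have NN : bform (G z) N N = 1.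
  rewrite /N bformZl bformZr -(bform_norm_sqr bb) expr2.
  by field; rewrite gt_eqF.
have NL v : bform (G z) N v = (bform_norm (G z) b)^-1 * (k * L v).
  by rewrite bformZl hb.
have ck : 0 < (bform_norm (G z) b)^-1 * k by rewrite mulr_gt0// invr_gt0.
have LN : 0 < L N by have := @ltr01 R; rewrite -NN NL mulrA pmulr_rgt0.
have oN : outward_unit_normal A G z N.
  split=> //; first by move=> v /tL Lv; rewrite NL Lv !mulr0.
  have [d1 d10 h1] : exists2 d : R, 0 < d & forall s, 0 < s < d -> A (z + s *: - N).
    by apply: (conormal_in cL); rewrite (linN lL) oppr_lt0.
  have [d2 d20 h2] := conormal_out cL LN.
  apply: (@near_right _ _ (Num.min d1 d2)); first by rewrite lt_min d10.
  move=> s /andP[s0]; rewrite lt_min => /andP[s1 s2]; split.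
    by rewrite -scalerN; apply: h1; rewrite s0.
  by apply: h2; rewrite s0.
rewrite /unit_normal; case: xgetP => [N' _ [N'N' N't N'o]|/(_ N)]; last by [].
(* the component of the other normal orthogonal to [N] is tangent, hence zero *)
pose c := bform (G z) N N'.
have hv : bform (G z) N' (N' - c *: N) = 0.
  apply: N't; apply/tL.
  have : bform (G z) N (N' - c *: N) = 0 by rewrite bformBr bformZr NN mulr1 subrr.
  by rewrite NL mulrA => /eqP; rewrite mulf_eq0 gt_eqF//= => /eqP.
have vN : bform (G z) N (N' - c *: N) = 0 by rewrite bformBr bformZr NN mulr1 subrr.
have N'E : N' = c *: N.
  apply/eqP; rewrite -subr_eq0; apply/negP => /negP/Gp.
  by rewrite bformBl bformZl hv vN mulr0 subr0 ltxx.
have c2 : c ^+ 2 = 1.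
  by move: N'N'; rewrite N'E bformZl bformZr NN mulr1 expr2.
have /orP[/eqP c1|/eqP c1] : (c == 1) || (c == -1) by rewrite -sqrf_eq1 c2.
  by rewrite N'E c1 scale1r.
exfalso; have [_ _ oN'] := oN.
have [s [[_ h1] [h2 _]]] : exists s, (A (z - s *: N) /\ ~ A (z + s *: N)) /\
    (A (z - s *: N') /\ ~ A (z + s *: N')).
  by apply: (@filter_ex _ (0:R)^'+); move: oN' N'o; exact: filterS2.
by apply: h1; move: h2; rewrite N'E c1 scaleN1r scalerN opprK.
Qed.

(** Both differentials vanish on the tangent space of the boundary, hence are
    proportional. The factor is not 0 because [Lf] is not, and it is positive
    because [f] does not increase towards the interior. *)
Lemma ld_multiple A r U z L (f : E -> R) Lf : local_defining A r U -> U z -> r z = 0 ->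
  has_deriv_on setT r z L -> has_deriv_on (closure A) f z Lf -> f z = 0 ->
  (\forall y \near z, closure A y -> f y <= 0) ->
  (\forall y \near z, boundary A y -> f y = 0) ->
  (exists v, Lf v != 0) -> exists2 k : R, 0 < k & forall v, Lf v = k * L v.
Proof.
move=> H Uz rz hL hf fz fle f0 [w Lw].
have cL := ld_conormal H Uz rz hL; have [lL [m' Lm'] [tL _ _]] := cL.
have lLf := hd_lin hf.
have [m Lm] : exists m, L m = 1.
  by exists ((L m')^-1 *: m'); rewrite (linZ lL) /GRing.scale /= mulVf.
have LT v : L v = 0 -> Lf v = 0.
  move=> /tL/tangent_tdir tv.
  have h0 : has_deriv_on (boundary A) f z (fun=> 0).
    by have := hd_cst (boundary A) (0 : R) z; apply: hd_eq; [exact: near_all| |].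
  have sb : boundary A `<=` closure A by move=> y [].
  exact: (hd_uniq_tdir (hd_sub sb hf) h0 tv).
have E1 v : Lf v = Lf m * L v.
  have /LT : L (v - L v *: m) = 0.
    by rewrite (linB lL) (linZ lL) Lm /GRing.scale /= mulr1 subrr.
  by rewrite (linB lLf) (linZ lLf) => /eqP; rewrite subr_eq0 mulrC => /eqP.
exists (Lf m) => //; rewrite lt_neqAle eq_sym.
apply/andP; split; first by apply/negP => /eqP k0; move: Lw; rewrite E1 k0 mul0r eqxx.
rewrite leNgt; apply/negP => k0.
have [d d0 hin] : exists2 d : R, 0 < d & forall s, 0 < s < d -> A (z + s *: - m).
  by apply: (conormal_in cL); rewrite (linN lL) Lm oppr_lt0.
have nf0 : - f z = 0 by rewrite fz oppr0.
have Lnm : - Lf (- m) < 0 by rewrite (linN lLf) opprK.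
have [e [d' [e0 d'0 hs]]] := lin_sign (hd_opp hf) nf0 Lnm.
have /nbhs_normP[d3 /= d30 h3] := fle.
have m0 : 0 < `|m| + 1 by rewrite ltr_wpDl.
pose q := Num.min (Num.min d d') (d3 / (`|m| + 1)).
have q0 : 0 < q by rewrite !lt_min d0 d'0 divr_gt0.
have [q1 q2 q3] : [/\ q / 2 < d, q / 2 < d' & q / 2 < d3 / (`|m| + 1)].
  have h : q / 2 < q by rewrite ltr_pdivrMr// ltr_pMr// ltr1n.
  by move: h; rewrite {2}/q !lt_min => /andP[/andP[? ?] ?].
have p0 : 0 < q / 2 by rewrite divr_gt0.
have cA : closure A (z + (q / 2) *: - m).
  by apply: subset_closure; apply: hin; rewrite p0.
have := hs (- m) (q / 2); rewrite subrr normr0 p0 q2 => /(_ e0 erefl cA).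
rewrite oppr_lt0 ltNge h3//= /ball_ /= opprD addrA subrr sub0r normrN.
rewrite normrZ normrN gtr0_norm//; move: q3; rewrite ltr_pdivlMr//.
by apply: le_lt_trans; rewrite ler_pM2l// lerDl.
Qed.

Lemma conormal_scale A z (L L' : E -> R) (k : R) : 0 < k ->
  (forall v, L' v = k * L v) -> conormal A z L -> conormal A z L'.
Proof.
move=> k0 hk [lL [m Lm] [tL inL outL]]; split.
- by move=> a u v; rewrite !hk lL /GRing.scale /=; ring.
- by exists m; rewrite hk mulf_neq0// gt_eqF.
split.
- move=> v; rewrite tL hk; split=> [->|/eqP]; first by rewrite mulr0.
  by rewrite mulf_eq0 gt_eqF//= => /eqP.
- by move=> v; rewrite hk pmulr_rlt0//; exact: inL.
- by move=> v; rewrite hk pmulr_rgt0//; exact: outL.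
Qed.

(** This is how [hs] and [hs o T], known on the closed domain only, give
    conormals. *)
Lemma defining_conormal A r U z (f : E -> R) Lf : local_defining A r U -> U z ->
  boundary A z -> has_deriv_on (closure A) f z Lf ->
  (\forall y \near z, closure A y -> f y <= 0) ->
  (\forall y \near z, boundary A y -> f y = 0) ->
  (exists v, Lf v != 0) -> conormal A z Lf.
Proof.
move=> H Uz bz hf fle f0 nz; have rz := (ld_boundary H Uz).1 bz.
have [L [hL _]] := ld_neg H Uz.
have fz : f z = 0 by exact: (nbhs_singleton f0).
have [k k0 hk] := ld_multiple H Uz rz hL hf fz fle f0 nz.
exact: conormal_scale k0 hk (ld_conormal H Uz rz hL).
Qed.

(** The unit normal is [b] divided by its norm. Differentiating the norm
    produces a multiple of [b], which is orthogonal to [w]; what is left of the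
    connection is the Koszul formula. The field [b] is differentiated only in
    the tangential direction [v]. *)
Lemma second_form_eval A (G : E -> 'M[R]_n) p (b : E -> E) Lb LG v w :
  boundary A p ->
  (\forall z \near p, boundary A z ->
     unit_normal A G z = (bform_norm (G z) (b z))^-1 *: b z) ->
  has_deriv_on (boundary A) b p Lb ->
  has_deriv_on (closure A) G p LG -> fat (closure A) p ->
  posdef (G p) -> 0 < bform (G p) (b p) (b p) ->
  tangent_to (boundary A) p v -> bform (G p) (b p) w = 0 ->
  bform_norm (G p) (b p) * second_form A G p v w =
    bform (G p) (Lb v) w + 2^-1 *
      (bform (LG v) (b p) w + bform (LG (b p)) v w - bform (LG w) v (b p)).
Proof.
move=> bp hN hb hG fA Gp bb tv bw.
have sb : boundary A `<=` closure A by move=> y [].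
have hGb := hd_sub sb hG.
have nb := bform_norm_gt0 bb.
have hn := hd_sqrt (f := fun z => bform (G z) (b z) (b z)) bb (hd_bform hGb hb hb).
have nb0 : Num.sqrt (bform (G p) (b p) (b p)) != 0 by rewrite gt_eqF.
have hi := hd_inv (f := fun z => Num.sqrt (bform (G z) (b z) (b z))) nb0 hn.
have hs := hd_scale hi hb.
set LN := (X in has_deriv_on _ _ _ X) in hs.
have NE : unit_normal A G p = (bform_norm (G p) (b p))^-1 *: b p.
  exact: (nbhs_singleton hN).
have hU : has_deriv_on (boundary A) (unit_normal A G) p LN.
  by move: hs; apply: hd_eq => //; exact: near_all.
have dU : deriv_on (boundary A) (unit_normal A G) p v = LN v.
  by apply: (hd_uniq_tdir _ hU (tangent_tdir tv)); apply: deriv_onP; exists LN.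
rewrite /second_form dU /LN NE bformDl bformDl !bformZl bw mulr0 add0r.
set nrm := bform_norm (G p) (b p) in nb *.
rewrite -/(bform_norm (G p) (b p)) -/nrm mulrDr.
rewrite mulrA mulfV ?gt_eqF// mul1r; congr (_ + _).
rewrite /christoffel (deriv_onE fA hG).
have lLG := hd_lin hG.
set rw := \row_k _.
have -> : bform (G p) (rw *m invmx (G p)) w = (rw *m w^T) 0 0.
  by rewrite /bform -(mulmxA _ _ (G p)) mulVmx ?mulmx1//; exact: posdef_unit.
rewrite mulrCA; congr (_ * _); rewrite !mxE.
have sumw (f : E -> R) : linear f -> f w = \sum_k f (delta_mx 0 k) * w 0 k.
  move=> lf; rewrite {1}[w]row_sum_delta (lin_sum lf); apply: eq_bigr => k _.
  by rewrite (linZ lf) /GRing.scale /= mulrC.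
have l3 : linear (fun k => bform (LG k) v (b p)).
  by move=> a x y; rewrite lLG bform_linB.
rewrite (sumw _ (bform_linr (LG v) (b p))) (sumw _ (bform_linr (LG (b p)) v)) (sumw _ l3).
rewrite mulr_sumr -big_split -sumrB; apply: eq_bigr => k _ /=.
have sE (x y : R) : x *: y = x * y by [].
rewrite !mxE (linZ lLG) (linZ (bform_linB _ _)) bformZl bformZr sE.
by field; rewrite gt_eqF.
Qed.

End Normals.

Lemma cancel4 {V : zmodType} (p l q t : V) : p - l + (l - q - (t - q)) = p - t.
Proof. by rewrite opprB (addrA (l - q)) subrK addrA subrK. Qed.

Lemma cancel5 {V : zmodType} (p l t : V) : p + (l - t) - (p - t) = l.
Proof. by rewrite opprB addrA -(addrA p) subrK [p + _]addrC addrK. Qed.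

(** * Cones under maps with invertible derivative *)

Section OpenMapping.
Context {R : realType} {n : nat}.
Local Notation E := 'rV[R]_n.

Lemma fermat_min {V : normedModType R} (D : set V) (g : V -> R) c L :
  nbhs c D -> has_deriv_on D g c L -> (forall z, D z -> g c <= g z) ->
  forall v, L v = 0.
Proof.
move=> Dc hg gmin; have lL := hd_lin hg.
suff h v : 0 <= L v.
  move=> v; apply/eqP; rewrite eq_le h andbT -oppr_ge0 -(linN lL); exact: h.
have c0 : (fun s : R => c + s *: v) @ nbhs (0:R) --> c.
  have := hd_ctsT (hd_line setT c v 0).
  by rewrite scale0r addr0.
have N0 : nbhs (0:R) [set s : R | D (c + s *: v)] by exact: c0.
have h1 : has_deriv_on [set s : R | D (c + s *: v)] (fun s => g (c + s *: v)) (0:R)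
    (fun s => L (s *: v)).
  apply: (@hd_comp _ _ _ _ _ D (fun s : R => c + s *: v) g (0:R) (fun s : R => s *: v) L).
  - exact: near_all.
  - exact: hd_line.
  - by rewrite scale0r addr0.
rewrite leNgt; apply/negP => Lv; have [_ _ h2] := h1.
have e0 : 0 < - L v / 2 by rewrite divr_gt0// oppr_gt0.
have /nbhs_normP[d /= d0 hd] := h2 _ e0.
have /nbhs_normP[d' /= d'0 hd'] := N0.
pose s := Num.min d d' / 2.
have s0 : 0 < s by rewrite divr_gt0// lt_min d0.
have [s1 s2] : s < d /\ s < d'.
  have : s < Num.min d d' by rewrite ltr_pdivrMr// ltr_pMr ?ltr1n// lt_min d0.
  by rewrite lt_min => /andP[].
have Ds : D (c + s *: v) by apply: hd'; rewrite /ball_ /= sub0r normrN gtr0_norm.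
have := hd s; rewrite /ball_ /= sub0r normrN gtr0_norm// => /(_ s1 Ds).
rewrite scale0r addr0 !subr0 (gtr0_norm s0) (linZ lL) => h3.
have := gmin _ Ds; have := le_trans (ler_norm _) h3; rewrite /GRing.scale /=.
have : s * L v < 0 by rewrite pmulr_rlt0.
nra.
Qed.

(** The Euclidean square norm is differentiable, unlike the square of the
    maximum norm of row vectors. *)
Definition sqnorm (v : E) : R := \sum_k v 0 k ^+ 2.

Lemma sqnorm_ge (v : E) : `|v| ^+ 2 <= sqnorm v.
Proof.
have s0 : 0 <= sqnorm v by apply: sumr_ge0 => k _; exact: sqr_ge0.
rewrite -(sqr_sqrtr s0) ler_sqr ?nnegrE ?sqrtr_ge0//.
apply/mx_norm_leP; first exact: sqrtr_ge0.
move=> a k; rewrite (ord1 a) -sqrtr_sqr ler_sqrt//.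
by rewrite /sqnorm (bigD1 k)//= lerDl sumr_ge0// => l _; exact: sqr_ge0.
Qed.

Lemma sqnorm_le (v : E) : sqnorm v <= n%:R * `|v| ^+ 2.
Proof.
rewrite mulr_natl -[X in _ *+ X](card_ord n) -sumr_const; apply: ler_sum => k _.
by rewrite -real_normK ?num_real// ler_sqr ?nnegrE// mx_norm_entry.
Qed.

(** A minimiser [z] of [sqnorm (f z - Q)] over the closed ball is interior. As
    the derivative of [f] at [z] is onto, the vanishing of the differential of
    the square gives [f z = Q]. *)
Lemma interior_value (f : E -> E) (a Q : E) (rho : R) : 0 < rho ->
  (forall z, `|z - a| <= rho -> exists2 L,
     has_deriv_on [set z | `|z - a| <= rho] f z L & forall w, exists v, L v = w) ->
  (forall z, `|z - a| = rho -> sqnorm (f a - Q) < sqnorm (f z - Q)) ->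
  exists2 z, `|z - a| < rho & f z = Q.
Proof.
move=> rho0 hf hs; pose D := [set z : E | `|z - a| <= rho].
have Da : D a by rewrite /D /= subrr normr0 ltW.
have cD : compact D.
  apply: bounded_closed_compact.
    exists (rho + `|a|); split; first exact: num_real.
    move=> x hx y Dy /=; apply: le_trans (ltW hx).
    by rewrite -[y](subrK a) (le_trans (ler_normD _ _))// lerD2r.
  have -> : D = closed_ball a rho; last exact: closed_ball_closed.
  by rewrite closed_ballE//; apply/seteqP; split=> z; rewrite /D /closed_ball_ /= distrC.
have hg z L : has_deriv_on D f z L ->
    has_deriv_on D (fun z => sqnorm (f z - Q)) z
      (fun v => \sum_k (L v 0 k * (f z - Q) 0 k + (f z - Q) 0 k * L v 0 k)).
  move=> h; apply: hd_sum => k.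
  under eq_fun do rewrite expr2.
  have hfQ : has_deriv_on D (fun z => f z - Q) z L.
    have := hd_add h (hd_cst D (- Q) z).
    by under [X in has_deriv_on _ _ _ X -> _]eq_fun do rewrite addr0.
  by apply: hd_mul; exact: hd_entry.
have [c /set_mem Dc cmin] : exists2 c, c \in D &
    forall z, z \in D -> sqnorm (f c - Q) <= sqnorm (f z - Q).
  apply: (@EVT_min_rV R n (fun z => sqnorm (f z - Q)) D) => //; first by exists a.
  apply/subspace_continuousP => z Dz; have [L hL _] := hf z Dz.
  exact: (hd_cts (hg _ _ hL)).
have {}cmin z : D z -> sqnorm (f c - Q) <= sqnorm (f z - Q).
  by move=> Dz; apply: cmin; exact/mem_set.
have cr : `|c - a| < rho.
  rewrite lt_neqAle Dc andbT; apply/negP => /eqP/hs.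
  by rewrite ltNge cmin.
have nD : nbhs c D.
  suff : \forall z \near c, D z by [].
  apply/nbhs_normP; exists (rho - `|c - a|); first by rewrite /= subr_gt0.
  move=> z; rewrite /ball_ /= => h; rewrite /D /=.
  rewrite -[z](subrK c) -addrA (le_trans (ler_normD _ _))// distrC.
  by move: h; rewrite ltrBrDr => /ltW.
exists c => //; have [L hL sL] := hf c Dc; have [v Lv] := sL (f c - Q).
have := fermat_min nD (hg _ _ hL) cmin v; rewrite Lv => h0.
apply/eqP; rewrite -subr_eq0; apply/eqP/rowP => k; rewrite [RHS]mxE.
have h0' : \sum_k ((f c - Q) 0 k * (f c - Q) 0 k + (f c - Q) 0 k * (f c - Q) 0 k) == 0.
  by rewrite h0.
have pos l : true -> 0 <= (f c - Q) 0 l * (f c - Q) 0 l + (f c - Q) 0 l * (f c - Q) 0 l.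
  by move=> _; rewrite -expr2 addr_ge0// sqr_ge0.
move: h0'; rewrite psumr_eq0// => /allP/(_ k); rewrite mem_index_enum => /(_ erefl).
by rewrite /= -mulr2n mulrn_eq0/= mulf_eq0 orbb => /eqP.
Qed.

(** [f] is close to its linear part on the ball of radius proportional to [s]
    around [x + s *: v], so that [sqnorm (f - Q)] is larger on the sphere than at
    the centre and [interior_value] applies. *)
Lemma cone_image (A : set E) (f : E -> E) x L (v : E) (m : R) :
  has_deriv_on A f x L -> 0 < m -> (forall w, m * `|w| <= `|L w|) ->
  (forall z, A z -> exists2 L', has_deriv_on A f z L' & forall w, exists v, L' v = w) ->
  cone_dir A x v ->
  exists e d : R, [/\ 0 < e, 0 < d & forall u s, `|u - L v| < e -> 0 < s < d ->
     exists2 z, A z & f z = f x + s *: u].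
Proof.
move=> hf m0 hm hA [e [d [e0 d0 hc]]]; have [lL cL hL] := hf.
(* [k] bounds the error relative to [s]; the factor [n.+1] compares the two
   norms, through [sqnorm_le] and [sqnorm_ge] *)
pose k := m * e / (16 * n.+1%:R).
have n0 : (0:R) < n.+1%:R by rewrite ltr0Sn.
have k0 : 0 < k by rewrite divr_gt0// !mulr_gt0.
have C0 : 0 < `|v| + e by rewrite ltr_wpDl.
have ek : 0 < k / (`|v| + e) by rewrite divr_gt0.
have /near_withinP[d1 d10 h1] := hL _ ek.
exists k, (Num.min d (d1 / (`|v| + e))); split=> //.
  by rewrite lt_min d0 divr_gt0.
move=> u s hu /andP[s0]; rewrite lt_min ltr_pdivlMr// => /andP[sd sd1].
pose a := x + s *: v; pose Q := f x + s *: u; pose rho := s * (e / 2).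
have rho0 : 0 < rho by rewrite !mulr_gt0// divr_gt0.
have inD z : `|z - a| <= rho -> exists w, [/\ z = x + s *: w, `|w - v| < e,
     `|w| <= `|v| + e & `|w - v| = s^-1 * `|z - a|].
  move=> hz; exists (v + s^-1 *: (z - a)).
  have nw : `|v + s^-1 *: (z - a) - v| = s^-1 * `|z - a|.
    by rewrite addrC addKr normrZ gtr0_norm ?invr_gt0.
  have nwe : `|v + s^-1 *: (z - a) - v| <= e / 2.
    by rewrite nw mulrC ler_pdivrMr// mulrC.
  split=> //.
  - by rewrite scalerDr scalerA mulfV ?gt_eqF// scale1r addrA -/a addrC subrK.
  - by rewrite (le_lt_trans nwe)// ltr_pdivrMr// ltr_pMr// ltr1n.
  - rewrite (le_trans (ler_normD _ _))// lerD2l normrZ gtr0_norm ?invr_gt0//.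
    rewrite -nw (le_trans nwe)// ler_pdivrMr// ler_pMr// ler1n//.
have DA z : `|z - a| <= rho -> A z.
  by move=> /inD[w [-> wv _ _]]; apply: hc => //; rewrite s0.
have err z : `|z - a| <= rho -> `|f z - f x - L (z - x)| <= s * k.
  move=> hz; have [w [zE wv wn _]] := inD z hz.
  have zx : z - x = s *: w by rewrite zE addrC addKr.
  have nzx : `|z - x| <= s * (`|v| + e).
    by rewrite zx normrZ gtr0_norm// ler_wpM2l// ltW.
  have := h1 z (DA z hz) (le_lt_trans nzx sd1) => h2; apply: le_trans h2 _.
  rewrite (le_trans (ler_wpM2l (ltW ek) nzx))//.
  by rewrite le_eqVlt; apply/orP; left; apply/eqP; field; rewrite gt_eqF.
have QE z : f z - Q = (f z - f x - L (z - x)) + (L (z - a) - s *: (u - L v)).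
  have -> : z - a = (z - x) - s *: v by rewrite /a opprD addrA.
  rewrite (linB lL (z - x)) (linZ lL) scalerBr cancel4 /Q opprD.
  by rewrite [LHS]addrA.
have us : `|s *: (u - L v)| <= s * k.
  by rewrite normrZ gtr0_norm// ler_wpM2l// ltW.
have aa : `|a - a| <= rho by rewrite subrr normr0 ltW.
have fa : `|f a - Q| <= 2 * (s * k).
  rewrite QE subrr (lin0 lL) sub0r (le_trans (ler_normB _ _))//.
  by have := err a aa; lra.
have fs z : `|z - a| = rho -> 4 * n.+1%:R * (s * k) <= `|f z - Q|.
  move=> hz; have hz' : `|z - a| <= rho by rewrite hz.
  have h2 := err z hz'; have h3 := hm (z - a); rewrite hz in h3.
  have h4 : `|L (z - a)| <= `|f z - Q| + 2 * (s * k).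
    have -> : L (z - a) = (f z - Q) - ((f z - f x - L (z - x)) - s *: (u - L v)).
      by rewrite QE cancel5.
    rewrite (le_trans (ler_normB _ _))// lerD2l (le_trans (ler_normB _ _))//.
    by lra.
  have h5 : m * rho = 8 * n.+1%:R * (s * k).
    by rewrite /rho /k; field; rewrite gt_eqF.
  have n1 : (1 : R) <= n.+1%:R by rewrite ler1n.
  have sk : 0 < s * k by rewrite mulr_gt0.
  have : s * k <= n.+1%:R * (s * k) by rewrite ler_pMl.
  rewrite h5 in h3; move: h3 h4; rewrite -!mulrA; lra.
have [z za fz] : exists2 z, `|z - a| < rho & f z = Q.
  apply: interior_value => //.
    move=> z hz; have [L' hL' sL'] := hA z (DA z hz); exists L' => //.
    by move: hL'; apply: hd_sub => y; exact: DA.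
  move=> z /fs hz; apply: le_lt_trans (sqnorm_le _) _.
  apply: lt_le_trans (sqnorm_ge _).
  have sk : 0 < s * k by rewrite mulr_gt0.
  have h2 : `|f a - Q| ^+ 2 <= (2 * (s * k)) ^+ 2.
    by rewrite ler_sqr ?nnegrE// mulr_ge0// ltW.
  have h3 : (4 * n.+1%:R * (s * k)) ^+ 2 <= `|f z - Q| ^+ 2.
    by rewrite ler_sqr ?nnegrE// !mulr_ge0// ltW.
  apply: lt_le_trans h3; apply: le_lt_trans (ler_wpM2l (ler0n _ _) h2) _.
  have nn : (0 : R) <= n%:R by exact: ler0n.
  have sk2 : 0 < (s * k) ^+ 2 by rewrite exprn_gt0.
  have -> : n%:R * (2 * (s * k)) ^+ 2 = (4 * n%:R) * (s * k) ^+ 2 by ring.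
  have -> : (4 * n.+1%:R * (s * k)) ^+ 2 = (16 * n.+1%:R ^+ 2) * (s * k) ^+ 2 by ring.
  by rewrite ltr_pM2r// -natr1; nra.
by exists z => //; exact: DA (ltW za).
Qed.

End OpenMapping.

(** * Domains of a manifold seen in charts *)

Section Charts.
Context {R : realType} {n : nat} {M : riemannian_manifold R n}.
Implicit Types (A : set M) (i : chart_index M) (x : M) (z : 'rV[R]_n).

Definition chart_img i : set 'rV[R]_n := chart i @` chart_dom i.

Lemma chart_inv_dom i z : chart_img i z -> chart_dom i (chart_inv i z).
Proof. by move=> [x dx <-]; rewrite chartK. Qed.

Lemma chart_invK i z : chart_img i z -> chart i (chart_inv i z) = z.
Proof. by move=> [x dx <-]; rewrite chartK. Qed.

Lemma chart_in_img i x : chart_dom i x -> chart_img i (chart i x).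
Proof. by exists x. Qed.

Lemma chart_setP i A z : chart_set i A z <-> chart_img i z /\ A (chart_inv i z).
Proof.
split=> [[x [Ax dx] <-]|[iz Az]]; first by rewrite chartK//; split=> //; exists x.
by exists (chart_inv i z); [split=> //; exact: chart_inv_dom|exact: chart_invK].
Qed.

Lemma chart_setE i A x : chart_dom i x -> (chart_set i A (chart i x) <-> A x).
Proof.
move=> dx; split=> [/chart_setP[_]|Ax]; first by rewrite chartK.
by exists x.
Qed.

Lemma near_img i z : chart_img i z -> \forall y \near z, chart_img i y.
Proof. by move=> iz; apply: open_nbhs_nbhs; split=> //; exact: chart_img_open. Qed.

Lemma near_dom i x : chart_dom i x -> \forall y \near x, chart_dom i y.
Proof. by move=> dx; apply: open_nbhs_nbhs; split=> //; exact: chart_dom_open. Qed.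

Lemma chart_cvg i x : chart_dom i x -> chart i @ nbhs x --> chart i x.
Proof.
move=> dx; have := @chart_continuous _ _ M i.
rewrite continuous_open_subspace; last exact: chart_dom_open.
by move=> /(_ x); rewrite inE => /(_ dx).
Qed.

Lemma chart_inv_cvg i z : chart_img i z -> chart_inv i @ nbhs z --> chart_inv i z.
Proof.
move=> iz; have := @chart_inv_continuous _ _ M i.
rewrite continuous_open_subspace; last exact: chart_img_open.
by move=> /(_ z); rewrite inE => /(_ iz).
Qed.

Lemma nbhs_chart i x A : chart_dom i x ->
  (nbhs (chart i x) (chart_set i A) <-> nbhs x A).
Proof.
move=> dx; split=> h.
  have h1 : \forall y \near x, chart_set i A (chart i y) := chart_cvg dx h.
  have h2 := near_dom dx.
  by move: h1 h2; apply: filterS2 => y h3 dy; apply/(chart_setE A dy).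
have iz := chart_in_img dx.
have h1 : \forall z \near chart i x, A (chart_inv i z).
  by have := chart_inv_cvg iz; rewrite chartK// => /(_ _ h).
move: h1 (near_img iz); apply: filterS2 => z h1 h2; exact/chart_setP.
Qed.

Lemma chart_set_interior i A x : chart_dom i x ->
  (interior (chart_set i A) (chart i x) <-> interior A x).
Proof. exact: nbhs_chart. Qed.

Lemma chart_set_closure i A x : chart_dom i x ->
  (closure (chart_set i A) (chart i x) <-> closure A x).
Proof.
move=> dx; split=> h B nB.
  have [y [/chart_setP[iy Ay] /chart_setP[_ By]]] := h _ ((nbhs_chart B dx).2 nB).
  by exists (chart_inv i y).
have n1 : \forall y \near x, B (chart i y) := chart_cvg dx nB.
have [y [Ay [By dy]]] := h _ (filterI n1 (near_dom dx)).
by exists (chart i y); split=> //; exact/(chart_setE A dy).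
Qed.

Lemma chart_set_boundary i A x : chart_dom i x ->
  (boundary (chart_set i A) (chart i x) <-> boundary A x).
Proof.
move=> dx; have h1 := chart_set_closure A dx; have h2 := chart_set_interior A dx.
by split=> -[/h1 ? h3]; split=> // /h2.
Qed.

Lemma near_closure i A x : chart_dom i x ->
  \forall z \near chart i x, chart_set i (closure A) z <-> closure (chart_set i A) z.
Proof.
move=> dx; apply: filterS (near_img (chart_in_img dx)) => z [y dy <-].
by rewrite (chart_setE _ dy); apply: iff_sym; exact: chart_set_closure.
Qed.

(** Independence of the open set lets derivatives of transition maps, which are
    taken on overlaps of charts, be composed freely. *)
Lemma hd_open {V W : normedModType R} (O : set V) (f : V -> W) (y : V) L : open O -> O y ->
  has_deriv_on O f y L -> has_deriv_on setT f y L.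
Proof.
move=> oO Oz; apply: hd_eq => //; last exact: near_all.
by apply: filterS (open_nbhs_nbhs (conj oO Oz)) => q.
Qed.

Lemma fat_setT {V : normedModType R} (y : V) : fat setT y.
Proof.
apply: cone_fat; exists 0, 1, 1; split=> //.
Qed.

(** A smooth boundary is given near each point by a defining function in one
    chart; composition with the transition map, whose derivative is invertible,
    gives one in any other chart. The neighbourhood is shrunk to a set on which
    the derivative of [r'] in one fixed direction does not vanish. *)
Lemma chart_local_defining (Om : set M) i x : smooth_boundary Om ->
  boundary Om x -> chart_dom i x -> exists r U,
    [/\ local_defining (chart_set i Om) r U, U (chart i x) & U `<=` chart_img i].
Proof.
move=> sO bx dx; have [i' [U' [r' [[dx' oU' Up'] [Cr' gr' hU']]]]] := sO x bx.
set p' := chart i' x in Up' gr'.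
have [dr' cdr'] : (forall z, U' z -> differentiable_on U' r' z) /\
    (forall v, {within U', continuous (fun z => deriv_on U' r' z v)}).
  exact: (Cr' 1%N).
have [k gk] : exists k, deriv_on U' r' p' (delta_mx 0 k) != 0.
  apply: contrapT => /forallNP h; move/negP: gr'; apply; apply/eqP/rowP => k.
  by rewrite !mxE; apply/eqP/negPn/negP; exact: h.
pose v : 'rV[R]_n := delta_mx 0 k.
pose theta z := chart i' (chart_inv i z).
pose O := chart i @` (chart_dom i `&` chart_dom i').
have OP z : O z <-> chart_img i z /\ chart_dom i' (chart_inv i z).
  split=> [[y [dy dy'] <-]|[iz dz]]; first by rewrite chartK//; split=> //; exists y.
  by exists (chart_inv i z); [split=> //; exact: chart_inv_dom|exact: chart_invK].
have oO : open O.
  rewrite openE => z /OP[iz dz]; rewrite /interior /=.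
  have n1 : \forall y \near z, chart_dom i' (chart_inv i y).
    exact: (chart_inv_cvg iz (near_dom dz)).
  by move: n1 (near_img iz); apply: filterS2 => y ? ?; exact/OP.
have hth z : O z -> exists2 L, has_deriv_on setT theta z L &
    forall w, exists u, L u = w.
  move=> Oz; have [iz dz] := (OP z).1 Oz.
  have [h1 _] := @chart_smooth _ _ M i i' 1%N.
  have [L hL] := h1 z Oz; exists L; first exact: hd_open oO Oz hL.
  have [h2 _] := @chart_smooth _ _ M i' i 1%N.
  have Otz : (chart i' @` (chart_dom i' `&` chart_dom i)) (theta z).
    by exists (chart_inv i z) => //; split=> //; exact: chart_inv_dom.
  have [K hK] := h2 _ Otz.
  have tz : chart i (chart_inv i' (theta z)) = z by rewrite /theta chartK// chart_invK.
  have hL' : has_deriv_on O theta (chart i (chart_inv i' (theta z))) L by rewrite tz.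
  have hc := hd_comp (near_all (theta z) _) hK hL'.
  have {}hc : has_deriv_on (chart i' @` (chart_dom i' `&` chart_dom i)) id (theta z) (L \o K).
    apply: hd_eq (hc _); [exact: near_all| | |].
    - apply: near_all => y [q [dq dq'] <-] /=.
      by rewrite (chartK dq) /theta (chartK dq').
    - by rewrite /= tz.
    - by move=> y [q [dq dq'] <-]; rewrite chartK//; exists q.
  have oO' : open (chart i' @` (chart_dom i' `&` chart_dom i)).
    rewrite openE => y [q [dq dq'] <-]; rewrite /interior /=.
    have := (nbhs_chart (chart_dom i) dq).2 (near_dom dq').
    by apply: filterS => ? [a [da da'] <-]; exists a.
  have LK : L \o K = id.
    exact: hd_uniq (fat_setT _) (hd_open oO' Otz hc) (hd_id _ _).
  by move=> w; exists (K w); have := congr1 (fun f => f w) LK.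
have cth z : O z -> theta @ nbhs z --> theta z.
  by move=> /hth[L hL _]; exact: hd_ctsT hL.
exists (r' \o theta), [set z | O z /\ (U' (theta z) /\ deriv_on U' r' (theta z) v != 0)].
have Op : O (chart i x) by apply/OP; rewrite chartK//; split=> //; exact: chart_in_img.
have thp : theta (chart i x) = p' by rewrite /theta chartK.
split; last 2 first.
- by split; [exact: Op|rewrite thp; split; [exact: Up'|exact: gk]].
- by move=> z [/OP[]].
split.
- rewrite openE => z [Oz [Uz dz]]; rewrite /interior /=.
  have n1 : \forall y \near z, O y by exact: open_nbhs_nbhs.
  have n2 : \forall y \near z, U' (theta y).
    by apply: (cth z Oz); exact: open_nbhs_nbhs.
  have n3 : \forall y \near z, deriv_on U' r' (theta y) v != 0.
    suff h : nbhs (theta z) [set y | deriv_on U' r' y v != 0].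
      by have := cth z Oz _ h; rewrite nbhs_simpl.
    have := cdr' v; rewrite continuous_open_subspace// => /(_ (theta z)).
    rewrite inE => /(_ Uz) cc.
    have : nbhs (deriv_on U' r' (theta z) v) [set y : R | y != 0].
      by apply: open_nbhs_nbhs; split=> //; exact: open_neq.
    exact: cc.
  by move: n1 n2 n3; apply: filterS3.
- move=> z [Oz [Uz dz]]; have [L hL sL] := hth z Oz.
  have hr' := hd_open oU' Uz (deriv_onP (dr' _ Uz)).
  exists (deriv_on U' r' (theta z) \o L); split.
    by apply: hd_comp hL hr'; exact: near_all.
  by have [w Lw] := sL v; exists w; rewrite /= Lw.
- move=> z [/OP[iz dz] [Uz _]].
  have : (chart_set i' Om `&` U') (theta z) <-> U' (theta z) /\ r' (theta z) < 0.
    by rewrite hU'.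
  rewrite /setI /= => h; split.
    by move=> /chart_setP[_ Oz]; apply h.1; split=> //; exact/(chart_setE _ dz).
  move=> rz; apply/chart_setP; split=> //.
  have [/(chart_setE _ dz)//] : chart_set i' Om (theta z) /\ U' (theta z).
  by apply h.2.
Qed.

Lemma dom_cone (Om : set M) i x : open Om -> smooth_boundary Om ->
  closure Om x -> chart_dom i x -> cone_at (chart_set i Om) (chart i x).
Proof.
move=> oO sO cx dx; have [Ox|nOx] := pselect (Om x).
  apply: cone_interior; apply/chart_set_interior => //.
  exact: open_nbhs_nbhs.
have bx : boundary Om x by split=> // /interior_subset.
have [r [U [H Up _]]] := chart_local_defining sO bx dx.
by apply: (ld_cone H Up); exact/chart_set_boundary.
Qed.

Lemma cone_sub {V : normedModType R} (A B : set V) (y : V) :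
  A `<=` B -> cone_at A y -> cone_at B y.
Proof.
by move=> AB [v [e [d [e0 d0 h]]]]; exists v, e, d; split=> // w s ? ?; exact/AB/h.
Qed.

Lemma dom_cone_closure (Om : set M) i x : open Om -> smooth_boundary Om ->
  closure Om x -> chart_dom i x -> cone_at (chart_set i (closure Om)) (chart i x).
Proof.
move=> oO sO cx dx; apply: cone_sub (dom_cone oO sO cx dx).
by move=> z [y [Oy dy] <-]; exists y => //; split=> //; exact: subset_closure.
Qed.

Lemma near_boundary (S : set M) i x : chart_dom i x ->
  \forall z \near chart i x, boundary (chart_set i S) z ->
    [/\ chart_img i z, chart_dom i (chart_inv i z) & boundary S (chart_inv i z)].
Proof.
move=> dx; apply: filterS (near_img (chart_in_img dx)) => z iz bz; split=> //.
  exact: chart_inv_dom.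
by apply/(chart_set_boundary _ (chart_inv_dom iz)); rewrite chart_invK.
Qed.

End Charts.

(** * Jacobian matrices *)

Section Jacobians.
Context {R : realType} {n : nat}.
Local Notation E := 'rV[R]_n.

Lemma lin1_mxE (L : E -> E) v : linear L -> L v = v *m lin1_mx L.
Proof.
move=> lL; apply/rowP => k; rewrite lin_mx_sum// big_ord1 summxE !mxE.
by apply: eq_bigr => l _; rewrite !mxE.
Qed.

Lemma mulmx_linear (J : 'M[R]_n) : linear (fun v : E => v *m J).
Proof. by move=> a u v; rewrite mulmxDl -scalemxAl. Qed.

Lemma mulmx_continuous (J : 'M[R]_n) : continuous (fun v : E => v *m J).
Proof. exact: mx_lin_cts (mulmx_linear J). Qed.

Lemma mulmx_bound (J : 'M[R]_n) :
  exists2 C : R, 0 < C & forall v : E, `|v *m J| <= C * `|v|.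
Proof. exact: lin_bound (mulmx_linear J) (@mulmx_continuous J). Qed.

Lemma hd_jac (A : set E) (f : E -> E) z : differentiable_on A f z ->
  has_deriv_on A f z (fun v => v *m jac_on A f z).
Proof.
move=> /deriv_onP h; have lL := hd_lin h.
suff -> : (fun v => v *m jac_on A f z) = deriv_on A f z by [].
by apply/funext => v; rewrite /jac_on -lin1_mxE.
Qed.

Lemma jac_onE (A : set E) (f : E -> E) z (J : 'M[R]_n) : fat A z ->
  has_deriv_on A f z (fun v => v *m J) -> jac_on A f z = J.
Proof.
move=> fA h; rewrite /jac_on (deriv_onE fA h); apply/matrixP => k l.
by rewrite [LHS]mxE -rowE mxE.
Qed.

Lemma hd_mulmxr {V : normedModType R} m p q (A : set V) (f : V -> 'M[R]_(m, p)) x L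
    (J : 'M[R]_(p, q)) :
  has_deriv_on A f x L -> has_deriv_on A (fun y => f y *m J) x (fun v => L v *m J).
Proof.
move=> h; have := hd_mulmx h (hd_cst A J x).
by under [X in has_deriv_on _ _ _ X -> _]eq_fun do rewrite mulmx0 addr0.
Qed.

Lemma unit_lower_bound (J : 'M[R]_n) : J \in unitmx ->
  exists2 m : R, 0 < m & forall w : E, m * `|w| <= `|w *m J|.
Proof.
move=> uJ; have [C C0 hC] := mulmx_bound (invmx J).
exists C^-1; first by rewrite invr_gt0.
move=> w; rewrite mulrC ler_pdivrMr// mulrC.
by have := hC (w *m J); rewrite mulmxK.
Qed.

End Jacobians.

Lemma cvg_near_within {T T' : topologicalType} (A : set T) (f : T -> T') (x : T) (l : T')
    (B : T' -> Prop) :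
  f @ within A (nbhs x) --> l -> nbhs l B -> \forall y \near x, A y -> B (f y).
Proof. by move=> h /h. Qed.

(** * The image of a domain under a diffeomorphism *)

Section ImageOfDomain.
Context {R : realType} {n : nat} {M : riemannian_manifold R n}.
Implicit Types (A : set M) (i : chart_index M) (x : M).
Local Notation E := 'rV[R]_n.

Lemma cvg_within_chart {Z : topologicalType} i A x (f : M -> Z) (l : Z) : chart_dom i x ->
  (fun z => f (chart_inv i z)) @ within (chart_set i A) (nbhs (chart i x)) --> l ->
  f @ within A (nbhs x) --> l.
Proof.
move=> dx h B nB; have h1 := cvg_near_within h nB.
have h2 : \forall y \near x, chart_set i A (chart i y) -> B (f (chart_inv i (chart i y))).
  exact: (chart_cvg dx h1).
have : \forall y \near x, A y -> B (f y).
  move: h2 (near_dom dx); apply: filterS2 => y h2 dy Ay.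
  by have := h2 ((chart_setE A dy).2 Ay); rewrite chartK.
by [].
Qed.

Context (Om : set M) (Phi : M -> E).
Hypothesis sbd : smooth_bounded_domain Om.
Hypothesis dPhi : diffeo_onto_image (closure Om) Phi.

Let oO : open Om. Proof. by have [[]] := sbd. Qed.
Let sO : smooth_boundary Om. Proof. by have [_ []] := sbd. Qed.
Let kO : compact (closure Om). Proof. by have [_ []] := sbd. Qed.

Definition phi_jac i z : 'M[R]_n :=
  jac_on (chart_set i (closure Om)) (fun y => Phi (chart_inv i y)) z.

Lemma domain_boundaryP x : boundary Om x <-> closure Om x /\ ~ Om x.
Proof.
split=> -[cx nx]; split=> //; first by move=> Ox; apply: nx; exact: open_nbhs_nbhs.
by move=> /interior_subset.
Qed.

Lemma image_hd i x : closure Om x -> chart_dom i x ->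
  has_deriv_on (chart_set i (closure Om)) (fun y => Phi (chart_inv i y)) (chart i x)
    (fun v => v *m phi_jac i (chart i x)).
Proof.
move=> cx dx; apply: hd_jac; have [h _] := dPhi; have [h1 _] := h i.
by apply: h1; exact/chart_setE.
Qed.

Lemma image_cvg x : closure Om x -> Phi @ within (closure Om) (nbhs x) --> Phi x.
Proof.
move=> cx; have [i dx] := chart_cover x; apply: (cvg_within_chart dx).
by have := hd_cts (image_hd cx dx); rewrite chartK.
Qed.

Lemma image_map_inj x y : closure Om x -> closure Om y -> Phi x = Phi y -> x = y.
Proof. by have [_ [G [GK _ _]]] := dPhi => cx cy e; rewrite -(GK x)// -(GK y)// e. Qed.

(** The inverse is differentiable on the image of the part of the domain in one
    chart; by continuity of [G] this is the whole image near [Phi x]. *)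
Lemma image_inverse : exists G : E -> M,
  [/\ forall x, closure Om x -> G (Phi x) = x,
      forall x, closure Om x -> G @ within (Phi @` closure Om) (nbhs (Phi x)) --> x &
      forall i x, closure Om x -> chart_dom i x ->
        phi_jac i (chart i x) \in unitmx /\
        has_deriv_on (Phi @` closure Om) (fun p => chart i (G p)) (Phi x)
          (fun v => v *m invmx (phi_jac i (chart i x)))].
Proof.
have [_ [G [GK cG dG]]] := dPhi; exists G; split=> //.
  by move=> x cx; rewrite -{2}[x]GK//; move/subspace_continuousP: cG => /(_ (Phi x)); apply; exists x.
move=> i x cx dx; set J := phi_jac i (chart i x).
have [h1 _] := dG i.
have SP : (Phi @` (closure Om `&` chart_dom i)) (Phi x) by exists x.
have hK := hd_jac (h1 _ SP); set K := jac_on _ _ _ in hK.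
have hc : has_deriv_on (chart_set i (closure Om)) id (chart i x) (fun v => v *m J *m K).
  have hK' : has_deriv_on (Phi @` (closure Om `&` chart_dom i)) (fun p => chart i (G p))
      (Phi (chart_inv i (chart i x))) (fun v => v *m K) by rewrite chartK.
  have := hd_comp _ (image_hd cx dx) hK' => /(_ _)/=.
  have m1 : \forall y \near chart i x, chart_set i (closure Om) y ->
      (Phi @` (closure Om `&` chart_dom i)) (Phi (chart_inv i y)).
    by apply: near_all => _ [y [cy dy] <-]; rewrite chartK//; exists y.
  move=> /(_ m1); apply: hd_eq; first exact: near_all.
    by apply: near_all => _ [y [cy dy] <-] /=; rewrite chartK// GK.
  by rewrite /= chartK// GK.
have fA := cone_fat (dom_cone_closure oO sO cx dx).
have JK : J *m K = 1%:M.
  apply/row_matrixP => k; rewrite !rowE mulmxA.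
  by have := congr1 (fun f => f (delta_mx 0 k)) (hd_uniq fA hc (hd_id _ _)); rewrite mulmx1.
have [uJ uK] := mulmx1_unit JK; split; first exact: uJ.
have -> : invmx J = K by rewrite -[LHS]mulmx1 -JK mulKmx.
move: hK; apply: hd_eq => //; last exact: near_all.
move/subspace_continuousP: cG => /(_ (Phi x)); rewrite /= => cG.
have SP' : (Phi @` closure Om) (Phi x) by exists x.
have ncx : nbhs (G (Phi x)) (chart_dom i) by rewrite GK//; exact: near_dom.
have := cvg_near_within (cG SP') ncx.
apply: filterS => p h [y cy py]; exists y => //; split=> //.
by have : chart_dom i (G p) := h (ex_intro2 _ _ y cy py); rewrite -py GK.
Qed.

Lemma image_closure : closure (Phi @` Om) = Phi @` closure Om.
Proof.
apply/seteqP; split.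
  have cl : closed (Phi @` closure Om).
    apply: compact_closed; first exact: norm_hausdorff.
    apply: continuous_compact => //; apply/subspace_continuousP => x; exact: image_cvg.
  have /closure_subset : Phi @` Om `<=` Phi @` closure Om.
    by move=> _ [x Ox <-]; exists x => //; exact: subset_closure.
  by move/subset_trans; apply; move/closure_id: cl => <-.
move=> _ [x cx <-] B nB.
have h := cvg_near_within (image_cvg cx) nB.
have [y [Oy hy]] := cx _ h.
by exists (Phi y); split; [exists y|apply: hy; exact: subset_closure].
Qed.

(** Interior directions are preserved, by [cone_image]. This replaces the inverse
    function theorem, which is not available at boundary points. *)
Lemma image_cone i x (v : E) : closure Om x -> chart_dom i x ->
  cone_dir (chart_set i Om) (chart i x) v ->
  cone_dir (Phi @` Om) (Phi x) (v *m phi_jac i (chart i x)).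
Proof.
move=> cx dx hv; have [G [GK cG dG]] := image_inverse.
have [uJ _] := dG i x cx dx; have [m m0 hm] := unit_lower_bound uJ.
have sub : chart_set i Om `<=` chart_set i (closure Om).
  by move=> z [y [Oy dy] <-]; exists y => //; split=> //; exact: subset_closure.
have hf := hd_sub sub (image_hd cx dx).
have hA z : chart_set i Om z -> exists2 L', has_deriv_on (chart_set i Om)
    (fun y => Phi (chart_inv i y)) z L' & forall w, exists v, L' v = w.
  move=> [y [Oy dy] <-]; have cy := subset_closure Oy.
  exists (fun v => v *m phi_jac i (chart i y)); first exact: hd_sub sub (image_hd cy dy).
  move=> w; exists (w *m invmx (phi_jac i (chart i y))).
  by rewrite mulmxKV; last exact: (dG i y cy dy).1.
have [e [d [e0 d0 h]]] := cone_image hf m0 hm hA hv.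
exists e, d; split=> // u s hu hs; have [z [y [Oy dy] <-]] := h u s hu hs.
by rewrite !chartK// => <-; exists y.
Qed.

(** At an interior point every direction, in particular 0, is interior, so that
    its image is interior. *)
Lemma image_boundary P : boundary (Phi @` Om) P <-> exists2 x, boundary Om x & P = Phi x.
Proof.
split.
  move=> [cP nP]; move: cP; rewrite image_closure => -[x cx xP]; exists x => //.
  apply/domain_boundaryP; split=> // Ox; apply: nP; rewrite -xP.
  have [i dx] := chart_cover x.
  have Ai : interior (chart_set i Om) (chart i x).
    by apply/chart_set_interior => //; exact: open_nbhs_nbhs.
  have [e [d [e0 d0 h]]] : cone_dir (Phi @` Om) (Phi x) (0 *m phi_jac i (chart i x)).
    by apply: image_cone => //; exact: cone_dir0.
  have d2 : 0 < d / 2 by rewrite divr_gt0.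
  suff : \forall Q \near Phi x, (Phi @` Om) Q by [].
  apply/nbhs_normP; exists (d / 2 * e); first by rewrite /= mulr_gt0.
  move=> Q; rewrite /ball_ /= => hQ.
  have := h ((d / 2)^-1 *: (Q - Phi x)) (d / 2).
  rewrite scalerA mulfV ?gt_eqF// scale1r [Phi x + _]addrC subrK; apply.
    rewrite mul0mx subr0 normrZ gtr0_norm ?invr_gt0// mulrC ltr_pdivrMr//.
    by rewrite distrC mulrC.
  by rewrite d2 ltr_pdivrMr// ltr_pMr// ltr1n.
move=> [x /domain_boundaryP[cx nx] ->]; split.
  by rewrite image_closure; exists x.
move=> /interior_subset[y Oy yx]; apply: nx.
by rewrite -(image_map_inj (subset_closure Oy) cx yx).
Qed.

Lemma image_fat i x : closure Om x -> chart_dom i x -> fat (closure (Phi @` Om)) (Phi x).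
Proof.
move=> cx dx; rewrite image_closure.
have [G [GK cG dG]] := image_inverse; have [uJ _] := dG i x cx dx.
set J := phi_jac i (chart i x) in uJ.
have := @fat_push _ _ _ (chart_set i (closure Om)) (Phi @` closure Om) _ _ _
  (fun v => v *m invmx J) _ (image_hd cx dx).
rewrite chartK//; apply.
- by apply: near_all => z /chart_setP[_ cz]; exists (chart_inv i z).
- exact: mulmx_linear.
- exact: mulmx_continuous.
- by move=> v; rewrite mulmxK.
- by move=> v; rewrite mulmxKV.
- exact: cone_fat (dom_cone_closure oO sO cx dx).
Qed.

(** Conormals are pulled back by the inverse of [Phi]: tangent vectors travel in
    both directions along curves, inward cones by [image_cone], and outward cones
    because [G] is differentiable at [Phi x]. *)
Lemma image_conormal i x Lc : boundary Om x -> chart_dom i x ->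
  conormal (chart_set i Om) (chart i x) Lc ->
  conormal (Phi @` Om) (Phi x) (fun v => Lc (v *m invmx (phi_jac i (chart i x)))).
Proof.
move=> bx dx [lL [m Lm] [tL inL outL]].
have [cx nx] := (domain_boundaryP x).1 bx.
have [G [GK cG dG]] := image_inverse; have [uJ hG] := dG i x cx dx.
set J := phi_jac i (chart i x) in uJ hG *.
split.
- by move=> a u v; rewrite mulmxDl -scalemxAl lL.
- by exists (m *m J); rewrite mulmxK.
have bs : boundary (Phi @` Om) `<=` Phi @` closure Om.
  by move=> P [cP _]; rewrite -image_closure.
have Gdom : \forall P \near Phi x, (Phi @` closure Om) P -> chart_dom i (G P).
  exact: cvg_near_within (cG x cx) (near_dom dx).
split.
- move=> v; rewrite -tL; split=> tv.
    have := @tangent_push _ _ _ (boundary (chart_set i Om)) _ (fun p => chart i (G p)) _ v _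
      _ (near_all _ bs) hG tv; rewrite GK//; apply.
    apply: filterS Gdom => P hP bP; have := hP (bs _ bP).
    have /image_boundary[y by_ ->] := bP; have [cy _] := (domain_boundaryP y).1 by_.
    by rewrite GK// => dy; exact/chart_set_boundary.
  have := @tangent_push _ _ _ (boundary (Phi @` Om)) (chart_set i (closure Om))
     (fun z => Phi (chart_inv i z)) _ _ _ _ _ (image_hd cx dx) tv.
  rewrite chartK// mulmxKV//; apply.
    apply: filterS (near_img (chart_in_img dx)) => z [y dy <-] /(chart_set_boundary Om dy) by_.
    by apply/image_boundary; exists y => //; rewrite chartK.
  apply: filterS (near_img (chart_in_img dx)) => z [y dy <-] /(chart_set_boundary Om dy) [cy _].
  by exists y.
- by move=> v /inL; rewrite -{2}[v](mulmxKV uJ); exact: image_cone.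
move=> v /outL[e [d [e0 d0 hout]]].
have [C C0 hC] := mulmx_bound (invmx J).
have v1 : 0 < `|v| + 1 by rewrite ltr_wpDl.
have e1 : 0 < e / 2 / (`|v| + 1) by rewrite !divr_gt0.
have [_ _ /(_ _ e1)/near_withinP[d1 d10 h1]] := hG.
have /nbhs_normP[d2 /= d20 h2] := Gdom.
exists (Num.min 1 (e / 2 / C)), (Num.min d (Num.min d1 d2 / (`|v| + 1))).
split; rewrite ?lt_min ?ltr01 ?d0 /= ?divr_gt0// ?lt_min ?d10//.
move=> w s; rewrite !lt_min => /andP[w1 wC] /and3P[s0 sd].
rewrite ltr_pdivlMr// lt_min => /andP[s1 s2] [y Oy yP].
have cy := subset_closure Oy.
have nw : `|w| <= `|v| + 1.
  by rewrite -[w](subrK v) (le_trans (ler_normD _ _))// addrC lerD2l ltW.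
have sw : `|s *: w| <= s * (`|v| + 1) by rewrite normrZ gtr0_norm// ler_wpM2l// ltW.
have SP : (Phi @` closure Om) (Phi x + s *: w) by exists y.
have dy : chart_dom i y.
  rewrite -(GK y cy) yP; apply: h2 => //.
  by rewrite /ball_ /= opprD addrA subrr sub0r normrN (le_lt_trans sw).
have := h1 _ SP; rewrite -yP !GK// yP [Phi x + _]addrC addrK => /(_ (le_lt_trans sw s1)) h3.
apply: (hout (s^-1 *: (chart i y - chart i x)) s); last 2 first.
- by rewrite s0.
- by rewrite scalerA mulfV ?gt_eqF// scale1r addrC subrK; exact/chart_setE.
have -> : s^-1 *: (chart i y - chart i x) - v *m invmx J =
   s^-1 *: (chart i y - chart i x - s *: w *m invmx J) + (w - v) *m invmx J.
  rewrite (scalerBr _ (chart i y - chart i x)) mulmxBl.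
  have -> : s^-1 *: (s *: w *m invmx J) = w *m invmx J.
    by rewrite -scalemxAl scalerA mulVf ?gt_eqF// scale1r.
  by rewrite addrA subrK.
rewrite (le_lt_trans (ler_normD _ _))// [e]splitr ler_ltD//.
  rewrite normrZ gtr0_norm ?invr_gt0// mulrC ler_pdivrMr//.
  apply: le_trans h3 _; apply: le_trans (ler_wpM2l (ltW e1) sw) _.
  by rewrite mulrCA divfK ?gt_eqF// mulrC.
by apply: le_lt_trans (hC _) _; rewrite mulrC -ltr_pdivlMr.
Qed.

(** In the flat metric [G0] the form is the derivative of a normal field, and
    [nu] read through the inverse of [Phi] is such a field: it is enough to
    differentiate a conormal field along the boundary of the domain. *)
Lemma image_second_form i x (G0 : 'M[R]_n) (nu : E -> E) Lnu v w :
  boundary Om x -> chart_dom i x -> posdef G0 ->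
  (\forall z \near chart i x, boundary (chart_set i Om) z ->
     conormal (chart_set i Om) z (fun v => (nu z *m (v *m phi_jac i z)^T) 0 0)) ->
  has_deriv_on (boundary (chart_set i Om)) nu (chart i x) Lnu ->
  tangent_to (boundary (chart_set i Om)) (chart i x) v ->
  tangent_to (boundary (chart_set i Om)) (chart i x) w ->
  let J := phi_jac i (chart i x) in
  bform_norm (invmx G0) (nu (chart i x)) *
    second_form (Phi @` Om) (fun=> G0) (Phi x) (v *m J) (w *m J) =
  (Lnu v *m (w *m J)^T) 0 0.
Proof.
move=> bx dx pG hnu dnu tv tw J.
have [cx nx] := (domain_boundaryP x).1 bx.
have [G [GK cG dG]] := image_inverse; have [uJ hG] := dG i x cx dx.
rewrite -/J in uJ hG.
have uG := posdef_unit pG; have [Gs _] := pG.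
have iGs : (invmx G0)^T = invmx G0 by rewrite trmx_inv Gs.
have bs : boundary (Phi @` Om) `<=` Phi @` closure Om.
  by move=> P [cP _]; rewrite -image_closure.
(* the metric dual of the conormal, a normal field on the boundary of the image *)
pose b P := nu (chart i (G P)) *m invmx G0.
have bE P u : bform G0 (b P) u = (nu (chart i (G P)) *m u^T) 0 0.
  by rewrite /bform /b mulmxKV.
have bxi : boundary (chart_set i Om) (chart i x) by exact/chart_set_boundary.
have cn := nbhs_singleton hnu bxi.
have hN0 P y : boundary Om y -> P = Phi y -> chart_dom i y ->
    conormal (chart_set i Om) (chart i y) (fun v => (nu (chart i y) *m (v *m phi_jac i (chart i y))^T) 0 0) ->
    0 < bform G0 (b P) (b P) /\
    unit_normal (Phi @` Om) (fun=> G0) P = (bform_norm G0 (b P))^-1 *: b P.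
  move=> by_ -> dy hc; have [cy _] := (domain_boundaryP y).1 by_.
  have [uJy _] := dG i y cy dy.
  apply: (unit_normalE (k := 1) (image_conormal by_ dy hc)) => // u.
  by rewrite bE mul1r GK// mulmxKV.
have Gdom : \forall P \near Phi x, (Phi @` closure Om) P -> chart_dom i (G P).
  exact: cvg_near_within (cG x cx) (near_dom dx).
have hN : \forall P \near Phi x, boundary (Phi @` Om) P ->
    unit_normal (Phi @` Om) (fun=> G0) P = (bform_norm G0 (b P))^-1 *: b P.
  have n1 : \forall P \near Phi x, (Phi @` closure Om) P ->
      boundary (chart_set i Om) (chart i (G P)) ->
      conormal (chart_set i Om) (chart i (G P))
        (fun v => (nu (chart i (G P)) *m (v *m phi_jac i (chart i (G P)))^T) 0 0).
    have hnu' : nbhs (chart i (G (Phi x))) (fun z => boundary (chart_set i Om) z ->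
      conormal (chart_set i Om) z (fun v => (nu z *m (v *m phi_jac i z)^T) 0 0)).
      by rewrite GK.
    exact: cvg_near_within (hd_cts hG) hnu'.
  move: Gdom n1; apply: filterS2 => P h1 h2 bP; have SP := bs _ bP.
  have {}h1 := h1 SP; have {}h2 := h2 SP.
  have /image_boundary[y by_ Py] := bP; have [cy _] := (domain_boundaryP y).1 by_.
  move: h1 h2; rewrite Py GK// => dy h2.
  by have [] := hN0 _ y by_ erefl dy (h2 ((chart_set_boundary Om dy).2 by_)).
have [bb _] := hN0 _ x bx erefl dx cn.
have hb : has_deriv_on (boundary (Phi @` Om)) b (Phi x)
    (fun u => Lnu (u *m invmx J) *m invmx G0).
  suff h0 : has_deriv_on (boundary (Phi @` Om)) (fun P => nu (chart i (G P))) (Phi x)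
    (fun u => Lnu (u *m invmx J)) by exact: hd_mulmxr h0.
  apply: (@hd_comp _ _ _ _ _ (boundary (chart_set i Om)) (fun P => chart i (G P)) nu).
  - apply: filterS Gdom => P hP bP; have := hP (bs _ bP).
    have /image_boundary[y by_ ->] := bP; have [cy _] := (domain_boundaryP y).1 by_.
    by rewrite (GK y cy) => dy; exact: (chart_set_boundary Om dy).2 by_.
  - exact: hd_sub hG.
  - by rewrite GK.
have bP0 : boundary (Phi @` Om) (Phi x) by apply/image_boundary; exists x.
have [_ _ [tL _ _]] := image_conormal bx dx cn; rewrite -/J in tL.
have tv' : tangent_to (boundary (Phi @` Om)) (Phi x) (v *m J).
  by apply/tL; rewrite mulmxK//; have [_ _ [t _ _]] := cn; exact/t.
have bw : bform G0 (b (Phi x)) (w *m J) = 0.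
  by rewrite bE GK//; have [_ _ [t _ _]] := cn; exact/t.
have := second_form_eval bP0 hN hb (hd_cst _ G0 (Phi x)) (image_fat cx dx) pG bb tv' bw.
have b0 u1 u2 : bform (0 : 'M[R]_n) u1 u2 = 0.
  by rewrite /bform mulmx0 mul0mx mxE.
rewrite !b0 addr0 subr0 mulr0 addr0.
have -> : bform_norm G0 (b (Phi x)) = bform_norm (invmx G0) (nu (chart i x)).
  rewrite /bform_norm; congr Num.sqrt; rewrite /bform /b GK//.
  by rewrite trmx_mul iGs mulmxKV// mulmxA.
by move=> ->; rewrite /bform mulmxKV// mulmxK.
Qed.

End ImageOfDomain.

(** * Higher derivatives on products *)

Section Products.
Context {R : realType}.
Implicit Types V W Z : normedModType R.

Lemma pair_cts {V W Z} (f : V -> W) (g : V -> Z) :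
  continuous f -> continuous g -> continuous (fun v => (f v, g v)).
Proof. by move=> cf cg v; apply: cvg_pair; [exact: cf|exact: cg]. Qed.

Lemma hd_pair {V W Z} (A : set V) (f : V -> W) (g : V -> Z) x Lf Lg :
  has_deriv_on A f x Lf -> has_deriv_on A g x Lg ->
  has_deriv_on A (fun y => (f y, g y)) x (fun v => (Lf v, Lg v)).
Proof.
move=> [lf cf hf] [lg cg hg]; split.
- by move=> a u v; rewrite lf lg.
- exact: pair_cts.
move=> e e0; move: (hf e e0) (hg e e0); apply: filterS2 => y h1 h2.
by rewrite [`|_|]/(Num.max _ _) ge_max h1 h2.
Qed.

Lemma cone_prod {V W} (A : set V) (B : set W) x y :
  cone_at A x -> cone_at B y -> cone_at (A `*` B) (x, y).
Proof.
move=> [v [e [d [e0 d0 h]]]] [w [e' [d' [e'0 d'0 h']]]].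
exists (v, w), (Num.min e e'), (Num.min d d'); split; rewrite ?lt_min ?e0 ?d0//.
move=> [z1 z2] s; rewrite [`|_|]/(Num.max _ _) !lt_min gt_max => /andP[a b].
move=> /and3P[s0 sd sd']; move: a b; rewrite !gt_max /= => /andP[a1 a2] /andP[b1 b2].
by split=> /=; [apply: h|apply: h'] => //; rewrite s0.
Qed.

Lemma hd_slice1 {V W Z} (A : set V) (B : set W) (F : V * W -> Z) x y L : B y ->
  has_deriv_on (A `*` B) F (x, y) L ->
  has_deriv_on A (fun x' => F (x', y)) x (fun v => L (v, 0)).
Proof.
move=> By hF; have h := hd_pair (hd_id A x) (hd_cst A y x).
by apply: (hd_comp (B := A `*` B)) h hF; exact: near_all.
Qed.

Lemma hd_slice2 {V W Z} (A : set V) (B : set W) (F : V * W -> Z) x y L : A x ->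
  has_deriv_on (A `*` B) F (x, y) L ->
  has_deriv_on B (fun y' => F (x, y')) y (fun v => L (0, v)).
Proof.
move=> Ax hF; have h := hd_pair (hd_cst B x y) (hd_id B y).
by apply: (hd_comp (B := A `*` B)) h hF; exact: near_all.
Qed.

(** Forgets what is asked of the top derivatives, so that the cost, the potential
    and [hs] are treated alike. *)
Definition diff_class {V W} (k : nat) (A : set V) (f : V -> W) : Prop :=
  class_on (fun=> True) k A f.

Lemma class_diff {V W} (top : (V -> W) -> Prop) k A f :
  class_on top k A f -> diff_class k A f.
Proof.
rewrite /diff_class; elim: k f => [//|k IH] f /= [h1 h2].
by split; [exact: h1|move=> v; exact: IH (h2 v)].
Qed.

Lemma deriv_on_congr {V W} (A : set V) (f g : V -> W) x : A x ->
  (forall y, A y -> f y = g y) -> deriv_on A f x = deriv_on A g x.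
Proof.
by move=> Ax fg; apply: deriv_on_eq; [exact: near_all|exact: near_all|exact: fg].
Qed.

Lemma schwarz_class {V} (A : set V) (f : V -> R) x a b :
  diff_class 2 A f -> A x -> cone_at A x ->
  deriv_on A (fun y => deriv_on A f y a) x b =
  deriv_on A (fun y => deriv_on A f y b) x a.
Proof. by move=> [d1 d2] Ax cA; apply: schwarz => // v; have [h _] := d2 v; exact: h. Qed.

Lemma deriv3_swap {V} (A : set V) (f : V -> R) x a b d :
  diff_class 3 A f -> (forall y, A y -> cone_at A y) -> A x ->
  deriv_on A (fun y => deriv_on A (fun z => deriv_on A f z a) y b) x d =
  deriv_on A (fun y => deriv_on A (fun z => deriv_on A f z d) y b) x a.
Proof.
move=> df cA Ax; have [d1 d2] := df.
have inner p q r : deriv_on A (fun y => deriv_on A (fun z => deriv_on A f z p) y q) x r =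
    deriv_on A (fun y => deriv_on A (fun z => deriv_on A f z q) y p) x r.
  have -> // := @deriv_on_congr _ _ A _ (fun y => deriv_on A (fun z => deriv_on A f z q) y p) x Ax.
  move=> y Ay; apply: schwarz_class => //; last exact: cA.
  by split=> // v; have [h1 h2] := d2 v; split.
have outer p q r : deriv_on A (fun y => deriv_on A (fun z => deriv_on A f z p) y q) x r =
    deriv_on A (fun y => deriv_on A (fun z => deriv_on A f z p) y r) x q.
  by apply: schwarz_class; [exact: d2 p|exact: Ax|exact: cA].
by rewrite inner outer inner.
Qed.

End Products.

(** * Hessians and their derivatives *)

Section Hessians.
Context {R : realType} {n : nat}.
Local Notation E := 'rV[R]_n.
Local Notation e_ k := (delta_mx 0 k : E).

Lemma bform_bilinear (F : E -> E -> R) v w :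
  (forall w, linear (F^~ w)) -> (forall v, linear (F v)) ->
  bform (\matrix_(k, l) F (e_ k) (e_ l)) v w = F v w.
Proof.
move=> l1 l2; rewrite [in RHS](row_sum_delta v) (lin_sum (l1 w)).
rewrite /bform -mulmxA mxE; apply: eq_bigr => k _.
rewrite (linZ (l1 w)) /GRing.scale /=; congr (_ * _).
rewrite [in RHS](row_sum_delta w) (lin_sum (l2 _)) mxE; apply: eq_bigr => l _.
by rewrite (linZ (l2 _)) !mxE /GRing.scale /= mulrC.
Qed.

Lemma bform_delta (B : 'M[R]_n) k l : bform B (e_ k) (e_ l) = B k l.
Proof.
rewrite /bform -rowE mxE (bigD1 l)//= big1 ?addr0.
  by rewrite !mxE !eqxx mulr1.
by move=> m ml; rewrite !mxE (negPf ml) andbF mulr0.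
Qed.

(** Reduces the derivative of a Hessian, or of a block of one, to third derivatives
    of a scalar function. *)
Lemma hd_of_bform {V : normedModType R} (S : set V) (Q : V -> 'M[R]_n)
    (F : E -> E -> V -> R) z : fat S z -> S z ->
  (forall v w, differentiable_on S (F v w) z) ->
  (forall y v w, S y -> bform (Q y) v w = F v w y) ->
  exists L, has_deriv_on S Q z L /\
    forall h v w, bform (L h) v w = deriv_on S (F v w) z h.
Proof.
move=> fS Sz dF hQ; have [L hL] : differentiable_on S Q z.
  apply: diff_mx => k l; have [L hL] := dF (e_ k) (e_ l); exists L; move: hL.
  by apply: hd_eq; [exact: near_all|apply: near_all => y Sy|]; rewrite -hQ// bform_delta.
exists L; split=> // h v w.
have hb := hd_bform hL (hd_cst S v z) (hd_cst S w z).
have -> : deriv_on S (F v w) z = fun h => bform (L h) v w; last by [].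
apply: deriv_onE => //.
have -> : (fun h => bform (L h) v w) =
    (fun h => bform (Q z) 0 w + bform (L h) v w + bform (Q z) v 0).
  by apply/funext => k; rewrite (lin0 (bform_linl _ _)) (lin0 (bform_linr _ _)) add0r addr0.
by move: hb; apply: hd_eq; [exact: near_all|apply: near_all => y Sy|]; rewrite hQ.
Qed.

Lemma bform_inj (B C : 'M[R]_n) : (forall v w, bform B v w = bform C v w) -> B = C.
Proof. by move=> h; apply/matrixP => k l; rewrite -!bform_delta. Qed.

Lemma rV_inj (u v : E) : (forall w : E, (u *m w^T) 0 0 = (v *m w^T) 0 0) -> u = v.
Proof.
move=> h; apply/rowP => k; have := h (e_ k).
rewrite !mxE (bigD1 k)//= big1 ?addr0 => [|l lk]; last first.
  by rewrite !mxE (negPf lk) andbF mulr0.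
rewrite (bigD1 k)//= big1 ?addr0 => [|l lk]; last first.
  by rewrite !mxE (negPf lk) andbF mulr0.
by rewrite !mxE !eqxx !mulr1.
Qed.

Lemma pairing_neq0 (g : E) : g <> 0 -> exists v : E, (g *m v^T) 0 0 != 0.
Proof.
move=> g0; apply: contrapT => h; apply: g0; apply: rV_inj => w.
rewrite mul0mx [RHS]mxE; apply/eqP/negPn/negP => hw; apply: h; by exists w.
Qed.

Variable (A : set E).
Hypothesis cA : forall z, A z -> cone_at A z.

Let fA z (Az : A z) : fat A z := cone_fat (cA Az).

Lemma deriv_on_lin {V W : normedModType R} (S : set V) (f : V -> W) x :
  differentiable_on S f x -> linear (deriv_on S f x).
Proof. by move=> /deriv_onP; exact: hd_lin. Qed.

Lemma deriv2_lin {V W : normedModType R} (S : set V) (f : V -> W) x w : fat S x -> S x ->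
  diff_class 2 S f -> linear (fun v => deriv_on S (fun y => deriv_on S f y v) x w).
Proof.
move=> fS Sx [d1 d2] k u v.
have h p : has_deriv_on S (fun y => deriv_on S f y p) x
    (deriv_on S (fun y => deriv_on S f y p) x).
  by apply: deriv_onP; have [h _] := d2 p; exact: h.
have lk : linear (fun z : W => k *: z).
  by move=> a p q; rewrite scalerDr !scalerA mulrC.
have ck : continuous (fun z : W => k *: z).
  by apply: (@lin_cts _ _ _ _ `|k|) => // z; rewrite normrZ.
have H := hd_add (hd_post lk ck (h u)) (h v).
have -> // : deriv_on S (fun y => deriv_on S f y (k *: u + v)) x =
  fun w => k *: deriv_on S (fun y => deriv_on S f y u) x w +
           deriv_on S (fun y => deriv_on S f y v) x w.
apply: deriv_onE => //; move: H; apply: hd_eq; first exact: near_all.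
  by apply: near_all => y Sy; rewrite (deriv_on_lin (d1 y Sy)).
by rewrite (deriv_on_lin (d1 x Sx)).
Qed.

Lemma grad_onE (f : E -> R) z v : linear (deriv_on A f z) ->
  (grad_on A f z *m v^T) 0 0 = deriv_on A f z v.
Proof.
move=> l; rewrite mxE {2}[v]row_sum_delta (lin_sum l); apply: eq_bigr => k _.
by rewrite !mxE (linZ l) mulrC.
Qed.

Lemma hd_grad (f : E -> R) z : diff_class 2 A f -> A z ->
  has_deriv_on A (grad_on A f) z (fun v => v *m hess_on A f z).
Proof.
move=> [d1 d2] Az; rewrite /hess_on; apply: hd_jac; apply: diff_mx => k l.
have [h _] := d2 (e_ l); have [L hL] := h z Az; exists L; move: hL.
by apply: hd_eq; [exact: near_all|apply: near_all => y _|]; rewrite /grad_on mxE.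
Qed.

Lemma hess_onE (f : E -> R) z v w : diff_class 2 A f -> A z ->
  bform (hess_on A f z) v w = deriv_on A (fun y => deriv_on A f y w) z v.
Proof.
move=> df Az; have [d1 d2] := df.
rewrite -(bform_bilinear (F := fun v w => deriv_on A (fun y => deriv_on A f y w) z v)).
- congr bform; apply/matrixP => k l; rewrite [RHS]mxE.
  have h := hd_entry 0 l (hd_grad df Az).
  have h' : has_deriv_on A (fun y => deriv_on A f y (e_ l)) z
      (fun v => (v *m hess_on A f z) 0 l).
    by move: h; apply: hd_eq; [exact: near_all|apply: near_all => y _|]; rewrite /grad_on mxE.
  by rewrite (deriv_onE (fA Az) h') /= -rowE [RHS]mxE.
- by move=> w'; apply: deriv_on_lin; have [h _] := d2 w'; exact: h.
- by move=> v'; apply: deriv2_lin => //; exact: fA.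
Qed.

Lemma hess_on_sym (f : E -> R) z : diff_class 2 A f -> A z ->
  (hess_on A f z)^T = hess_on A f z.
Proof.
move=> df Az; apply: bform_inj => v w.
have -> : bform (hess_on A f z)^T v w = bform (hess_on A f z) w v.
  rewrite /bform; have -> : (w *m hess_on A f z *m v^T) 0 0 =
    (w *m hess_on A f z *m v^T)^T 0 0 by rewrite [RHS]mxE.
  by rewrite !trmx_mul trmxK mulmxA.
by rewrite !hess_onE//; apply: schwarz_class => //; exact: cA.
Qed.

Lemma hd_hess (f : E -> R) z : diff_class 3 A f -> A z ->
  exists L, has_deriv_on A (hess_on A f) z L /\
    forall a v w, bform (L a) v w =
      deriv_on A (fun y => deriv_on A (fun y' => deriv_on A f y' w) y v) z a.
Proof.
move=> df Az; have [d1 d2] := df.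
have df2 : diff_class 2 A f by split=> // v; have [h1 h2] := d2 v.
apply: (hd_of_bform (F := fun v w => deriv_on A (fun y => deriv_on A f y w) ^~ v)).
- exact: fA.
- exact: Az.
- by move=> v w; have [_ h] := d2 w; have [h' _] := h v; exact: h'.
- by move=> y v w Ay; exact: hess_onE.
Qed.

(** Total symmetry of third derivatives, in the form in which it is applied to
    the potential. *)
Lemma hd_hess_swap (f : E -> R) z L a v w : diff_class 3 A f -> A z ->
  has_deriv_on A (hess_on A f) z L -> bform (L a) v w = bform (L w) v a.
Proof.
move=> df Az hL; have [L' [hL' LE]] := hd_hess df Az.
by rewrite (hd_uniq (fA Az) hL hL') !LE; exact: deriv3_swap.
Qed.

End Hessians.

(** * Second derivatives on a product *)

Section MixedDerivatives.
Context {R : realType} {n : nat}.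
Local Notation E := 'rV[R]_n.
Local Notation e_ k := (delta_mx 0 k : E).
Variables (A B : set E) (F : E * E -> R).
Hypothesis cA : forall z, A z -> cone_at A z.
Hypothesis cB : forall z, B z -> cone_at B z.
Hypothesis dF : diff_class 3 (A `*` B) F.
Local Notation S := (A `*` B).
Local Notation D v f := (fun z => deriv_on S f z v).

(** The order of the indices of [mixed_yx] makes [v *m mixed_yx z] the derivative
    of [mixed_x] in the direction [v] of the second factor. *)
Definition mixed_x : E * E -> E := fun z => \row_k D (e_ k, 0) F z.
Definition mixed_y : E * E -> E := fun z => \row_k D (0, e_ k) F z.
Definition mixed_xx : E * E -> 'M[R]_n :=
  fun z => \matrix_(k, l) D (e_ k, 0) (D (e_ l, 0) F) z.
Definition mixed_yx : E * E -> 'M[R]_n :=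
  fun z => \matrix_(k, l) D (0, e_ k) (D (e_ l, 0) F) z.

Let cS z : S z -> cone_at S z.
Proof. by case: z => z1 z2 [/= Az Bz]; apply: cone_prod; [exact: cA|exact: cB]. Qed.

Let fS z (Sz : S z) : fat S z := cone_fat (cS Sz).

Let dF2 : diff_class 2 S F.
Proof. by have [d1 d2] := dF; split=> // v; have [h1 h2] := d2 v. Qed.

Let dFv v : diff_class 2 S (D v F).
Proof. exact: dF.2 v. Qed.

Let l1 z v : S z -> linear (deriv_on S (D v F) z).
Proof. by move=> Sz; apply: deriv_on_lin; have [h _] := dFv v; exact: h. Qed.

Let l2 z w : S z -> linear (fun v => deriv_on S (D v F) z w).
Proof. by move=> Sz; apply: deriv2_lin => //; exact: fS. Qed.

Let linx : linear (fun v : E => (v, 0 : E)).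
Proof. by move=> a u v; apply/pair_equal_spec; rewrite /= scaler0 addr0. Qed.

Let liny : linear (fun v : E => (0 : E, v)).
Proof. by move=> a u v; apply/pair_equal_spec; rewrite /= scaler0 addr0. Qed.

Let comp_lin {V W Z : normedModType R} (f : V -> W) (g : W -> Z) :
  linear f -> linear g -> linear (fun v => g (f v)).
Proof. by move=> lf lg a u v; rewrite lf lg. Qed.

Lemma bform_mixed_xx z v w : S z -> bform (mixed_xx z) v w = D (v, 0) (D (w, 0) F) z.
Proof.
move=> Sz /=; rewrite -(bform_bilinear (F := fun v w => D (v, 0) (D (w, 0) F) z))//.
- by move=> w'; exact: comp_lin linx (l1 _ Sz).
- by move=> v'; exact: comp_lin linx (l2 _ Sz).
Qed.

Lemma bform_mixed_yx z v w : S z -> bform (mixed_yx z) v w = D (0, v) (D (w, 0) F) z.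
Proof.
move=> Sz /=; rewrite -(bform_bilinear (F := fun v w => D (0, v) (D (w, 0) F) z))//.
- by move=> w'; exact: comp_lin liny (l1 _ Sz).
- by move=> v'; exact: comp_lin linx (l2 _ Sz).
Qed.

Lemma hd_mixed_x z : S z ->
  has_deriv_on S mixed_x z (fun v => v.1 *m mixed_xx z + v.2 *m mixed_yx z).
Proof.
move=> Sz; apply: hd_mxE => a k; rewrite (ord1 a).
have h : has_deriv_on S (D (e_ k, 0) F) z (deriv_on S (D (e_ k, 0) F) z).
  by apply: deriv_onP; have [h _] := dFv (e_ k, 0); exact: h.
have -> : (fun v : E * E => (v.1 *m mixed_xx z + v.2 *m mixed_yx z) 0 k : R) =
    deriv_on S (D (e_ k, 0) F) z.
  apply/funext => -[v w] /=.
  have -> : (v, w) = (v, 0) + (0, w) :> E * E.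
    by congr (_, _); rewrite /= ?addr0 ?add0r.
  rewrite (linD (l1 _ Sz)) -(bform_mixed_xx _ _ Sz) -(bform_mixed_yx _ _ Sz) mxE.
  by congr (_ + _); rewrite /bform -[_ *m (e_ k)^T]trmxK trmx_mul trmxK -rowE !mxE.
by move: h; apply: hd_eq; [exact: near_all|apply: near_all => y Sy|]; rewrite mxE.
Qed.

Lemma hd_mixed_y z : S z -> exists L,
  has_deriv_on S mixed_y z L /\ forall v, L (v, 0) = v *m (mixed_yx z)^T.
Proof.
move=> Sz; exists (fun v => \row_k deriv_on S (D (0, e_ k) F) z v); split.
  apply: hd_mxE => a k.
  have h : has_deriv_on S (D (0, e_ k) F) z (deriv_on S (D (0, e_ k) F) z).
    by apply: deriv_onP; have [h _] := dFv (0, e_ k); exact: h.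
  under [X in has_deriv_on _ _ _ X]eq_fun do rewrite mxE.
  by move: h; apply: hd_eq; [exact: near_all|apply: near_all => y Sy|]; rewrite mxE.
move=> v; apply/rowP => k; rewrite mxE schwarz_class//; last exact: cS.
rewrite -bform_mixed_yx// /bform -rowE.
by rewrite !mxE; apply: eq_bigr => l _; rewrite !mxE mulrC.
Qed.

Lemma hd_mixed_xx z : S z -> exists L, has_deriv_on S mixed_xx z L /\
  forall h v w, bform (L h) v w = deriv_on S (D (v, 0) (D (w, 0) F)) z h.
Proof.
move=> Sz; apply: (hd_of_bform (F := fun v w => D (v, 0) (D (w, 0) F))) => //.
- exact: fS.
- by move=> v w; have [_ h] := dFv (w, 0); have [h' _] := h (v, 0); exact: h'.
- by move=> y v w Sy; exact: bform_mixed_xx.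
Qed.

Lemma hd_mixed_yx z : S z -> exists L, has_deriv_on S mixed_yx z L /\
  forall h v w, bform (L h) v w = deriv_on S (D (0, v) (D (w, 0) F)) z h.
Proof.
move=> Sz; apply: (hd_of_bform (F := fun v w => D (0, v) (D (w, 0) F))) => //.
- exact: fS.
- by move=> v w; have [_ h] := dFv (w, 0); have [h' _] := h (0, v); exact: h'.
- by move=> y v w Sy; exact: bform_mixed_yx.
Qed.

Lemma mixed_xx_sym z : S z -> (mixed_xx z)^T = mixed_xx z.
Proof.
move=> Sz; apply/matrixP => k l; rewrite !mxE.
by apply: schwarz_class => //; exact: cS.
Qed.

Lemma mixed_xx_swap z L a v w : S z -> has_deriv_on S mixed_xx z L ->
  bform (L (a, 0)) v w = bform (L (w, 0)) v a.
Proof.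
move=> Sz hL; have [L' [hL' LE]] := hd_mixed_xx Sz.
by rewrite (hd_uniq (fS Sz) hL hL') !LE; exact: deriv3_swap.
Qed.

(** Exchange of an [x] and a [y] derivative: the variation of [mixed_xx] when
    the second point moves is a variation of [mixed_yx] when the first one does. *)
Lemma mixed_xx_yx z L K e v w : S z -> has_deriv_on S mixed_xx z L ->
  has_deriv_on S mixed_yx z K -> bform (L (0, e)) v w = bform (K (v, 0)) e w.
Proof.
move=> Sz hL hK; have [L' [hL' LE]] := hd_mixed_xx Sz.
have [K' [hK' KE]] := hd_mixed_yx Sz.
rewrite (hd_uniq (fS Sz) hL hL') (hd_uniq (fS Sz) hK hK') LE KE.
by apply: schwarz_class => //; exact: cS.
Qed.

End MixedDerivatives.

(** * Inverse matrices *)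

Section Quotients.
Context {R : realType} {n : nat}.
Local Notation E := 'rV[R]_n.

(** The derivative of [g Q^-1] is characterised by differentiating its product
    with [Q], which keeps the derivative of the inverse implicit. *)
Lemma hd_quotient {V : normedModType R} (S : set V) (g : V -> E) (Q : V -> 'M[R]_n) x Lg LQ :
  fat S x -> Q x \in unitmx -> (\forall y \near x, S y -> Q y \in unitmx) ->
  has_deriv_on S g x Lg -> has_deriv_on S Q x LQ ->
  exists L, has_deriv_on S (fun y => g y *m invmx (Q y)) x L /\
    forall v, L v *m Q x + g x *m invmx (Q x) *m LQ v = Lg v.
Proof.
move=> fS uQ nQ hg hQ; have [LI hI] := diff_invmx uQ hQ.
exists (fun v => Lg v *m invmx (Q x) + g x *m LI v).
have hL := hd_mulmx hg hI; split=> // v.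
have hP := hd_mulmx hL hQ.
have hg' : has_deriv_on S g x
  (fun v => (Lg v *m invmx (Q x) + g x *m LI v) *m Q x + g x *m invmx (Q x) *m LQ v).
  apply: (hd_eq _ _ _ hP); first exact: near_all.
    by apply: filterS nQ => y hy Sy; rewrite mulmxKV//; exact: hy.
  by rewrite mulmxKV.
by have := hd_uniq fS hg' hg => /(congr1 (fun f => f v)).
Qed.

Lemma posdef_inv (B : 'M[R]_n) : posdef B -> posdef (invmx B).
Proof.
move=> pB; have uB := posdef_unit pB; have [sB hB] := pB.
have sI : (invmx B)^T = invmx B by rewrite trmx_inv sB.
split=> // v v0.
have -> : bform (invmx B) v v = bform B (v *m invmx B) (v *m invmx B).
  by rewrite /bform mulmxKV// trmx_mul sI mulmxA.
apply: hB; apply: contra_neq v0 => h.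
by rewrite -[v](mulmxKV uB) h mul0mx.
Qed.

End Quotients.

(** * Positive definiteness along a path *)

Section PositiveDefinite.
Context {R : realType} {n : nat}.
Local Notation E := 'rV[R]_n.

Lemma bform_bound (X : 'M[R]_n) (v : E) :
  `|bform X v v| <= (\sum_k \sum_l `|X k l|) * `|v| ^+ 2.
Proof.
have -> : bform X v v = \sum_k \sum_l v 0 k * X k l * v 0 l.
  rewrite /bform mxE exchange_big /=; apply: eq_bigr => l _.
  by rewrite !mxE mulr_suml.
rewrite (le_trans (ler_norm_sum _ _ _))// mulr_suml ler_sum// => k _.
rewrite (le_trans (ler_norm_sum _ _ _))// mulr_suml ler_sum// => l _.
rewrite !normrM mulrAC mulrC ler_wpM2l// expr2.
by rewrite ler_pM// mx_norm_entry.
Qed.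

Lemma posdef_lower (B : 'M[R]_n) : posdef B ->
  exists2 m : R, 0 < m & forall v : E, m * `|v| ^+ 2 <= bform B v v.
Proof.
move=> [Bs Bp]; pose S := [set v : E | `|v| = 1].
have [[v0 Sv0]|S0] := pselect (exists v, S v); last first.
  exists 1 => // v; have [->|v0] := eqVneq v 0.
    by rewrite normr0 expr0n mulr0 (lin0 (bform_linl _ _)).
  exfalso; apply: S0; exists (`|v|^-1 *: v); rewrite /S /= normrZ gtr0_norm ?invr_gt0 ?normr_gt0//.
  by rewrite mulVf// normr_eq0.
have cS : compact S.
  apply: bounded_closed_compact.
    exists 1; split; first exact: num_real.
    by move=> x x1 v /= ->; exact: ltW.
  have -> : S = (fun v : E => `|v|) @^-1` [set 1] by [].
  by apply: (@preimage_closed _ _ (fun v : E => `|v|)) => [v _|]; [exact: norm_continuous|exact: closed_eq].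
have [c /set_mem Sc hc] : exists2 c, c \in S & forall v, v \in S -> bform B c c <= bform B v v.
  apply: (@EVT_min_rV R n (fun v => bform B v v) S) => //; first by exists v0.
  apply/subspace_continuousP => v _.
  exact: (hd_cts (hd_bform (hd_cst S B v) (hd_id S v) (hd_id S v))).
have c0 : c != 0 by apply/negP => /eqP c0; move: Sc; rewrite /S /= c0 normr0 => /esym/eqP; rewrite oner_eq0.
exists (bform B c c); first exact: Bp.
move=> v; have [->|v0'] := eqVneq v 0.
  by rewrite normr0 expr0n mulr0 (lin0 (bform_linl _ _)).
have nv : 0 < `|v| by rewrite normr_gt0.
have Sv : (`|v|^-1 *: v) \in S.
  by apply/mem_set; rewrite /S /= normrZ gtr0_norm ?invr_gt0// mulVf// gt_eqF.
have := hc _ Sv; rewrite bformZl bformZr mulrA -expr2 exprVn.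
by rewrite mulrC ler_pdivlMr// exprn_gt0.
Qed.

Lemma posdef_near (B B' : 'M[R]_n) (m : R) : B'^T = B' ->
  (forall v : E, m * `|v| ^+ 2 <= bform B v v) ->
  \sum_k \sum_l `|(B' - B) k l| < m -> posdef B'.
Proof.
move=> Bs hm hB; split=> // v v0.
have nv : 0 < `|v| ^+ 2 by rewrite exprn_gt0// normr_gt0.
have := bform_bound (B' - B) v; rewrite (linB (bform_linB v v)) => h.
have h2 := hm v; have h3 : (\sum_k \sum_l `|(B' - B) k l|) * `|v| ^+ 2 < m * `|v| ^+ 2.
  by rewrite ltr_pM2r.
have := ler_norm (- (bform B' v v - bform B v v)); rewrite normrN; lra.
Qed.

(** By Cauchy-Schwarz an isotropic vector of a positive semidefinite form lies in
    its kernel. *)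
Lemma psd_unit_posdef (B : 'M[R]_n) : B^T = B -> B \in unitmx ->
  (forall v : E, 0 <= bform B v v) -> posdef B.
Proof.
move=> Bs uB B0; split=> // v v0; rewrite lt_neqAle B0 andbT eq_sym.
apply/negP => /eqP vv; move/negP: v0; apply; apply/eqP.
suff vB : v *m B = 0 by rewrite -[v](mulmxK uB) vB mul0mx.
apply: rV_inj => w; rewrite mul0mx [RHS]mxE -/(bform B v w).
apply/eqP/negP => /negP bw.
have q k : 0 <= 2 * k * bform B v w + k ^+ 2 * bform B w w.
  have := B0 (v + k *: w); rewrite bformDl (linD (bform_linr _ _)) (linD (bform_linr _ _)).
  by rewrite !bformZl !bformZr vv (bform_sym w v Bs); congr (_ <= _); ring.
have [w0|w0] := eqVneq (bform B w w) 0.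
  have := q (- bform B v w); rewrite w0 mulr0 addr0; move: bw; rewrite -sqrf_eq0.
  have := sqr_ge0 (bform B v w); rewrite expr2 => h1 h2 h3.
  by move/negP: h2; apply; apply/eqP; lra.
have wp : 0 < bform B w w by rewrite lt_neqAle eq_sym w0 B0.
have := q (- bform B v w / bform B w w).
have -> : 2 * (- bform B v w / bform B w w) * bform B v w +
   (- bform B v w / bform B w w) ^+ 2 * bform B w w = - (bform B v w ^+ 2 / bform B w w).
  by field.
rewrite oppr_ge0 leNgt divr_gt0// lt_neqAle sqr_ge0 eq_sym sqrf_eq0 bw//.
Qed.

(** On the segment from the identity to [B] all matrices are positive definite,
    so that the determinant does not vanish there. *)
Lemma posdef_det_gt0 (B : 'M[R]_n) : posdef B -> 0 < \det B.
Proof.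
move=> Bp; have [Bs B0] := Bp.
pose N (t : R) : 'M[R]_n := (1 - t)%:M + t *: B.
have Np t : 0 <= t <= 1 -> \det (N t) != 0.
  move=> /andP[t0 t1]; rewrite -unitfE -unitmxE; apply: posdef_unit; split.
    by rewrite /N linearD linearZ /= tr_scalar_mx Bs.
  move=> v v0; rewrite /N (linD (bform_linB v v)) (linZ (bform_linB v v)).
  have vv : 0 < (v *m v^T) 0 0.
    apply: lt_le_trans (_ : `|v| ^+ 2 <= _); first by rewrite exprn_gt0// normr_gt0.
    apply: le_trans (sqnorm_ge v) _; rewrite le_eqVlt; apply/orP; left; apply/eqP.
    by rewrite mxE; apply: eq_bigr => k _; rewrite mxE expr2.
  have -> : bform (1 - t)%:M v v = (1 - t) * (v *m v^T) 0 0.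
    by rewrite /bform mul_mx_scalar -scalemxAl mxE.
  have h1 : 0 <= 1 - t by rewrite subr_ge0.
  have h2 := B0 v v0; rewrite /GRing.scale /=.
  have [->|t0'] := eqVneq t 0; first by rewrite subr0 mul1r mul0r addr0.
  have tp : 0 < t by rewrite lt_neqAle eq_sym t0'.
  by rewrite ltr_wpDl// ?mulr_gt0// mulr_ge0// ltW.
have cN : {within `[(0:R), 1], continuous (fun t => \det (N t))}.
  apply/subspace_continuousP => t _.
  have [L hL] : differentiable_on `[(0:R), 1] (fun t => \det (N t)) t.
    apply: diff_det => k l.
    have lB : linear (fun t : R => t * (B k l - (k == l)%:R)).
      by move=> a p q; rewrite /GRing.scale /=; ring.
    have cB : continuous (fun t : R => t * (B k l - (k == l)%:R)).
      by apply: (@lin_cts _ _ _ _ `|B k l - (k == l)%:R|) => // p; rewrite normrM mulrC.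
    eexists; have := hd_add (hd_cst `[(0:R), 1] ((k == l)%:R : R) t) (hd_clin _ t lB cB).
    apply: hd_eq; first exact: near_all.
      by apply: near_all => s _; rewrite /N !mxE -[(1 - s) *+ _]mulr_natr; ring.
    by rewrite /N !mxE -[(1 - t) *+ _]mulr_natr; ring.
  exact: hd_cts hL.
rewrite ltNge; apply/negP => dB.
have N0 : \det (N 0) = 1 by rewrite /N subr0 scale0r addr0 det1.
have N1 : \det (N 1) = \det B by rewrite /N subrr scale1r raddf0 add0r.
have [t t01 dt] : exists2 t, t \in `[(0:R), 1] & \det (N t) = 0.
  apply: (@IVT R (fun t => \det (N t))) => //.
  by rewrite N0 N1 ge_min le_max ler01 dB orbT.
by have := Np t; rewrite dt eqxx => /(_ _)/negP; apply; move: t01; rewrite in_itv.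
Qed.

(** Connectedness of the segment. *)
Lemma segment_clopen (a b : R) (P : R -> Prop) : a <= b -> P a ->
  (forall s, a <= s <= b -> P s -> \forall r \near s, a <= r <= b -> P r) ->
  (forall s, a <= s <= b -> closure [set r | a <= r <= b /\ P r] s -> P s) ->
  forall s, a <= s <= b -> P s.
Proof.
move=> ab Pa oP cP; pose B := [set r | a <= r <= b /\ P r].
have iE (r : R) : `[a, b]%classic r <-> a <= r <= b by rewrite /= in_itv.
suff : B = `[a, b]%classic.
  by move=> e s sab; have : `[a, b]%classic s by []; rewrite -e => -[].
apply: (@segment_connected R a b).
- by exists a; split=> //; rewrite lexx.
- exists (interior [set r : R | a <= r <= b -> P r]); first exact: open_interior.
  apply/seteqP; split=> s.
    by move=> [sab Ps]; split; [exact/iE|exact: oP].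
  by move=> [/iE sab /interior_subset h]; split=> //; exact: h.
- exists (closure B); first exact: closed_closure.
  apply/seteqP; split=> s.
    by move=> [sab Ps]; split; [exact/iE|apply: subset_closure].
  by move=> [/iE sab h]; split=> //; exact: cP.
Qed.

Lemma sum_cvg0 (F : set_system R) {FF : Filter F} (W : R -> 'M[R]_n) (W0 : 'M[R]_n) :
  (forall k l, (fun s => W s k l) @ F --> W0 k l) ->
  (fun s => \sum_k \sum_l `|(W s - W0) k l|) @ F --> (0 : R).
Proof.
move=> h; have z : \sum_(k < n) \sum_(l < n) (0 : R) = 0.
  by rewrite big1// => k _; rewrite big1.
rewrite -[X in _ --> X]z.
apply: cvg_big => // [|k _]; first exact: add_continuous.
apply: cvg_big => // [|l _]; first exact: add_continuous.
have : (fun s => `|W s k l - W0 k l|) @ F --> `|W0 k l - W0 k l|.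
  by apply: cvg_norm; apply: cvgB; [exact: h|exact: cvg_cst].
rewrite subrr normr0 => h1.
by under eq_fun do rewrite !mxE.
Qed.

(** Positive definite matrices form an open set by [posdef_near], and a limit of
    them is positive semidefinite, hence positive definite when it is
    invertible. *)
Lemma posdef_path (a b : R) (W : R -> 'M[R]_n) : a <= b -> posdef (W a) ->
  (forall s, a <= s <= b -> (W s)^T = W s) ->
  (forall s, a <= s <= b -> W s \in unitmx) ->
  (forall s, a <= s <= b -> forall k l,
     (fun r => W r k l) @ within [set r | a <= r <= b] (nbhs s) --> W s k l) ->
  forall s, a <= s <= b -> posdef (W s).
Proof.
move=> ab Wa Ws Wu Wc; apply: segment_clopen => // s sab.
  move=> /posdef_lower[m m0 hm].
  have h : \forall r \near s, a <= r <= b -> \sum_k \sum_l `|(W r - W s) k l| < m.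
    exact: (cvgr_lt _ (sum_cvg0 (Wc s sab)) _ m0).
  move: h; apply: filterS => r hr rab; apply: (posdef_near (Ws r rab) hm); exact: hr.
move=> cs; apply: psd_unit_posdef; [exact: Ws|exact: Wu|].
move=> v; rewrite leNgt; apply/negP => vv.
have c2 : (fun r => bform (W r) v v) @ within [set r | a <= r <= b] (nbhs s) --> bform (W s) v v.
  have e B : bform B v v = \sum_k \sum_l v 0 k * B k l * v 0 l.
    rewrite /bform mxE exchange_big /=; apply: eq_bigr => l _.
    by rewrite !mxE mulr_suml.
  under eq_fun do rewrite e.
  rewrite e; apply: cvg_big => // [|k _]; first exact: add_continuous.
  apply: cvg_big => // [|l _]; first exact: add_continuous.
  apply: cvgM; last exact: cvg_cst.
  by apply: cvgM; [exact: cvg_cst|exact: Wc].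
have h : \forall r \near s, a <= r <= b -> bform (W r) v v < 0.
  exact: (cvgr_lt _ c2 _ vv).
have [r [[rab [_ Wp]] hr]] := cs _ h.
have vn : v != 0.
  by apply/negP => /eqP v0; move: vv; rewrite v0 (lin0 (bform_linl _ _)) ltxx.
by have := lt_trans (hr rab) (Wp v vn); rewrite ltxx.
Qed.

End PositiveDefinite.

Section WithinFilters.
Context {T T' T'' : topologicalType}.

Lemma cvg_within_eq (A : set T) (f g : T -> T') (x : T) (l : T') :
  (\forall y \near x, A y -> f y = g y) ->
  f @ within A (nbhs x) --> l -> g @ within A (nbhs x) --> l.
Proof.
move=> fg hf V nV; suff : \forall y \near x, A y -> V (g y) by [].
have h := cvg_near_within hf nV.
by move: fg h; apply: filterS2 => y e h Ay; rewrite -e//; exact: h.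
Qed.

Lemma cvg_within_comp (A : set T) (B : set T') (f : T -> T') (g : T' -> T'')
    (x : T) (l : T') (m : T'') :
  (\forall y \near x, A y -> B (f y)) ->
  f @ within A (nbhs x) --> l -> g @ within B (nbhs l) --> m ->
  (fun y => g (f y)) @ within A (nbhs x) --> m.
Proof.
move=> AB hf hg V nV; suff : \forall y \near x, A y -> V (g (f y)) by [].
have h1 := cvg_near_within hg nV.
have h2 : \forall y \near x, A y -> B (f y) -> V (g (f y)).
  by have := cvg_near_within hf h1.
by move: AB h2; apply: filterS2 => y a b Ay; exact: b Ay (a Ay).
Qed.

End WithinFilters.

(** * The cost in charts and the transport map *)

Section CostInCharts.
Context {R : realType} {n : nat} {M Mb : riemannian_manifold R n}.
Context (Om : set M) (Omb : set Mb) (c : M -> Mb -> R) (alpha : R).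
Hypothesis sO : smooth_bounded_domain Om.
Hypothesis sOb : smooth_bounded_domain Omb.
Hypothesis cC : cost_Ckalpha Om Omb c 4 alpha.
Hypothesis bt : bi_twist Om Omb c.
Local Notation E := 'rV[R]_n.
Local Notation A i := (chart_set i (closure Om)).
Local Notation B j := (chart_set j (closure Omb)).

Definition chart_cost i j : E * E -> R :=
  fun z => c (chart_inv i z.1) (chart_inv j z.2).

Local Notation Cx i j := (mixed_x (A i) (B j) (chart_cost i j)).
Local Notation Cy i j := (mixed_y (A i) (B j) (chart_cost i j)).
Local Notation Cxx i j := (mixed_xx (A i) (B j) (chart_cost i j)).
Local Notation Cyx i j := (mixed_yx (A i) (B j) (chart_cost i j)).

Lemma diff_classW {V W : normedModType R} k (S : set V) (f : V -> W) :
  diff_class k.+1 S f -> diff_class k S f.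
Proof.
rewrite /diff_class; elim: k f => [//|k IH] f [h1 h2].
by split; [exact: h1|move=> v; exact: IH (h2 v)].
Qed.

Lemma chart_cost_diff i j : diff_class 3 (A i `*` B j) (chart_cost i j).
Proof. by apply: diff_classW; exact: class_diff (cC i j). Qed.

Lemma src_cone i z : A i z -> cone_at (A i) z.
Proof.
by move=> [x [cx dx] <-]; have [[_ oO _] [_ bO]] := sO; exact: dom_cone_closure.
Qed.

Lemma tgt_cone j z : B j z -> cone_at (B j) z.
Proof.
by move=> [x [cx dx] <-]; have [[_ oO _] [_ bO]] := sOb; exact: dom_cone_closure.
Qed.

Section FirstDerivatives.
Variables (i : chart_index M) (j : chart_index Mb) (x : M) (xb : Mb).
Hypotheses (cx : closure Om x) (dx : chart_dom i x).
Hypotheses (cxb : closure Omb xb) (dxb : chart_dom j xb).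

Let Az : A i (chart i x). Proof. by exists x. Qed.
Let Bz : B j (chart j xb). Proof. by exists xb. Qed.

Lemma DcE : Dc Om c i x xb = Cx i j (chart i x, chart j xb).
Proof.
rewrite /Dc /dform /grad_on /mixed_x; apply/rowP => k; rewrite !mxE.
have -> : (fun y => c (chart_inv i y) xb) = (fun x' => chart_cost i j (x', chart j xb)).
  by apply/funext => y; rewrite /chart_cost /= chartK.
have [h _] := chart_cost_diff i j.
have hz := deriv_onP (h (chart i x, chart j xb) (conj Az Bz)).
by rewrite (deriv_onE (cone_fat (src_cone Az)) (hd_slice1 Bz hz)).
Qed.

Lemma DbcE : Dbc Omb c j x xb = Cy i j (chart i x, chart j xb).
Proof.
rewrite /Dbc /dform /grad_on /mixed_y; apply/rowP => k; rewrite !mxE.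
have -> : (fun y => c x (chart_inv j y)) = (fun y => chart_cost i j (chart i x, y)).
  by apply/funext => y; rewrite /chart_cost /= chartK.
have [h _] := chart_cost_diff i j.
have hz := deriv_onP (h (chart i x, chart j xb) (conj Az Bz)).
by rewrite (deriv_onE (cone_fat (tgt_cone Bz)) (hd_slice2 Az hz)).
Qed.

End FirstDerivatives.

Section SecondDerivatives.
Variables (i : chart_index M) (j : chart_index Mb) (x : M) (xb : Mb).
Hypotheses (cx : closure Om x) (dx : chart_dom i x).
Hypotheses (cxb : closure Omb xb) (dxb : chart_dom j xb).

Let Az : A i (chart i x). Proof. by exists x. Qed.
Let Bz : B j (chart j xb). Proof. by exists xb. Qed.
Let z := (chart i x, chart j xb).
Let Sz : (A i `*` B j) z. Proof. by split. Qed.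

Lemma hd_Dc_tgt : has_deriv_on (B j) (fun yb => Dc Om c i x (chart_inv j yb)) (chart j xb)
  (fun v => v *m Cyx i j z).
Proof.
have := hd_slice2 Az (hd_mixed_x (@src_cone i) (@tgt_cone j) (chart_cost_diff i j) Sz).
under [X in has_deriv_on _ _ _ X -> _]eq_fun do rewrite /= mul0mx add0r.
apply: hd_eq; first exact: near_all.
  by apply: near_all => _ [q [cq dq] <-]; rewrite chartK// (DcE cx dx cq dq).
by rewrite chartK// (DcE cx dx cxb dxb).
Qed.

Lemma hd_Dbc_src : has_deriv_on (A i) (fun y => Dbc Omb c j (chart_inv i y) xb) (chart i x)
  (fun v => v *m (Cyx i j z)^T).
Proof.
have [L [hL LE]] := hd_mixed_y (@src_cone i) (@tgt_cone j) (chart_cost_diff i j) Sz.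
have := hd_slice1 Bz hL.
have -> : (fun v : E => L (v, 0)) = (fun v => v *m (Cyx i j z)^T) by apply/funext => v.
apply: hd_eq; first exact: near_all.
  by apply: near_all => _ [q [cq dq] <-]; rewrite chartK// (DbcE cq dq cxb dxb).
by rewrite chartK// (DbcE cx dx cxb dxb).
Qed.

Lemma DbDcE : DbDc Om Omb c i j x xb = Cyx i j z.
Proof. exact: jac_onE (cone_fat (tgt_cone Bz)) hd_Dc_tgt. Qed.

Lemma DDbcE : DDbc Om Omb c i j x xb = (Cyx i j z)^T.
Proof. exact: jac_onE (cone_fat (src_cone Az)) hd_Dbc_src. Qed.

Lemma hess_costE : hess (closure Om) (fun y => c y xb) i x = Cxx i j z.
Proof.
rewrite /hess /hess_on; apply: jac_onE (cone_fat (src_cone Az)) _.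
have := hd_slice1 Bz (hd_mixed_x (@src_cone i) (@tgt_cone j) (chart_cost_diff i j) Sz).
under [X in has_deriv_on _ _ _ X -> _]eq_fun do rewrite /= mul0mx addr0.
have D q : closure Om q -> chart_dom i q ->
  grad_on (A i) (fun y => c (chart_inv i y) xb) (chart i q) = Cx i j (chart i q, chart j xb).
  by move=> cq dq; rewrite -(DcE cq dq cxb dxb).
apply: hd_eq; first exact: near_all.
  by apply: near_all => _ [q [cq dq] <-]; rewrite D.
by rewrite D.
Qed.

(** The Jacobians of the two maps whose images occur in the identity. They are
    invertible because these maps have differentiable inverses. *)
Lemma tgt_jacE : phi_jac Omb (fun q => - Dc Om c i x q) j (chart j xb) = - Cyx i j z.
Proof.
apply: jac_onE (cone_fat (tgt_cone Bz)) _; have := hd_opp hd_Dc_tgt.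
by have -> : (fun v : E => - (v *m Cyx i j z)) = (fun v => v *m - Cyx i j z)
  by apply/funext => v; rewrite mulmxN.
Qed.

Lemma src_jacE : phi_jac Om (fun q => - Dbc Omb c j q xb) i (chart i x) = - (Cyx i j z)^T.
Proof.
apply: jac_onE (cone_fat (src_cone Az)) _; have := hd_opp hd_Dbc_src.
by have -> : (fun v : E => - (v *m (Cyx i j z)^T)) = (fun v => v *m - (Cyx i j z)^T)
  by apply/funext => v; rewrite mulmxN.
Qed.

Lemma cyx_unit : Cyx i j z \in unitmx.
Proof.
have [G [_ _ h]] := image_inverse sOb (bt.1 i x dx cx).
have [u _] := h j xb cxb dxb; move: u; rewrite tgt_jacE.
by rewrite -scaleN1r unitmxZ// unitrN1.
Qed.

End SecondDerivatives.

Section TransportMap.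
Variables (v : M -> R) (T : M -> Mb).
Hypothesis dv : forall i, diff_class 3 (A i) (fun y => v (chart_inv i y)).
Hypothesis tm : transport_map Om Omb c v T.

Local Notation U i := (fun y => v (chart_inv i y)).

Lemma transportP i x : closure Om x -> chart_dom i x ->
  closure Omb (T x) /\ - Dc Om c i x (T x) = dform (closure Om) v i x.
Proof.
move=> cx dx; have [[q cq qE] ->] := tm dx cx.
by rewrite /Ymap; case: xgetP => [y _ //|/(_ q)]; case.
Qed.

Lemma transport_closure x : closure Om x -> closure Omb (T x).
Proof. by move=> cx; have [i dx] := chart_cover x; have [] := transportP cx dx. Qed.

Lemma tgt_map_inj i x q q' : closure Om x -> chart_dom i x ->
  closure Omb q -> closure Omb q' -> Dc Om c i x q = Dc Om c i x q' -> q = q'.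
Proof.
move=> cx dx cq cq' h; apply: (image_map_inj (bt.1 i x dx cx)) => //.
by rewrite h.
Qed.

(** The set of targets outside a neighbourhood of [T x] is compact and none of its
    points solves [- Dc x q = Dv x]. By continuity none solves the equation at a
    point [y] near [x] either, uniformly over the compact set. *)
Lemma transport_cvg x : closure Om x -> T @ within (closure Om) (nbhs x) --> T x.
Proof.
move=> cx V nV; suff : \forall y \near x, closure Om y -> V (T y) by [].
have [i dx] := chart_cover x; have [cT eT] := transportP cx dx.
pose K := closure Omb `&` ~` (interior V).
have kO : compact (closure Omb) by have [_ []] := sOb.
have kK : compact K.
  apply: (subclosed_compact _ kO); last by move=> q [].
  by apply: closedI; [exact: closed_closure|apply: open_closedC; exact: open_interior].
have dU := hd_cts (hd_grad (diff_classW (dv i)) ((chart_setE (closure Om) dx).2 cx)).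
have main : \forall y \near x, K `<=` (fun q => chart_dom i y -> closure Om y ->
    closure Omb q -> - Dc Om c i y q <> dform (closure Om) v i y).
  move/compact_near_coveringP : kK; apply => q [cq nq].
  have [j dq] := chart_cover q.
  have qT : q <> T x by move=> qT; apply: nq; rewrite qT.
  pose a := Cx i j (chart i x, chart j q); pose b := - grad_on (A i) (U i) (chart i x).
  have ab : 0 < `|a - b| / 2.
    rewrite divr_gt0// normr_gt0 subr_eq0; apply/negP => /eqP ab; apply: qT.
    apply: (tgt_map_inj cx dx cq cT).
    by rewrite (DcE cx dx cq dq) -/a ab /b -[LHS]/(- dform (closure Om) v i x) -eT opprK.
  have Sz : (A i `*` B j) (chart i x, chart j q).
    by split; [exists x|exists q].
  have hc := hd_cts (hd_mixed_x (@src_cone i) (@tgt_cone j) (chart_cost_diff i j) Sz).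
  have nb (p0 : E) : nbhs p0 [set p : E | `|p - p0| < `|a - b| / 2].
    suff : \forall p \near p0, `|p - p0| < `|a - b| / 2 by [].
    by apply/nbhs_normP; exists (`|a - b| / 2) => // p; rewrite /ball_ /= distrC.
  have h1 := cvg_near_within hc (nb a).
  have nbb' : nbhs (grad_on (A i) (U i) (chart i x)) [set p : E | `|p - (- b)| < `|a - b| / 2].
    by have := nb (- b); rewrite {1}/b opprK.
  have h2 := cvg_near_within dU nbb'.
  have {}h2 : \forall y \near x, A i (chart i y) ->
      `|grad_on (A i) (U i) (chart i y) - (- b)| < `|a - b| / 2 := chart_cvg dx h2.
  have [[Q1 Q2] /= [n1 n2] h12] := h1.
  have n1' : \forall y \near x, Q1 (chart i y) := chart_cvg dx n1.
  have n2' : \forall q' \near q, Q2 (chart j q') := chart_cvg dq n2.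
  exists ([set q' | Q2 (chart j q') /\ chart_dom j q'],
          [set y | Q1 (chart i y) /\ (A i (chart i y) ->
      `|grad_on (A i) (U i) (chart i y) - (- b)| < `|a - b| / 2)]).
    split => /=; first by move: n2' (near_dom dq); apply: filterS2.
    by move: n1' h2; apply: filterS2.
  move=> [q' y] /= [[Q2q dq'] [Q1y hy]] dy cy cq' e.
  have Ay : A i (chart i y) by exists y.
  have {}hy := hy Ay.
  have := h12 (chart i y, chart j q') (conj Q1y Q2q) (conj Ay (ex_intro2 _ _ q' (conj cq' dq') erefl)).
  rewrite /= -(DcE cy dy cq' dq') => h3.
  have h4 : `|- Dc Om c i y q' + b| < `|a - b| / 2.
    by rewrite e; move: hy; rewrite opprK; exact.
  have : `|a - b| <= `|Dc Om c i y q' - a| + `|- Dc Om c i y q' + b|.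
    rewrite (le_trans _ (ler_normD _ _))// -normrN opprB addrA.
    by rewrite [Dc _ _ _ _ _ - a]addrC addrK addrC.
  by rewrite leNgt [ltRHS]splitr ltrD.
move: main (near_dom dx); apply: filterS2 => y hy dy cy.
have [cTy eTy] := transportP cy dy.
apply: interior_subset; apply: contrapT => nVy.
exact: (hy (T y) (conj cTy nVy)).
Qed.

Section Derivative.
Variables (i : chart_index M) (j : chart_index Mb) (x : M).
Hypotheses (cx : closure Om x) (dx : chart_dom i x) (dT : chart_dom j (T x)).

Local Notation theta := (fun y => chart j (T (chart_inv i y))).
Let z := (chart i x, chart j (T x)).
Let cT : closure Omb (T x) := transport_closure cx.
Let Az : A i (chart i x). Proof. by exists x. Qed.
Let Bz : B j (chart j (T x)). Proof. by exists (T x). Qed.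
Let Sz : (A i `*` B j) z. Proof. by split. Qed.

(** The Jacobian of [T] read off the differentiated equation
    [Dc x (T x) = - Dv x]. *)
Definition DTmx : 'M[R]_n := - (w_matrix Om c v T i x *m invmx (Cyx i j z)).

Lemma w_matrixE :
  w_matrix Om c v T i x = hess_on (A i) (U i) (chart i x) + Cxx i j z.
Proof. by rewrite /w_matrix (hess_costE cx dx cT dT). Qed.

Lemma w_matrix_sym : (w_matrix Om c v T i x)^T = w_matrix Om c v T i x.
Proof.
rewrite w_matrixE linearD /= hess_on_sym//; last exact: diff_classW (dv i).
  by rewrite mixed_xx_sym//; [exact: src_cone|exact: tgt_cone|exact: chart_cost_diff].
exact: src_cone.
Qed.

Lemma near_transport_dom : \forall y \near chart i x, A i y -> chart_dom j (T (chart_inv i y)).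
Proof.
have h := cvg_near_within (transport_cvg cx) (near_dom dT).
have ix := chart_in_img dx.
have h2 : \forall y \near chart i x, closure Om (chart_inv i y) -> chart_dom j (T (chart_inv i y)).
  by have := chart_inv_cvg ix; rewrite chartK// => /(_ _ h).
by apply: filterS h2 => y hy /chart_setP[_]; exact: hy.
Qed.

Lemma theta_cvg : theta @ within (A i) (nbhs (chart i x)) --> theta (chart i x).
Proof.
move=> V; rewrite /= chartK// => nV.
suff : \forall y \near chart i x, A i y -> V (theta y) by [].
have h1 : \forall q \near T x, V (chart j q) := chart_cvg dT nV.
have h := cvg_near_within (transport_cvg cx) h1.
have ix := chart_in_img dx.
have h2 : \forall y \near chart i x, closure Om (chart_inv i y) -> V (theta y).
  by have := chart_inv_cvg ix; rewrite chartK// => /(_ _ h).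
by apply: filterS h2 => y hy /chart_setP[_]; exact: hy.
Qed.

(** Implicit differentiation of [Dc x (T x) = - Dv x] in charts. *)
Lemma transport_hd : has_deriv_on (A i) theta (chart i x) (fun v => v *m DTmx).
Proof.
have uK : Cyx i j z \in unitmx by exact: (cyx_unit cx dx cT dT).
have [m m0 hm] := unit_lower_bound uK.
have hF := hd_mixed_x (@src_cone i) (@tgt_cone j) (chart_cost_diff i j) Sz.
have hg := hd_opp (hd_grad (diff_classW (dv i)) Az).
have eq y : closure Om y -> chart_dom i y -> chart_dom j (T y) ->
    Cx i j (chart i y, chart j (T y)) = - grad_on (A i) (U i) (chart i y).
  move=> cy dy dTy; have [cTy eTy] := transportP cy dy.
  by rewrite -(DcE cy dy cTy dTy) -[RHS]/(- dform (closure Om) v i y) -eTy opprK.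
have tz : theta (chart i x) = chart j (T x) by rewrite chartK.
have h1 : \forall y \near chart i x, A i y -> B j (theta y).
  apply: filterS near_transport_dom => y hy Ay; have {}hy := hy Ay.
  move/chart_setP: Ay => [_ cy]; exists (T (chart_inv i y)) => //; split=> //.
  exact: transport_closure.
have h2 : \forall y \near chart i x, A i y ->
    Cx i j (y, theta y) = - grad_on (A i) (U i) y.
  apply: filterS near_transport_dom => y hy Ay; have {}hy := hy Ay.
  move/chart_setP: Ay => [iy cy].
  have := eq _ cy (chart_inv_dom iy) hy; rewrite (chart_invK iy); exact.
have h3 : Cx i j (chart i x, theta (chart i x)) = - grad_on (A i) (U i) (chart i x).
  by rewrite tz; exact: eq.
have hF' : has_deriv_on (A i `*` B j) (Cx i j) (chart i x, theta (chart i x))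
    (fun v => v.1 *m Cxx i j z + v.2 *m Cyx i j z) by rewrite tz; exact: hF.
have h4 (u : E) : u *m Cxx i j z + u *m DTmx *m Cyx i j z =
    - (u *m hess_on (A i) (U i) (chart i x)).
  rewrite /DTmx mulmxN mulNmx mulmxA mulmxKV; last exact: uK.
  by rewrite w_matrixE mulmxDr opprD addrC -addrA addNr addr0.
have h5 (w : E) : m * `|w| <= `|0 *m Cxx i j z + w *m Cyx i j z|.
  by rewrite mul0mx add0r; exact: hm.
exact: (hd_implicit h1 h2 h3 theta_cvg hF' hg (mulmx_linear DTmx)
  (@mulmx_continuous _ _ DTmx) h4 m0 h5).
Qed.

Lemma DTE : DT Om T i j x = DTmx.
Proof.
have e : \forall y \near chart i x, chart_set i (closure Om `&` T @^-1` chart_dom j) y <-> A i y.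
  apply: filterS near_transport_dom => y hy; split.
    by move=> /chart_setP[iy [cy _]]; exact/chart_setP.
  by move=> Ay; have := hy Ay; move/chart_setP: Ay => [iy cy] dTy; exact/chart_setP.
rewrite /DT; apply: jac_onE.
  apply: fat_near (cone_fat (src_cone Az)); by apply: filterS e => y [].
move: transport_hd; apply: hd_eq => //; last exact: near_all.
by apply: filterS e => y [].
Qed.

(** The relation [w = - DT DbDc] links the metric to both images: it also says
    that the pullback of the metric of Kim and McCann is [w]. *)
Lemma w_matrix_DT : w_matrix Om c v T i x = - (DT Om T i j x *m DbDc Om Omb c i j x (T x)).
Proof.
rewrite DTE (DbDcE cx dx cT dT) /DTmx mulNmx opprK mulmxKV//.
exact: (cyx_unit cx dx cT dT).
Qed.

Lemma pullback_metricE : pullback_metric Om Omb c T i j x = w_matrix Om c v T i x.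
Proof.
rewrite /pullback_metric /kim_mccann.
rewrite (DbDcE cx dx cT dT) (DDbcE cx dx cT dT) trmxK.
rewrite tr_row_mx trmx1 -scalemxAr mul_row_block !mul1mx !mulmx0 add0r addr0.
rewrite -scalemxAl mul_row_col mulmx1 !mulmxN mulNmx.
have WE := w_matrix_DT; rewrite (DbDcE cx dx cT dT) in WE.
have -> : (Cyx i j z)^T *m (DT Om T i j x)^T = - w_matrix Om c v T i x.
  by rewrite -trmx_mul -w_matrix_sym WE linearN opprK.
rewrite opprK -WE.
have -> : w_matrix Om c v T i x + w_matrix Om c v T i x = 2 *: w_matrix Om c v T i x.
  by rewrite scaler_nat mulr2n.
by rewrite scalerA mulVf ?scale1r// pnatr_eq0.
Qed.

End Derivative.
End TransportMap.

(** * The flow: positivity of the metric [w] up to the boundary *)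

Context (rho : M -> R) (rhos hs : Mb -> R) (tmax : R) (u : R -> M -> R) (T : R -> M -> Mb).
Hypothesis drho : density_on Om rho.
Hypothesis drhos : density_on Omb rhos.
Hypothesis dhs : defining_function Omb hs.
Hypothesis ic : initial_condition Om Omb c alpha hs (u 0) (T 0).
Hypothesis ps : parabolic_solution Om Omb c rho rhos hs tmax u T.
Local Notation e_ k := (delta_mx 0 k : E).
Local Notation I := `[(0 : R), tmax[%classic.

Let oO : open Om. Proof. by have [[]] := sO. Qed.

Lemma Ck_space_slice {V W : normedModType R} k (J : set R) (S : set V) (f : R -> V -> W) t :
  Ck_space k J S f -> J t -> diff_class k S (f t).
Proof.
rewrite /diff_class; elim: k f => [//|k IH] f [_ [h1 h2]] Jt.
by split; [move=> x; exact: h1|move=> v; exact: IH (h2 v) Jt].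
Qed.

Lemma inI s : 0 <= s < tmax -> I s.
Proof. by rewrite /= in_itv. Qed.

Lemma solution_diff s : 0 <= s < tmax ->
  forall i, diff_class 3 (A i) (fun y => u s (chart_inv i y)).
Proof.
move=> hs0 i; have [h _ _ _] := ps; have [h1 _] := h i.
by apply: diff_classW; exact: Ck_space_slice h1 (inI hs0).
Qed.

Lemma solution_transport s : 0 <= s < tmax -> transport_map Om Omb c (u s) (T s).
Proof. by have [_ h _ _] := ps; exact: h. Qed.

Lemma time_slice_cvg {W : topologicalType} (J : set R) (S : set E) (g : R * E -> W) s z :
  J s -> S z -> {within J `*` S, continuous g} ->
  (fun r => g (r, z)) @ within J (nbhs s) --> g (s, z).
Proof.
move=> Js Sz /subspace_continuousP/(_ (s, z) (conj Js Sz)) h.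
apply: (cvg_within_comp (B := J `*` S) (f := fun r : R => (r, z)) (l := (s, z))) h.
  exact: near_all.
exact: hd_cts (hd_pair (hd_id J s) (hd_cst J z s)).
Qed.

Lemma space_slice_cvg {W : topologicalType} (J : set R) (S : set E) (g : R * E -> W) s z :
  J s -> S z -> {within J `*` S, continuous g} ->
  (fun y => g (s, y)) @ within S (nbhs z) --> g (s, z).
Proof.
move=> Js Sz /subspace_continuousP/(_ (s, z) (conj Js Sz)) h.
apply: (cvg_within_comp (B := J `*` S) (f := fun y : E => (s, y)) (l := (s, z))) h.
  exact: near_all.
exact: hd_cts (hd_pair (hd_cst S s z) (hd_id S z)).
Qed.

Lemma hs_le0 q : closure Omb q -> hs q <= 0.
Proof.
have [_ [h1 h2 _]] := dhs => cq; have [/h1/ltW//|nq] := pselect (Omb q).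
by rewrite h2//; exact/domain_boundaryP.
Qed.

Lemma hd_hs j q : closure Omb q -> chart_dom j q ->
  has_deriv_on (B j) (fun y => hs (chart_inv j y)) (chart j q)
    (fun v => (dform (closure Omb) hs j q *m v^T) 0 0).
Proof.
move=> cq dq; have [h1 _] := dhs; have [h2 _] := h1 j.
have hd := deriv_onP (h2 (chart j q) ((chart_setE _ dq).2 cq)).
have -> // : (fun v : E => (dform (closure Omb) hs j q *m v^T) 0 0 : R) =
    deriv_on (B j) (fun y => hs (chart_inv j y)) (chart j q).
by apply/funext => v; rewrite grad_onE//; exact: hd_lin hd.
Qed.

(** The gradient of [hs] has length 1 on the boundary. *)
Lemma dform_hs_neq0 j q : boundary Omb q -> chart_dom j q ->
  dform (closure Omb) hs j q <> 0.
Proof.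
move=> bq dq h; have [_ [_ _ /(_ j q dq bq)]] := dhs.
rewrite h mul0mx => -[] /eqP.
by rewrite (lin0 (bform_linl _ _)) eq_sym oner_eq0.
Qed.

Lemma hd_hs_transport s i j x : 0 <= s < tmax -> closure Om x -> chart_dom i x ->
  chart_dom j (T s x) ->
  has_deriv_on (A i) (fun y => hs (T s (chart_inv i y))) (chart i x)
    (fun v => (dform (closure Omb) hs j (T s x) *m (v *m DT Om (T s) i j x)^T) 0 0).
Proof.
move=> hs0 cx dx dT.
have tm := solution_transport hs0; have du := solution_diff hs0.
have cT := transport_closure tm cx.
rewrite (DTE du tm cx dx dT).
have hT := transport_hd du tm cx dx dT.
have hh : has_deriv_on (B j) (fun y => hs (chart_inv j y))
   (chart j (T s (chart_inv i (chart i x))))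
   (fun v => (dform (closure Omb) hs j (T s x) *m v^T) 0 0).
  by rewrite chartK//; exact: hd_hs.
have nd := near_transport_dom du tm cx dx dT.
have := hd_comp _ hT hh => /(_ _)/=.
have m1 : \forall y \near chart i x, A i y -> B j (chart j (T s (chart_inv i y))).
  apply: filterS nd => y hy Ay; have {}hy := hy Ay; move/chart_setP: Ay => [_ cy].
  by apply/(chart_setE _ hy); exact: transport_closure tm _ cy.
move=> /(_ m1); apply: hd_eq; first exact: near_all.
  by apply: filterS nd => y hy Ay; rewrite /= chartK//; exact: hy.
by rewrite /= chartK// chartK.
Qed.

Lemma DT_unit s i j x : 0 <= s < tmax -> closure Om x -> chart_dom i x ->
  chart_dom j (T s x) -> w_matrix Om c (u s) (T s) i x \in unitmx ->
  DT Om (T s) i j x \in unitmx.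
Proof.
move=> hs0 cx dx dT uW.
have tm := solution_transport hs0; have du := solution_diff hs0.
have cT := transport_closure tm cx.
rewrite (DTE du tm cx dx dT) /DTmx.
rewrite -scaleN1r unitmxZ ?unitrN1// unitmx_mul uW unitmx_inv.
exact: (cyx_unit cx dx cT dT).
Qed.

Lemma det_equation s i j x : 0 < s < tmax -> Om x -> chart_dom i x ->
  chart_dom j (T s x) ->
  0 < \det (w_matrix Om c (u s) (T s) i x) /\
  deriv_on I (fun r => u r x) s 1 = ln (\det (w_matrix Om c (u s) (T s) i x)) -
    ln (rhs_density Om Omb c rho rhos i j x (T s x)).
Proof. by move=> hs0 Ox dx dT; have [_ _ h _] := ps; exact: h. Qed.

(** If an interior point were sent to the boundary, [hs o T] would have an interior
    maximum there and its differential would vanish, but neither [dhs] nor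
    [DT] is degenerate. *)
Lemma transport_interior s x : 0 < s < tmax -> Om x -> Omb (T s x).
Proof.
move=> /andP[s0 st] Ox; have hs0 : 0 <= s < tmax by rewrite ltW.
have hs1 : 0 < s < tmax by rewrite s0.
have cx := subset_closure Ox; have tm := solution_transport hs0.
have [i dx] := chart_cover x; have [j dT] := chart_cover (T s x).
have cT := transport_closure tm cx.
apply: contrapT => nT; have bT : boundary Omb (T s x) by exact/domain_boundaryP.
have [dW _] := det_equation hs1 Ox dx dT.
have uW : w_matrix Om c (u s) (T s) i x \in unitmx by rewrite unitmxE unitfE gt_eqF.
have uD := DT_unit hs0 cx dx dT uW.
have h := hd_opp (hd_hs_transport hs0 cx dx dT).
have nA : nbhs (chart i x) (A i).
  apply/(nbhs_chart _ dx); apply: filterS (open_nbhs_nbhs (conj oO Ox)) => y.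
  exact: subset_closure.
have [_ [_ hb _]] := dhs.
have mn z : A i z -> - hs (T s (chart_inv i (chart i x))) <= - hs (T s (chart_inv i z)).
  move=> /chart_setP[_ cz]; rewrite chartK// (hb _ bT) oppr0 oppr_ge0.
  by apply: hs_le0; exact: transport_closure tm _ cz.
have h0 := fermat_min nA h mn.
apply: (dform_hs_neq0 bT dT); apply: rV_inj => w.
have /eqP := h0 (w *m invmx (DT Om (T s) i j x)).
by rewrite mulmxKV// oppr_eq0 mul0mx => /eqP ->; rewrite mxE.
Qed.

Lemma metric_det_gt0 (N : riemannian_manifold R n) (i : chart_index N) x :
  chart_dom i x -> 0 < \det (metric_at i x).
Proof. by move=> dx; apply: posdef_det_gt0; exact: metric_posdef. Qed.

Lemma cometric_posdef (N : riemannian_manifold R n) (i : chart_index N) x :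
  chart_dom i x -> posdef (cometric_at i x).
Proof. by move=> dx; apply: posdef_inv; exact: metric_posdef. Qed.

Lemma metric_det_cvg (N : riemannian_manifold R n) (i : chart_index N) x :
  chart_dom i x -> (fun z => \det (metric i z)) @ nbhs (chart i x) --> \det (metric_at i x).
Proof.
move=> dx; have [h _] := @metric_smooth _ _ N i 1%N.
have ix := chart_in_img dx; have [L hL] := h _ ix.
have hT := hd_open (@chart_img_open _ _ N i) ix hL.
have [D hD] : differentiable_on setT (fun z => \det (metric i z)) (chart i x).
  by apply: diff_det => k l; eexists; exact: hd_entry hT.
exact: hd_ctsT hD.
Qed.

(** For the second derivatives of the cost, which enter [w] and the equation of
    [beta] along the graph of [T]. *)
Lemma hd_on_graph {W : normedModType R} s i j x (F : E * E -> W) L :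
  0 <= s < tmax -> closure Om x -> chart_dom i x -> chart_dom j (T s x) ->
  has_deriv_on (A i `*` B j) F (chart i x, chart j (T s x)) L ->
  has_deriv_on (A i) (fun z => F (z, chart j (T s (chart_inv i z)))) (chart i x)
    (fun v => L (v, v *m DT Om (T s) i j x)).
Proof.
move=> hs0 cx dx dT hF.
have tm := solution_transport hs0; have du := solution_diff hs0.
have hT := transport_hd du tm cx dx dT.
rewrite -(DTE du tm cx dx dT) in hT.
have nd := near_transport_dom du tm cx dx dT.
have m1 : \forall y \near chart i x, A i y -> (A i `*` B j) (y, chart j (T s (chart_inv i y))).
  apply: filterS nd => y hy Ay; have {}hy := hy Ay; split=> //=; move/chart_setP: Ay => [_ cy].
  by apply/(chart_setE _ hy); exact: transport_closure tm _ cy.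
have hF' : has_deriv_on (A i `*` B j) F
   (chart i x, chart j (T s (chart_inv i (chart i x)))) L by rewrite chartK.
exact: hd_comp m1 (hd_pair (hd_id (A i) (chart i x)) hT) hF'.
Qed.

(** In [dw], the Hessian of the potential contributes [LH], and the cost
    contributes [LC] in the direction in which the graph of [T] moves. *)
Lemma hd_w_matrix s i j x : 0 <= s < tmax -> closure Om x -> chart_dom i x ->
  chart_dom j (T s x) -> exists LH LC,
  [/\ has_deriv_on (A i) (hess_on (A i) (fun y => u s (chart_inv i y))) (chart i x) LH,
      has_deriv_on (A i `*` B j) (Cxx i j) (chart i x, chart j (T s x)) LC &
      has_deriv_on (A i) (fun z => w_matrix Om c (u s) (T s) i (chart_inv i z)) (chart i x)
        (fun v => LH v + LC (v, v *m DT Om (T s) i j x))].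
Proof.
move=> hs0 cx dx dT.
have tm := solution_transport hs0; have du := solution_diff hs0.
have cT := transport_closure tm cx.
have Ax : A i (chart i x) by exists x.
have Sx : (A i `*` B j) (chart i x, chart j (T s x)) by split=> //; exists (T s x).
have [LH [hH _]] := hd_hess (@src_cone i) (du i) Ax.
have [LC [hC _]] := hd_mixed_xx (@src_cone i) (@tgt_cone j)
  (chart_cost_diff i j) Sx.
exists LH, LC; split=> //.
have nd := near_transport_dom du tm cx dx dT.
have hc := hd_on_graph hs0 cx dx dT hC.
have := hd_add hH hc; apply: hd_eq; first exact: near_all.
  apply: filterS nd => y hy Ay; have {}hy := hy Ay; move/chart_setP: Ay => [iy cy].
  by rewrite (w_matrixE tm cy (chart_inv_dom iy) hy) chart_invK.
by rewrite /= !(chartK dx) (w_matrixE tm cx dx dT).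
Qed.

Lemma det_cyx_gt0 s i j x : 0 <= s < tmax -> closure Om x -> chart_dom i x ->
  chart_dom j (T s x) -> 0 < `|\det (Cyx i j (chart i x, chart j (T s x)))|.
Proof.
move=> hs0 cx dx dT; have tm := solution_transport hs0.
have cT := transport_closure tm cx.
have := cyx_unit cx dx cT dT.
by rewrite unitmxE unitfE normr_gt0.
Qed.

(** The parabolic equation solved for [det w]. The densities are bounded but
    need not be continuous, whence constants in place of [rho] and [rhos]: the
    other factors are continuous and positive up to the boundary. *)
Lemma det_lower_bound s i j x m1 m2 : 0 < s < tmax -> Om x -> chart_dom i x ->
  chart_dom j (T s x) -> 0 < m1 -> 0 < m2 -> m1 <= rho x -> 0 < rhos (T s x) <= m2 ->
  expR (deriv_on I (fun r => u r x) s 1) *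
    (`|\det (Cyx i j (chart i x, chart j (T s x)))| *
     ((m1 * Num.sqrt (\det (metric_at i x))) /
      (m2 * Num.sqrt (\det (metric_at j (T s x)))))) <=
  \det (w_matrix Om c (u s) (T s) i x).
Proof.
move=> hs1 Ox dx dT m10 m20 r1 /andP[r0 r2].
have hs0 : 0 <= s < tmax by case/andP: hs1 => /ltW -> ->.
have cx := subset_closure Ox; have tm := solution_transport hs0.
have cT := transport_closure tm cx.
have K0 := det_cyx_gt0 hs0 cx dx dT.
have [W0 ->] := det_equation hs1 Ox dx dT.
have g1 : 0 < Num.sqrt (\det (metric_at i x)) by rewrite sqrtr_gt0 metric_det_gt0.
have g2 : 0 < Num.sqrt (\det (metric_at j (T s x))) by rewrite sqrtr_gt0 metric_det_gt0.
have rx : 0 < rho x by exact: lt_le_trans r1.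
have rh0 : 0 < rhs_density Om Omb c rho rhos i j x (T s x).
  rewrite /rhs_density (DDbcE cx dx cT dT) det_tr mulr_gt0// divr_gt0 ?mulr_gt0//.
rewrite expRD expRN !lnK ?posrE// -mulrA ler_piMr ?(ltW W0)//.
rewrite ler_pdivrMl// mulr1 /rhs_density (DDbcE cx dx cT dT) det_tr.
rewrite ler_pM2l//; apply: ler_pM.
- by rewrite ltW// mulr_gt0.
- by rewrite ltW// invr_gt0 mulr_gt0.
- by rewrite ler_pM2r.
- by rewrite lef_pV2 ?posrE ?mulr_gt0// ler_pM2r.
Qed.

Lemma time_derivative_cvg s i z : 0 <= s < tmax -> A i z ->
  (fun y => deriv_on I (fun r => u r (chart_inv i y)) s 1) @ within (A i) (nbhs z) -->
  deriv_on I (fun r => u r (chart_inv i z)) s 1.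
Proof.
move=> hs0 Az; have [h _ _ _] := ps; have [_ [_ [_ [h1 _]]]] := h i.
exact: (space_slice_cvg (inI hs0) Az h1).
Qed.

(** Inside, the equation gives the sign; the bound of [det_lower_bound] passes to
    the limit at the boundary. *)
Lemma det_w_matrix_gt0 s i x : 0 < s < tmax -> closure Om x -> chart_dom i x ->
  0 < \det (w_matrix Om c (u s) (T s) i x).
Proof.
move=> hs1 cx dx; have hs0 : 0 <= s < tmax by case/andP: hs1 => /ltW -> ->.
have tm := solution_transport hs0; have du := solution_diff hs0.
have cT := transport_closure tm cx.
have [j dT] := chart_cover (T s x).
have [_ [m1 [m1' [m10 rho1]]]] := drho.
have [_ [m2' [m2 [m20 rho2]]]] := drhos.
have Ox0 : exists y, Om y by have [[[y Oy] _ _] _] := sO; exists y.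
have m2p : 0 < m2.
  have [[[q Oq] _ _] _] := sOb; have /andP[h1 h2] := rho2 _ Oq.
  exact: lt_le_trans m20 (le_trans h1 h2).
have Ax : A i (chart i x) by exists x.
pose th z := chart j (T s (chart_inv i z)).
pose low z := expR (deriv_on I (fun r => u r (chart_inv i z)) s 1) *
    (`|\det (Cyx i j (z, th z))| *
     ((m1 * Num.sqrt (\det (metric i z))) /
      (m2 * Num.sqrt (\det (metric j (th z)))))).
pose W z := w_matrix Om c (u s) (T s) i (chart_inv i z).
have K0 := det_cyx_gt0 hs0 cx dx dT.
have g1 : 0 < Num.sqrt (\det (metric_at i x)) by rewrite sqrtr_gt0 metric_det_gt0.
have g2 : 0 < Num.sqrt (\det (metric_at j (T s x))) by rewrite sqrtr_gt0 metric_det_gt0.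
have thx : th (chart i x) = chart j (T s x) by rewrite /th chartK.
have lowp : 0 < low (chart i x).
  by rewrite /low thx mulr_gt0 ?expR_gt0// mulr_gt0// divr_gt0// mulr_gt0.
have cW : (fun z => \det (W z)) @ within (A i) (nbhs (chart i x)) --> \det (W (chart i x)).
  have [LH [LC [_ _ hW]]] := hd_w_matrix hs0 cx dx dT.
  have [D hD] : differentiable_on (A i) (fun z => \det (W z)) (chart i x).
    by apply: diff_det => k l; eexists; exact: hd_entry hW.
  exact: hd_cts hD.
have cK : (fun z => \det (Cyx i j (z, th z))) @ within (A i) (nbhs (chart i x)) -->
    \det (Cyx i j (chart i x, th (chart i x))).
  have [LK [hK _]] := hd_mixed_yx (@src_cone i) (@tgt_cone j)
    (chart_cost_diff i j) (conj Ax (ex_intro2 _ _ (T s x) (conj cT dT) erefl) :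
      (A i `*` B j) (chart i x, chart j (T s x))).
  have hK' := hd_on_graph hs0 cx dx dT hK.
  have [D hD] : differentiable_on (A i) (fun z => \det (Cyx i j (z, th z))) (chart i x).
    by apply: diff_det => k l; eexists; exact: hd_entry hK'.
  exact: hd_cts hD.
have cg : (fun z => \det (metric i z)) @ within (A i) (nbhs (chart i x)) --> \det (metric_at i x).
  exact: cvg_within_filter (metric_det_cvg dx).
have cth : th @ within (A i) (nbhs (chart i x)) --> chart j (T s x).
  by rewrite -thx; exact: (theta_cvg du tm cx dx dT).
have cgb : (fun z => \det (metric j (th z))) @ within (A i) (nbhs (chart i x)) -->
    \det (metric_at j (T s x)).
  exact: (cvg_comp th (fun z => \det (metric j z)) cth (metric_det_cvg dT)).
have clow : low @ within (A i) (nbhs (chart i x)) --> low (chart i x).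
  apply: cvgM.
    by apply: continuous_cvg (time_derivative_cvg hs0 Ax); exact: continuous_expR.
  apply: cvgM; first exact: cvg_norm cK.
  apply: cvgM; first apply: cvgMr.
    by apply: continuous_cvg cg; exact: sqrt_continuous.
  rewrite thx; apply: cvgV; first by rewrite gt_eqF// mulr_gt0.
  by apply: cvgMr; apply: continuous_cvg cgb; exact: sqrt_continuous.
have -> : w_matrix Om c (u s) (T s) i x = W (chart i x) by rewrite /W chartK.
apply: lt_le_trans lowp _; rewrite leNgt; apply/negP => lt.
have lt0 : 0 < low (chart i x) - \det (W (chart i x)) by rewrite subr_gt0.
have cd : (fun z => low z - \det (W z)) @ within (A i) (nbhs (chart i x)) -->
    low (chart i x) - \det (W (chart i x)) by exact: cvgB clow cW.
have nlt : \forall z \near chart i x, A i z -> 0 < low z - \det (W z).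
  exact: (cvgr_gt _ cd _ lt0).
have cx' := (chart_set_closure Om dx).2 cx.
have nd := near_transport_dom du tm cx dx dT.
have nn : \forall z \near chart i x, A i z -> 0 < low z - \det (W z) /\ chart_dom j (T s (chart_inv i z)).
  by move: nlt nd; apply: filterS2 => z h1 h2 Az; split; [exact: h1|exact: h2].
have [z [Sz hz]] := cx' _ nn; move/chart_setP: Sz => [iz Oz].
have Az : A i z by apply/chart_setP; split=> //; exact: subset_closure.
have [{}lt dTz] := hz Az; move: lt; apply/negP; rewrite -leNgt subr_le0.
have OT := transport_interior hs1 Oz.
have /andP[r1 _] := rho1 _ Oz; have /andP[r2 r3] := rho2 _ OT.
have := det_lower_bound hs1 Oz (chart_inv_dom iz) dTz m10 m2p r1.
rewrite (lt_le_trans m20 r2) r3 => /(_ isT).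
by rewrite /metric_at !chart_invK.
Qed.

Lemma deriv_time_cvg s i z v : 0 <= s < tmax -> A i z ->
  (fun r => deriv_on (A i) (fun y => u r (chart_inv i y)) z v) @ within I (nbhs s) -->
  deriv_on (A i) (fun y => u s (chart_inv i y)) z v.
Proof.
move=> hs0 Az; have [h _ _ _] := ps; have [[_ [_ /(_ v) [h1 _]]] _] := h i.
exact: (time_slice_cvg (inI hs0) Az h1).
Qed.

Lemma deriv2_time_cvg s i z v w : 0 <= s < tmax -> A i z ->
  (fun r => deriv_on (A i) (fun y => deriv_on (A i) (fun y => u r (chart_inv i y)) y v) z w)
     @ within I (nbhs s) -->
  deriv_on (A i) (fun y => deriv_on (A i) (fun y => u s (chart_inv i y)) y v) z w.
Proof.
move=> hs0 Az; have [h _ _ _] := ps.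
have [[_ [_ /(_ v) [_ [_ /(_ w) [h1 _]]]]] _] := h i.
exact: (time_slice_cvg (inI hs0) Az h1).
Qed.

(** [T r x] is the image of [Du r x], which is continuous in time, under the
    continuous inverse of [q |-> - Dc x q]. *)
Lemma transport_time_cvg s x : 0 <= s < tmax -> closure Om x ->
  (fun r => T r x) @ within I (nbhs s) --> T s x.
Proof.
move=> hs0 cx; have [i dx] := chart_cover x.
have Ax : A i (chart i x) by exists x.
have tm := solution_transport hs0; have cT := transport_closure tm cx.
have [G [GK Gc _]] := image_inverse sOb (bt.1 i x dx cx).
have cd : (fun r => dform (closure Om) (u r) i x) @ within I (nbhs s) -->
    dform (closure Om) (u s) i x.
  rewrite [X in _ --> X]row_sum_delta.
  have -> : (fun r => dform (closure Om) (u r) i x) =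
      (fun r => \sum_k dform (closure Om) (u r) i x 0 k *: e_ k).
    by apply/funext => r; exact: row_sum_delta.
  apply: cvg_big => // [|k _]; first exact: add_continuous.
  apply: cvgZr_tmp; rewrite /dform /grad_on.
  rewrite mxE; under eq_fun do rewrite mxE.
  exact: deriv_time_cvg.
have e r : I r -> - Dc Om c i x (T r x) = dform (closure Om) (u r) i x.
  move=> Ir; have hr : 0 <= r < tmax by move: Ir; rewrite /= in_itv.
  by have [] := transportP (solution_transport hr) cx dx.
have := Gc _ cT; rewrite (e s (inI hs0)) => hG.
apply: (cvg_within_eq _ (cvg_within_comp _ cd hG)); apply: near_all => r Ir.
  have hr : 0 <= r < tmax by move: Ir; rewrite /= in_itv.
  by rewrite -(e _ Ir) GK//; exact: (transport_closure (solution_transport hr) cx).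
have hr : 0 <= r < tmax by move: Ir; rewrite /= in_itv.
exists (T r x); last exact: e.
exact: (transport_closure (solution_transport hr) cx).
Qed.

Lemma w_time_cvg s i x k l : 0 <= s < tmax -> closure Om x -> chart_dom i x ->
  (fun r => w_matrix Om c (u r) (T r) i x k l) @ within I (nbhs s) -->
  w_matrix Om c (u s) (T s) i x k l.
Proof.
move=> hs0 cx dx; have Ax : A i (chart i x) by exists x.
have tm := solution_transport hs0; have du := solution_diff hs0.
have cT := transport_closure tm cx; have [j dT] := chart_cover (T s x).
have cTt := transport_time_cvg hs0 cx.
have Bq : B j (chart j (T s x)) by exists (T s x).
have nd := cvg_near_within cTt (near_dom dT).
pose g r := deriv_on (A i) (fun y => deriv_on (A i) (fun y => u r (chart_inv i y)) y (e_ l))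
  (chart i x) (e_ k) + Cxx i j (chart i x, chart j (T r x)) k l.
have gE r : 0 <= r < tmax -> chart_dom j (T r x) -> g r = w_matrix Om c (u r) (T r) i x k l.
  move=> hr dr; have dur := solution_diff hr.
  rewrite (w_matrixE (solution_transport hr) cx dx dr) mxE -bform_delta.
  by rewrite hess_onE//; [exact: src_cone|exact: diff_classW (dur i)].
suff gc : g @ within I (nbhs s) --> g s.
  have {}gc := eq_rect (g s) (fun m : R => g @ within I (nbhs s) --> m) gc _ (gE s hs0 dT).
  apply: (@cvg_within_eq R R I g (fun r => w_matrix Om c (u r) (T r) i x k l) s _ _ gc).
  by apply: filterS nd => r h Ir; apply: gE; [move: Ir; rewrite /= in_itv|exact: h].
apply: cvgD; first exact: deriv2_time_cvg.
have [LC [hC _]] := hd_mixed_xx (@src_cone i) (@tgt_cone j)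
  (chart_cost_diff i j) (conj Ax Bq : (A i `*` B j) (chart i x, chart j (T s x))).
have hc := hd_cts (hd_entry k l (hd_slice2 Ax hC)).
apply: (cvg_within_comp (B := B j) (f := fun r => chart j (T r x)) _ _ hc).
  apply: filterS nd => r h Ir; have hr : 0 <= r < tmax by move: Ir; rewrite /= in_itv.
  by exists (T r x) => //; split; [exact: (transport_closure (solution_transport hr) cx)|exact: h].
by apply: cvg_comp cTt _; exact: chart_cvg.
Qed.

(** The matrix is positive definite at time 0, and on the interval from 0 to [s]
    it is symmetric, continuous in time and invertible: [posdef_path] applies. At
    boundary points this is what makes [w] a metric. *)
Lemma w_posdef s i x : 0 <= s < tmax -> closure Om x -> chart_dom i x ->
  posdef (w_matrix Om c (u s) (T s) i x).
Proof.
move=> /andP[s0 st] cx dx; have [_ _ ip _ _] := ic.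
have rI r : 0 <= r <= s -> 0 <= r < tmax.
  by move=> /andP[-> h]; exact: le_lt_trans h st.
apply: (posdef_path (W := fun r => w_matrix Om c (u r) (T r) i x) s0) => //.
- exact: ip.
- move=> r /rI hr; have [j dT] := chart_cover (T r x).
  have tm := solution_transport hr; have du := solution_diff hr.
  exact: (w_matrix_sym du tm cx dx dT).
- move=> r hr; case: (eqVneq r 0) => [->|r0]; first exact: posdef_unit (ip i x dx cx).
  rewrite unitmxE unitfE gt_eqF// det_w_matrix_gt0//.
  by have /andP[a b] := rI r hr; rewrite lt0r r0 a.
- move=> r hr k l; have h := w_time_cvg (k := k) (l := l) (rI r hr) cx dx.
  move=> V nV; have {}h := cvg_near_within h nV.
  suff : \forall y \near r, 0 <= y <= s -> V (w_matrix Om c (u y) (T y) i x k l) by [].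
  by apply: filterS h => y hy ys; apply: hy; rewrite /= in_itv /=; exact: rI.
- by rewrite s0 lexx.
Qed.

(** * The three second fundamental forms at a boundary point *)

Section AtATime.
Variable t : R.
Hypothesis ht : 0 <= t < tmax.
Local Notation W i x := (w_matrix Om c (u t) (T t) i x).
Local Notation D i j x := (DT Om (T t) i j x).
Local Notation dh j y := (dform (closure Omb) hs j y).
Local Notation bet i x := (beta Om Omb c hs (u t) i x).

Let tm : transport_map Om Omb c (u t) (T t) := solution_transport ht.
Let du := solution_diff ht.

(** The inverse of the Jacobian of [q |-> - Dc x q] enters the differential of
    [hs (Y x p)]; it is moved to the other side. *)
Lemma beta_eq i j x : closure Om x -> chart_dom i x -> chart_dom j (T t x) ->
  bet i x *m (Cyx i j (chart i x, chart j (T t x)))^T = - dh j (T t x).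
Proof.
move=> cx dx dT; have cT := transport_closure tm cx.
have [_ pE] := transportP tm cx dx.
set K := Cyx i j _; have uK : K \in unitmx := cyx_unit cx dx cT dT.
have dPhi := bt.1 i x dx cx.
have [G [GK Gc Gd]] := image_inverse sOb dPhi.
have [uN hG] := Gd j _ cT dT.
rewrite (tgt_jacE cx dx cT dT) -/K in uN hG.
set S := image_tgt Om c (closure Omb) i x.
have YG q : closure Omb q -> Ymap Om Omb c i x (- Dc Om c i x q) = q.
  move=> cq; rewrite /Ymap; case: xgetP => [y _ [cy e]|/(_ q)[]//].
  exact: (image_map_inj dPhi cy cq e).
have nG : \forall p \near - Dc Om c i x (T t x), S p -> chart_dom j (G p).
  exact: (cvg_near_within (Gc _ cT) (near_dom dT)).
have hh : has_deriv_on (B j) (fun y => hs (chart_inv j y)) (chart j (G (- Dc Om c i x (T t x))))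
    (fun v => (dh j (T t x) *m v^T) 0 0).
  by rewrite GK//; exact: hd_hs.
have m1 : \forall p \near - Dc Om c i x (T t x), S p -> B j (chart j (G p)).
  apply: filterS nG => p hp Sp; have dG := hp Sp; apply/(chart_setE _ dG).
  by move: Sp => [q cq <-]; rewrite GK.
have hf : has_deriv_on S (fun p => hs (Ymap Om Omb c i x p)) (- Dc Om c i x (T t x))
    (fun v => (dh j (T t x) *m (v *m invmx (- K))^T) 0 0).
  apply: (hd_eq _ _ _ (hd_comp m1 hG hh)); first exact: near_all.
    apply: filterS nG => p hp Sp; have dG := hp Sp.
    by rewrite /= chartK//; move: Sp => [q cq <-]; rewrite YG// GK.
  by rewrite /= chartK ?GK// YG.
have fS : fat S (- Dc Om c i x (T t x)).
  have := image_fat sOb dPhi cT dT; rewrite image_closure//.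
have e := deriv_onE fS hf.
apply: rV_inj => w; rewrite -mulmxA -trmx_mul.
have -> : bet i x = grad_on S (fun p => hs (Ymap Om Omb c i x p)) (- Dc Om c i x (T t x)).
  by rewrite pE.
rewrite grad_onE e; last exact: hd_lin hf.
have -> : w *m K *m invmx (- K) = - w.
  by rewrite -[w *m K]opprK -mulmxN mulNmx mulmxK.
by rewrite linearN /= mulmxN mulNmx.
Qed.

(** By [beta_eq] and [w = - DT DbDc], the field [beta] is the gradient of
    [hs o T] for the metric [w], hence normal to the boundary. *)
Lemma beta_dual i j x v : closure Om x -> chart_dom i x -> chart_dom j (T t x) ->
  bform (W i x) (bet i x) v = (dh j (T t x) *m (v *m D i j x)^T) 0 0.
Proof.
move=> cx dx dT; have cT := transport_closure tm cx.
rewrite /bform -(w_matrix_sym du tm cx dx dT).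
rewrite (w_matrix_DT du tm cx dx dT).
rewrite (DbDcE cx dx cT dT).
rewrite linearN /= trmx_mul mulmxN !mulNmx !mulmxA (beta_eq cx dx dT).
by rewrite mulNmx mulNmx opprK trmx_mul mulmxA.
Qed.

Lemma transport_boundary x : boundary Om x -> boundary Omb (T t x).
Proof.
move=> bx; have cx : closure Om x by case: bx.
apply/domain_boundaryP => //; split; first exact: (transport_closure tm cx).
move=> OT; have [_ [h1 _ _]] := dhs; have [_ _ _ h2] := ps.
by have := h1 _ OT; rewrite (h2 t x ht bx) ltxx.
Qed.

Lemma w_unit i x : closure Om x -> chart_dom i x -> W i x \in unitmx.
Proof.
by move=> cx dx; apply: posdef_unit; exact: (w_posdef ht cx dx).
Qed.

Lemma chart_transport_boundary i j x z : chart_dom i x -> chart_dom j (T t (chart_inv i z)) ->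
  boundary Om (chart_inv i z) -> boundary (chart_set j Omb) (chart j (T t (chart_inv i z))).
Proof.
by move=> dx dT bz; apply/(chart_set_boundary _ dT); exact: transport_boundary.
Qed.

Lemma source_conormal i j x : boundary Om x -> chart_dom i x -> chart_dom j (T t x) ->
  conormal (chart_set i Om) (chart i x)
    (fun v => (dh j (T t x) *m (v *m D i j x)^T) 0 0).
Proof.
move=> bx dx dT; have cx : closure Om x by case: bx.
have [_ [_ bO]] := sO; have [r [U [ld Ux _]]] := chart_local_defining bO bx dx.
have uD : D i j x \in unitmx.
  exact: (DT_unit ht cx dx dT (w_unit cx dx)).
have nc := near_closure Om dx.
apply: (defining_conormal (f := fun y => hs (T t (chart_inv i y))) ld Ux).
- exact/(chart_set_boundary _ dx).
- apply: (hd_eq _ _ _ (hd_hs_transport ht cx dx dT)) => //.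
    by apply: filterS nc => y hy cy; exact/hy.
  exact: near_all.
- apply: filterS nc => y hy /hy /chart_setP[_ cy].
  by apply: (hs_le0); exact: (transport_closure tm cy).
- apply: filterS (near_boundary Om dx) => y hy /hy[_ _ bz].
  by have [_ _ _ h] := ps; exact: h.
- have [v hv] := pairing_neq0 (dform_hs_neq0 (transport_boundary bx) dT).
  by exists (v *m invmx (D i j x)); rewrite mulmxKV.
Qed.

Lemma target_conormal j y : boundary Omb y -> chart_dom j y ->
  conormal (chart_set j Omb) (chart j y) (fun v => (dh j y *m v^T) 0 0).
Proof.
move=> bq dq; have cq : closure Omb y by case: bq.
have [_ [_ bO]] := sOb; have [r [U [ld Ux _]]] := chart_local_defining bO bq dq.
have nc := near_closure Omb dq.
apply: (defining_conormal (f := fun y => hs (chart_inv j y)) ld Ux).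
- exact/(chart_set_boundary _ dq).
- apply: (hd_eq _ _ _ (hd_hs cq dq)) => //.
    by apply: filterS nc => z hz cz; exact/hz.
  exact: near_all.
- by apply: filterS nc => z hz /hz /chart_setP[_ cz]; exact: (hs_le0).
- apply: filterS (near_boundary Omb dq) => z hz /hz[_ _ bz].
  by have [_ [_ h _]] := dhs; exact: h.
- exact: pairing_neq0 (dform_hs_neq0 bq dq).
Qed.

Section AtABoundaryPoint.
Variables (x0 : M) (i : chart_index M) (j : chart_index Mb).
Hypothesis bx : boundary Om x0.
Hypothesis dx : chart_dom i x0.
Hypothesis dT : chart_dom j (T t x0).
Local Notation A := (chart_set i (closure Om)).
Local Notation B := (chart_set j (closure Omb)).
Local Notation S := (chart_set i Om).
Local Notation Cxx := (mixed_xx A B (chart_cost i j)).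
Local Notation Cyx := (mixed_yx A B (chart_cost i j)).
Local Notation W x := (w_matrix Om c (u t) (T t) i x).
Local Notation y0 := (T t x0).
Local Notation p0 := (chart i x0).
Local Notation q0 := (chart j y0).
Local Notation theta := (fun z => chart j (T t (chart_inv i z))).
Local Notation dh y := (dform (closure Omb) hs j y).
Local Notation bet x := (beta Om Omb c hs (u t) i x).
Local Notation b := (bet x0).
Local Notation J := (DT Om (T t) i j x0).
Local Notation K := (Cyx (p0, q0)).
Local Notation hes := (hess_on B (fun y => hs (chart_inv j y)) q0).

Let cx : closure Om x0. Proof. by case: bx. Qed.
Let cT : closure Omb y0 := transport_closure tm cx.
Let bT : boundary Omb y0 := transport_boundary bx.
Let Ap : A p0. Proof. by exists x0. Qed.
Let Bq : B q0. Proof. by exists y0. Qed.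
Let fA : fat A p0 := cone_fat (src_cone Ap).
Let fB : fat B q0 := cone_fat (tgt_cone Bq).
Let uK : K \in unitmx := cyx_unit cx dx cT dT.
Let nd := near_transport_dom du tm cx dx dT.
Let pW : posdef (W x0) := w_posdef ht cx dx.
Let WE : W x0 = - (J *m K).
Proof. by rewrite (w_matrix_DT du tm cx dx dT) (DbDcE cx dx cT dT). Qed.
Let WT : W x0 = - (K^T *m J^T).
Proof. by rewrite -trmx_mul -linearN /= -WE; case: pW. Qed.

Variables (LK : E * E -> 'M[R]_n) (LW : E -> 'M[R]_n).
Hypothesis hLK : has_deriv_on (A `*` B) Cyx (p0, q0) LK.
Hypothesis hLW : has_deriv_on A (fun z => W (chart_inv i z)) p0 LW.

Lemma sub_boundary : \forall z \near p0, boundary S z -> A z.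
Proof.
apply: filterS (near_boundary Om dx) => z h /h[iz _ [cz _]].
exact/chart_setP.
Qed.

Lemma sub_boundary_tgt : \forall z \near q0, boundary (chart_set j Omb) z -> B z.
Proof.
apply: filterS (near_boundary Omb dT) => z h /h[iz _ [cz _]].
exact/chart_setP.
Qed.

Lemma hd_dform_hs : has_deriv_on B (fun y => dh (chart_inv j y)) q0 (fun v => v *m hes).
Proof.
have [h _] := dhs; have h2 := class_diff (h j).
have := hd_grad h2 Bq.
apply: hd_eq; first exact: near_all.
  by apply: near_all => y /chart_setP[iy _]; rewrite /dform chart_invK.
by rewrite /dform chartK.
Qed.

(** The product rule in [beta_eq], along the graph of [T]. *)
Lemma hd_beta : exists Lb : E -> E,
  has_deriv_on A (fun z => bet (chart_inv i z)) p0 Lb /\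
  forall v, Lb v *m K^T + b *m (LK (v, v *m J))^T = - (v *m J *m hes).
Proof.
have hK := hd_tr (hd_on_graph ht cx dx dT hLK).
have hT := transport_hd du tm cx dx dT.
rewrite -(DTE du tm cx dx dT) in hT.
have hd' : has_deriv_on B (fun y => dh (chart_inv j y)) (theta p0) (fun v => v *m hes).
  by rewrite /= (chartK dx); exact: hd_dform_hs.
have m1 : \forall z \near p0, A z -> B (theta z).
  apply: filterS nd => z hz Az; have {}hz := hz Az; move/chart_setP: Az => [_ cz].
  by apply/(chart_setE _ hz); exact: (transport_closure tm cz).
have hg := hd_opp (hd_comp m1 hT hd').
have uQ z : A z -> chart_dom j (T t (chart_inv i z)) -> (Cyx (z, theta z))^T \in unitmx.
  move=> /chart_setP[iz cz] dz; rewrite unitmx_tr.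
  have := cyx_unit cz (chart_inv_dom iz) (transport_closure tm cz) dz.
  by rewrite (chart_invK iz).
have dT' : chart_dom j (T t (chart_inv i p0)) by rewrite chartK.
have nQ : \forall z \near p0, A z -> (Cyx (z, theta z))^T \in unitmx.
  by apply: filterS nd => z hz Az; apply: uQ => //; exact: hz.
have [L [hL LE]] := hd_quotient fA (uQ _ Ap dT') nQ hg hK.
have be z : A z -> chart_dom j (T t (chart_inv i z)) -> bet (chart_inv i z) =
    - (dh (chart_inv j (theta z))) *m invmx (Cyx (z, theta z))^T.
  move=> Az dz; have uz := uQ _ Az dz; move/chart_setP: Az => [iz cz].
  have := beta_eq cz (chart_inv_dom iz) dz.
  by rewrite (chart_invK iz) (chartK dz) => <-; rewrite (mulmxK uz).
exists L; split.
  apply: (hd_eq _ _ _ hL); first exact: near_all.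
    by apply: filterS nd => z hz Az; apply: be => //; exact: hz.
  exact: be.
move=> v; have := LE v; rewrite /= -(be _ Ap dT') (chartK dx); exact.
Qed.

Variable Lb : E -> E.
Hypothesis hLb : has_deriv_on A (fun z => bet (chart_inv i z)) p0 Lb.
Hypothesis LbE : forall v, Lb v *m K^T + b *m (LK (v, v *m J))^T = - (v *m J *m hes).
Variables v w : E.
Hypothesis tv : tangent_to (boundary S) p0 v.
Hypothesis tw : tangent_to (boundary S) p0 w.

Let metric_w (z : E) := pullback_metric Om Omb c (T t) i j (chart_inv i z).

Let metric_wE z : A z -> chart_dom j (T t (chart_inv i z)) -> metric_w z = W (chart_inv i z).
Proof.
move=> /chart_setP[iz cz] dz.
exact: (pullback_metricE du tm cz (chart_inv_dom iz) dz).
Qed.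

Lemma metric_w0 : metric_w p0 = W x0.
Proof. by rewrite metric_wE ?chartK. Qed.

(** By [beta_dual], [beta] is a normal field for [w], to which [second_form_eval]
    applies. *)
Lemma metric_form_eval :
  bform_norm (metric_w p0) b * second_form S metric_w p0 v w =
  bform (W x0) (Lb v) w +
    2^-1 * (bform (LW v) b w + bform (LW b) v w - bform (LW w) v b).
Proof.
have bS : boundary S p0 by exact/(chart_set_boundary _ dx).
have nc := near_closure Om dx.
have dT' : chart_dom j (T t (chart_inv i p0)) by rewrite chartK.
have nn : \forall z \near p0, boundary S z ->
    unit_normal S metric_w z =
    (bform_norm (metric_w z) (bet (chart_inv i z)))^-1 *: bet (chart_inv i z) /\
    0 < bform (metric_w z) (bet (chart_inv i z)) (bet (chart_inv i z)).
  have nb := near_boundary Om dx.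
  move: nb nd; apply: filterS2 => z hb hd bz; have [iz dz bz'] := hb bz.
  have cz : closure Om (chart_inv i z) by case: bz'.
  have Az : A z by exact/chart_setP.
  have dTz := hd Az.
  have := source_conormal bz' dz dTz.
  rewrite (chart_invK iz) => cn.
  have pz : posdef (metric_w z).
    by rewrite (metric_wE Az dTz); exact: (w_posdef ht cz dz).
  have dual h : bform (metric_w z) (bet (chart_inv i z)) h =
      1 * (dh (T t (chart_inv i z)) *m (h *m DT Om (T t) i j (chart_inv i z))^T) 0 0.
    by rewrite mul1r (metric_wE Az dTz) (beta_dual h cz dz dTz).
  by have [h1 h2] := unit_normalE cn pz ltr01 dual.
have hm : has_deriv_on (closure S) metric_w p0 LW.
  apply: (hd_eq _ _ _ hLW); first by apply: filterS nc => z hz cz; exact/hz.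
    move: nc nd; apply: filterS2 => z hz hd cz; have Az : A z by exact/hz.
    by rewrite (metric_wE Az (hd Az)).
  by rewrite (metric_wE Ap dT').
have fS : fat (closure S) p0.
  by apply: fat_near fA; apply: filterS nc => z hz cz; exact/hz.
have hb : has_deriv_on (boundary S) (fun z => bet (chart_inv i z)) p0 Lb.
  by apply: (hd_eq _ _ _ hLb) => //; [exact: sub_boundary|exact: near_all].
have cn := source_conormal bx dx dT.
have [_ _ [ct _ _]] := cn.
have [_ b0] := nbhs_singleton nn bS.
have w0 : bform (metric_w p0) (bet (chart_inv i p0)) w = 0.
  rewrite metric_w0 (chartK dx) (beta_dual w cx dx dT).
  exact/ct.
have pm : posdef (metric_w p0) by rewrite metric_w0.
have n1 : \forall z \near p0, boundary S z -> unit_normal S metric_w z =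
    (bform_norm (metric_w z) (bet (chart_inv i z)))^-1 *: bet (chart_inv i z).
  by apply: filterS nn => z hz /hz[].
have := second_form_eval bS n1 hb hm fS pm b0 tv w0.
by rewrite metric_w0 (chartK dx).
Qed.

(** The conormal [beta w] of the source, pushed to its image by the Jacobian
    [- DbDc^T], is the field [nu] with [- nu DbDc = beta w], where the second
    point of [DbDc] stays fixed. At [x0] its value is [beta DT]. *)
Lemma source_image_form_eval :
  bform_norm (metric_at j y0) (b *m J) *
    second_form (image_src Omb c Om j y0) (fun=> cometric_at j y0) (- Dbc Omb c j x0 y0)
      (- (v *m DDbc Om Omb c i j x0 y0)) (- (w *m DDbc Om Omb c i j x0 y0)) =
  bform (W x0) (Lb v) w + bform (LW v) b w + bform (LK (v, 0)) (b *m J) w.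
Proof.
rewrite (DDbcE cx dx cT dT) -!mulmxN.
have hm := hd_opp (hd_mulmx hLb hLW).
have hK := hd_slice1 Bq hLK.
have uQ z : A z -> Cyx (z, q0) \in unitmx.
  move=> /chart_setP[iz cz].
  by have := cyx_unit cz (chart_inv_dom iz) cT dT; rewrite (chart_invK iz).
have nQ : \forall z \near p0, A z -> Cyx (z, q0) \in unitmx by exact: near_all.
have [Ln [hn LnE]] := hd_quotient fA uK nQ hm hK.
pose nu z := - (bet (chart_inv i z) *m W (chart_inv i z)) *m invmx (Cyx (z, q0)).
have nu0 : nu p0 = b *m J.
  by rewrite /nu (chartK dx) WE mulmxN opprK mulmxA (mulmxK uK).
have hb : has_deriv_on (boundary S) nu p0 Ln.
  by apply: (hd_eq _ _ _ hn) => //; [exact: sub_boundary|exact: near_all].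
have cn : \forall z \near p0, boundary S z ->
  conormal S z (fun v => (nu z *m (v *m phi_jac Om (fun x => - Dbc Omb c j x y0) i z)^T) 0 0).
  have nb := near_boundary Om dx.
  move: nb nd; apply: filterS2 => z hz hd bz; have [iz dz bz'] := hz bz.
  have cz : closure Om (chart_inv i z) by case: bz'.
  have Az : A z by exact/chart_setP.
  have dTz := hd Az.
  have := source_conormal bz' dz dTz.
  rewrite (chart_invK iz); apply: (conormal_scale ltr01) => e; rewrite mul1r.
  apply: (etrans _ (beta_dual e cz dz dTz)).
  have := src_jacE cz dz cT dT; rewrite (chart_invK iz) => ->.
  rewrite mulmxN linearN /= trmx_mul trmxK /nu mulmxN mulmxA (mulmxKV (uQ _ Az)).
  by rewrite !mulNmx opprK.
have := image_second_form sO (bt.2 j y0 dT cT) bx dx (cometric_posdef dT) cn hb tv tw.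
rewrite (src_jacE cx dx cT dT) /= nu0 /cometric_at invmxK => ->.
rewrite mulmxN linearN /= trmx_mul trmxK mulmxN mulmxA.
have -> : Ln v *m K = - (Lb v *m W x0 + b *m LW v) - b *m J *m LK (v, 0).
  have e : - (b *m W x0) *m invmx K = b *m J.
    by rewrite WE mulmxN opprK mulmxA (mulmxK uK).
  by have := LnE v; rewrite !(chartK dx) e => <-; rewrite addrK.
have mxD (X Y : 'M[R]_1) : (X + Y) 0 0 = X 0 0 + Y 0 0 by rewrite mxE.
by rewrite -mulNmx -opprD opprK /bform !mulmxDl !mxD.
Qed.

(** The conormal [dhs] of the target becomes the field [nu] with
    [- nu DbDc^T = dhs], where the first point of [DbDc] stays fixed; at [T x0]
    its value is [beta]. Comparing its derivative with that of [beta], which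
    solves the same equation with both points moving, leaves the variation of
    [DbDc] in the first point. *)
Lemma target_image_form_eval :
  bform_norm (metric_at i x0) b *
    second_form (image_tgt Om c Omb i x0) (fun=> cometric_at i x0) (- Dc Om c i x0 y0)
      (- (v *m J *m DbDc Om Omb c i j x0 y0)) (- (w *m J *m DbDc Om Omb c i j x0 y0)) =
  bform (W x0) (Lb v) w - bform (LK (v, 0)) (w *m J) b.
Proof.
rewrite (DbDcE cx dx cT dT) -!mulmxN.
have hK := hd_tr (hd_slice2 Ap hLK).
have hg := hd_opp hd_dform_hs.
have uQ z : B z -> (Cyx (p0, z))^T \in unitmx.
  move=> /chart_setP[iz cz]; rewrite unitmx_tr.
  by have := cyx_unit cx dx cz (chart_inv_dom iz); rewrite (chart_invK iz).
have nQ : \forall z \near q0, B z -> (Cyx (p0, z))^T \in unitmx by exact: near_all.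
have uKT : (Cyx (p0, q0))^T \in unitmx by rewrite unitmx_tr.
have [Ln [hn LnE]] := hd_quotient fB uKT nQ hg hK.
pose nu z := - dh (chart_inv j z) *m invmx (Cyx (p0, z))^T.
have nu0 : nu q0 = b.
  rewrite /nu (chartK dT).
  by have := beta_eq cx dx dT => <-; rewrite (mulmxK uKT).
have hb : has_deriv_on (boundary (chart_set j Omb)) nu q0 Ln.
  by apply: (hd_eq _ _ _ hn) => //; [exact: sub_boundary_tgt|exact: near_all].
have cn : \forall z \near q0, boundary (chart_set j Omb) z ->
  conormal (chart_set j Omb) z
    (fun v => (nu z *m (v *m phi_jac Omb (fun y => - Dc Om c i x0 y) j z)^T) 0 0).
  apply: filterS (near_boundary Omb dT) => z hz bz; have [iz dz bz'] := hz bz.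
  have cz : closure Omb (chart_inv j z) by case: bz'.
  have Bz : B z by exact/chart_setP.
  have := target_conormal bz' dz.
  rewrite (chart_invK iz); apply: (conormal_scale ltr01) => e; rewrite mul1r.
  have := tgt_jacE cx dx cz dz; rewrite (chart_invK iz) => ->.
  rewrite mulmxN linearN /= trmx_mul /nu mulmxN mulmxA (mulmxKV (uQ _ Bz)).
  by rewrite mulNmx opprK.
have push e : tangent_to (boundary S) p0 e -> tangent_to (boundary (chart_set j Omb)) q0 (e *m J).
  have hT := transport_hd du tm cx dx dT.
  rewrite -(DTE du tm cx dx dT) in hT.
  have q0E : theta p0 = q0 by rewrite /= chartK.
  move=> te; have := tangent_push _ sub_boundary hT te; rewrite q0E; apply.
  have nb := near_boundary Om dx.
  move: nb nd; apply: filterS2 => z hz hd bz; have [iz dz bz'] := hz bz.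
  have Az : A z by apply/chart_setP; split=> //; case: bz'.
  exact: (chart_transport_boundary dx (hd Az) bz').
have := image_second_form sOb (bt.1 i x0 dx cx) bT dT (cometric_posdef dx) cn hb (push v tv) (push w tw).
rewrite (tgt_jacE cx dx cT dT) /= nu0 /cometric_at invmxK => ->.
rewrite mulmxN linearN /= trmx_mul mulmxN mulmxA.
have -> : Ln (v *m J) *m K^T = Lb v *m K^T + b *m (LK (v, 0))^T.
  have e1 := LnE (v *m J); have e2 := LbE v.
  have e3 : LK (v, v *m J) = LK (v, 0) + LK (0, v *m J).
    rewrite -(linD (hd_lin hLK)); congr LK.
    exact: (f_equal2 pair (esym (addr0 v)) (esym (add0r (v *m J)))).
  rewrite -/(nu q0) nu0 in e1.
  apply: (addIr (b *m (LK (0, v *m J))^T)).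
  by rewrite e1 -addrA -mulmxDr -linearD /= -e3 e2.
rewrite mulmxDl opprD mxE; congr (_ + _).
  by rewrite /bform WT mulmxN mulNmx trmx_mul !mulmxA.
have tr1 (X : 'M[R]_1) : X 0 0 = X^T 0 0 by rewrite mxE.
by rewrite mxE; congr (- _); rewrite tr1 !trmx_mul !trmxK /bform mulmxA.
Qed.


(** The third derivatives of the potential and the pure [x] derivatives of the
    cost are symmetric and cancel. What is left comes from the motion of the
    target point. *)
Lemma hd_w_matrix_swap (LH : E -> 'M[R]_n) (LC : E * E -> 'M[R]_n) (a e d : E) :
  has_deriv_on A (hess_on A (fun y => u t (chart_inv i y))) p0 LH ->
  has_deriv_on (A `*` B) Cxx (p0, q0) LC ->
  bform (LH a + LC (a, a *m J)) e d - bform (LH d + LC (d, d *m J)) e a =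
  bform (LK (e, 0)) (a *m J) d - bform (LK (e, 0)) (d *m J) a.
Proof.
move=> hH hC; have Sz : (A `*` B) (p0, q0) by split.
have ca := @src_cone i; have cb := @tgt_cone j.
have cc := chart_cost_diff i j.
have split2 k : LC (k, k *m J) = LC (k, 0) + LC (0, k *m J).
  rewrite -(linD (hd_lin hC)); congr LC.
  exact: (f_equal2 pair (esym (addr0 k)) (esym (add0r (k *m J)))).
have bD (X Y : 'M[R]_n) k l : bform (X + Y) k l = bform X k l + bform Y k l.
  by rewrite /bform mulmxDr mulmxDl mxE.
rewrite !split2 !bD (hd_hess_swap ca a e d (du i) Ap hH).
rewrite (mixed_xx_swap ca cb cc a e d Sz hC).
rewrite (mixed_xx_yx ca cb cc (a *m J) e d Sz hC hLK).
rewrite (mixed_xx_yx ca cb cc (d *m J) e a Sz hC hLK).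
ring.
Qed.

End AtABoundaryPoint.
End AtATime.
End CostInCharts.

Lemma half_sum {R : realType} (x y p q r s : R) : p - q = r - s ->
  2 * (x + 2^-1 * (y + p - q)) = x + y + r + (x - s).
Proof. move=> h; lra. Qed.

Theorem theorem5p1 (R : realType) (n : nat) (M Mb : riemannian_manifold R n)
    (Om : set M) (Omb : set Mb) (c : M -> Mb -> R) (alpha : R)
    (rho : M -> R) (rhos : Mb -> R) (hs : Mb -> R)
    (tmax : R) (u : R -> M -> R) (T : R -> M -> Mb)
    (t : R) (x0 : M) (i : chart_index M) (j : chart_index Mb)
    (tau1 tau2 : 'rV[R]_n) :
  smooth_bounded_domain Om -> smooth_bounded_domain Omb ->
  0 < alpha <= 1 -> cost_Ckalpha Om Omb c 4 alpha -> bi_twist Om Omb c ->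
  density_on Om rho -> density_on Omb rhos -> equal_mass Om Omb rho rhos ->
  defining_function Omb hs ->
  initial_condition Om Omb c alpha hs (u 0) (T 0) ->
  parabolic_solution Om Omb c rho rhos hs tmax u T ->
  0 <= t < tmax ->
  boundary Om x0 -> chart_dom i x0 -> chart_dom j (T t x0) ->
  tangent_to (boundary (chart_set i Om)) (chart i x0) tau1 ->
  tangent_to (boundary (chart_set i Om)) (chart i x0) tau2 ->
  let y0 := T t x0 in
  let w (z : 'rV[R]_n) := pullback_metric Om Omb c (T t) i j (chart_inv i z) in
  let b := beta Om Omb c hs (u t) i x0 in
  let DT0 := DT Om (T t) i j x0 in
  let hat tau := - (tau *m DDbc Om Omb c i j x0 y0) in
  let hatb tau := - (tau *m DT0 *m DbDc Om Omb c i j x0 y0) in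
  2 * bform_norm (w (chart i x0)) b *
    second_form (chart_set i Om) w (chart i x0) tau1 tau2 =
  bform_norm (metric_at j y0) (b *m DT0) *
    second_form (image_src Omb c Om j y0) (fun=> cometric_at j y0)
      (- Dbc Omb c j x0 y0) (hat tau1) (hat tau2) +
  bform_norm (metric_at i x0) b *
    second_form (image_tgt Om c Omb i x0) (fun=> cometric_at i x0)
      (- Dc Om c i x0 y0) (hatb tau1) (hatb tau2).
Proof.
move=> sO sOb _ cC bt drho drhos _ dhs ic ps ht bx dx dT tv tw y0 w b DT0 hat hatb.
have cx : closure Om x0 by case: bx.
have tm := solution_transport ps ht.
have cT := transport_closure tm cx.
have Sz : (chart_set i (closure Om) `*` chart_set j (closure Omb)) (chart i x0, chart j y0).
  by split; [exists x0|exists y0].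
have ca := @src_cone _ _ _ _ sO i; have cb := @tgt_cone _ _ _ _ sOb j.
have cc := chart_cost_diff cC i j.
have [LH [LC [hH hC hW]]] := hd_w_matrix sO sOb cC bt ps ht cx dx dT.
have [LK [hK _]] := hd_mixed_yx ca cb cc Sz.
have [Lb [hb LbE]] := hd_beta sO sOb cC bt dhs ps ht bx dx dT hK.
rewrite -mulrA (metric_form_eval sO sOb cC bt drho drhos dhs ic ps ht bx dx dT hW hb tv tw).
have eS := source_image_form_eval sO sOb cC bt drho drhos dhs ic ps ht bx dx dT hK hW hb tv tw.
have eT := target_image_form_eval sO sOb cC bt drho drhos dhs ic ps ht bx dx dT hK LbE tv tw.
apply: (etrans _ (congr2 +%R (esym eS) (esym eT))).
apply: half_sum.
exact: (hd_w_matrix_swap sO sOb cC ps ht bx dx dT hK _ tau1 tau2 hH hC).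
Qed.
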